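(* Let $\varphi_1,\varphi_2\in B_\omega$ be defined by $\widehat{\varphi_1}=\chi_{[-\omega,\omega]}$ and $\widehat{\varphi_2}=-i\,\chi_{[-\omega,\omega]}\,\mathrm{sign}$, and let $\Phi=(\varphi_1,\varphi_2)$. If $\omega\le h<2\omega$ then $E_{\Phi,t_o}$ is a tight frame for $B_\omega$, and the dual generators are $\varphi_i^*=(2h)^{-1}\varphi_i$ for $i=1,2$. If $h=\omega$ then $E_{\Phi,t_o}$ is a Riesz basis for $B_\omega$. Moreover, for every $f\in B_\omega$ the following Hilbert transform sampling formula holds: $$f(x)=\frac{\omega}{h}\sum_{k\in\mathbb Z}\Big(f(kt_o)\cos\big(\tfrac{\omega (x-kt_o)}{2}\big)\,\mathrm{sinc}\big(\tfrac{\omega (x-kt_o)}{2}\big)-(\mathcal Hf)(kt_o)\,\sin\big(\tfrac{\omega (x-kt_o)}{2}\big)\,\mathrm{sinc}\big(\tfrac{\omega (x-kt_o)}{2}\big)\Big).$$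
   Context: Conventions: $\mathcal Ff(\xi)=\hat f(\xi)=\frac{1}{\sqrt{2\pi}}\int f(t)e^{-it\xi}\,dt$ (extended to $L^2(\mathbb R)$); $\tau_a f(x)=f(x+a)$; $\mathrm{sinc}(x)=\sin(x)/x$ (with value $1$ at $0$); $\mathcal Hf=-i\,\mathcal F^{-1}(\mathrm{sign}\cdot\mathcal Ff)$ is the Hilbert transform. Fix $\omega>0$ and $B_\omega=\{f\in L^2(\mathbb R):\operatorname{supp}\hat f\subset[-\omega,\omega]\}$ (its elements are identified with their continuous representatives); $t_o>0$ and $h=2\pi/t_o$. $E_{\Phi,t_o}=\{\tau_{nt_o}\varphi_j:n\in\mathbb Z,\ j=1,2\}$ is a frame for $B_\omega$ if there are $0<A\le B$ with $A\|f\|^2\le\sum_j\sum_n|\langle f,\tau_{nt_o}\varphi_j\rangle|^2\le B\|f\|^2$ for all $f\in B_\omega$; it is tight if one can take $A=B$; it is a Riesz basis if moreover $c\mapsto\sum_j\sum_nc_j(n)\tau_{nt_o}\varphi_j$ is injective on $\ell^2(\mathbb Z;\mathbb C^2)$. The dual generators of a frame are $\varphi_j^*=S^{-1}\varphi_j$, where $Sf=\sum_j\sum_n\langle f,\tau_{nt_o}\varphi_j\rangle\tau_{nt_o}\varphi_j$ is the frame operator on $B_\omega$. The sampling formula is the frame expansion $f=\sum_j\sum_n\langle f,\tau_{nt_o}\varphi_j\rangle\tau_{nt_o}\varphi_j^*$, with convergence in $L^2(\mathbb R)$, for $\omega\le h<2\omega$. *)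

(* Defs.v *)
From HB Require Import structures.
From mathcomp Require Import all_boot all_order all_algebra finmap.
From mathcomp Require Export complex.
From mathcomp Require Import all_classical all_reals all_analysis.
From mathcomp Require Import showcase.summability.

Set Implicit Arguments.
Unset Strict Implicit.
Unset Printing Implicit Defensive.

Import Order.TTheory GRing.Theory Num.Theory.
Import numFieldNormedType.Exports.

Local Open Scope classical_set_scope.
Local Open Scope ring_scope.
Local Open Scope complex_scope.

Section ComplexL2.
Context {R : realType}.
Notation mu := (@lebesgue_measure R).
Implicit Types (f g : R -> R[i]) (x xi : R).

Definition cmeasurable f : Prop :=
  measurable_fun [set: R] (fun x => complex.Re (f x)) /\
  measurable_fun [set: R] (fun x => complex.Im (f x)).

Definition cintegral f : R[i] :=
  (\int[mu]_x complex.Re (f x)) +i* (\int[mu]_x complex.Im (f x)).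

Definition cLnorm (p : \bar R) f : \bar R :=
  'N[mu]_p [(fun x => (Normc.normc (f x))%:E)]%E.

Definition cLspace (p : \bar R) f : Prop :=
  cmeasurable f /\ (cLnorm p f < +oo)%E.

Definition inner f g : R[i] := cintegral (fun x => f x * ((g x)^*)%C).

(* [F] is the sum of the family [u], with unconditional convergence in L^2:
   the finite partial sums converge to [F] along the directed set of finite
   sets of indices. *)
Definition L2_sum (I : choiceType) (u : I -> R -> R[i]) (F : R -> R[i]) : Prop :=
  cLspace 2%:E F /\
  (fun J : {fset I} => cLnorm 2%:E (fun x => F x - \sum_(i <- J) u i x))
    @ totally --> 0%E.

(* The support of an element of L^2, i.e. of a class of functions modulo
   almost everywhere equality: the complement of the largest open set on which
   [f] vanishes almost everywhere. *)
Definition ess_supp f : set R :=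
  [set x | forall U, nbhs x U -> ~ {ae mu, forall y, U y -> f y = 0}].

Definition expi x : R[i] := cos x +i* sin x.

Definition fourier_integral f xi : R[i] :=
  ((Num.sqrt (2 * pi))^-1)%:C * cintegral (fun t => f t * expi (- (t * xi))).

(* [g] represents the Fourier transform of [f] in L^2, defined by continuous
   extension from the intersection of L^1 and L^2. The transform is a relation
   because it is only determined up to almost everywhere equality. *)
Definition is_fourier f g : Prop :=
  [/\ cLspace 2%:E f, cLspace 2%:E g &
    exists f_ : nat -> R -> R[i],
      [/\ forall n, cLspace 1 (f_ n) /\ cLspace 2%:E (f_ n),
          (fun n => cLnorm 2%:E (fun x => f_ n x - f x)) @ \oo --> 0%E &
          (fun n => cLnorm 2%:E (fun xi => fourier_integral (f_ n) xi - g xi))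
            @ \oo --> 0%E]].

(* The inverse transform of [sign * fh] is a [v] whose transform is
   [sign * fh]. *)
Definition is_hilbert f g : Prop :=
  exists fh v : R -> R[i],
    [/\ is_fourier f fh,
        is_fourier v (fun xi => (Num.sg xi)%:C * fh xi) &
        forall x, g x = - 'i%C * v x].

(* The continuous representative of the Hilbert transform (unique when it
   exists, as it does for band-limited [f]). *)
Definition hilbert f : R -> R[i] :=
  xget (fun=> 0) [set g | continuous (g : R -> R[i]^o) /\ is_hilbert f g].

(* Elements are identified with their continuous representatives, so that this
   is a set of functions rather than of classes. *)
Definition bandlimited (w : R) : set (R -> R[i]) :=
  [set f | [/\ continuous (f : R -> R[i]^o), cLspace 2%:E f &
     exists2 fh, is_fourier f fh & ess_supp fh `<=` `[- w, w]]].

Definition translate (a : R) f : R -> R[i] := fun x => f (x + a).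

Definition sinc x : R := if x == 0 then 1 else sin x / x.

Section Frames.
Variables (w t0 : R) (m : nat) (Phi : m.-tuple (R -> R[i])).

Definition shift (j : 'I_m) (n : int) : R -> R[i] :=
  translate (n%:~R * t0) (tnth Phi j).

Definition frame_bounds (A B : R) : Prop :=
  forall f, bandlimited w f ->
    (A%:E * cLnorm 2%:E f ^+ 2 <=
      \sum_(j < m)
        \esum_(n in [set: int]) (Normc.normc (inner f (shift j n)) ^+ 2)%:E <=
      B%:E * cLnorm 2%:E f ^+ 2)%E.

Definition frame : Prop :=
  exists A B : R, 0 < A /\ A <= B /\ frame_bounds A B.

Definition tight_frame : Prop :=
  exists A : R, 0 < A /\ frame_bounds A A.

Definition l2 (c : 'I_m -> int -> R[i]) : Prop :=
  (\sum_(j < m) \esum_(n in [set: int]) (Normc.normc (c j n) ^+ 2)%:E < +oo)%E.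

Definition is_synthesis (c : 'I_m -> int -> R[i]) (F : R -> R[i]) : Prop :=
  L2_sum (fun (i : 'I_m * int) x => c i.1 i.2 * shift i.1 i.2 x) F.

(* Synthesis takes its values in L^2; two sequences have the same image when
   they have a common sum [F]. *)
Definition riesz_basis : Prop :=
  frame /\
  forall c d, l2 c -> l2 d ->
    forall F, is_synthesis c F -> is_synthesis d F -> c = d.

Definition frame_operator f : R -> R[i] :=
  xget (fun=> 0)
    [set F | bandlimited w F /\
             is_synthesis (fun j n => inner f (shift j n)) F].

Definition dual_generator (j : 'I_m) : R -> R[i] :=
  xget (fun=> 0)
    [set g | bandlimited w g /\ frame_operator g = tnth Phi j].

End Frames.

End ComplexL2.

(* Main.v *)
Require Import Defs.
From mathcomp Require Import all_boot all_order all_algebra finmap.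
From mathcomp Require Import complex.
From mathcomp Require Import all_classical all_reals all_analysis.
From mathcomp Require Import measurable_realfun showcase.summability.
From mathcomp Require Import ring lra.

Set Implicit Arguments.
Unset Strict Implicit.
Unset Printing Implicit Defensive.

Import Order.TTheory GRing.Theory Num.Theory.
Import numFieldNormedType.Exports.

Local Open Scope classical_set_scope.
Local Open Scope ring_scope.
Local Open Scope complex_scope.

(* A function of the Paley-Wiener space is [inv_fourier g] with [g] in L^2
   supported in [-w, w], and Plancherel's identity turns its inner products with
   the translates of [phi1] and [phi2] into the Fourier coefficients, of step
   [t0], of [g] and of the transform [- 'i sign g] of its Hilbert transform.
   Write [g = p + m] with [p] and [m] supported in [0, w] and [-w, 0]: the two
   coefficients of index [n] are [a + b] and [- 'i (a - b)] up to sign, where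
   [a] and [b] are those of [p] and [m], so their squared moduli add up to
   [2 |a|^2 + 2 |b|^2]. As [w <= h = 2 pi / t0], both [p] and [m] live on an
   interval of length [h], and Parseval's identity gives tightness with bound
   [2 h].
   Tightness bounds the distance from [2 h f] to a finite partial sum of the
   frame expansion by the missing part of the sum of squares; this yields the
   frame operator [2 h], the dual generators, and, after computing the two
   kernels, the sampling formula. If [h = w] each element of the frame has
   squared norm [2 h], equal to the frame bound, which forces orthogonality.
   Behind Parseval is the completeness of the exponentials: the bounded functions
   in their closed span form an algebra stable under bounded limits, and powers
   turn a cosine into the indicator of an arc, hence of an interval. *)

(** * Complex numbers, integrals and square integrable functions *)

(** The transform on L^2 is only a relation, given by approximations in L^1 and L^2. It stays
    tractable because one side always has bounded support: for a square integrable [g] supported in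
    [[- v, v]], the integral [inv_fourier g] converges absolutely and is continuous, and for every
    [f] in both spaces the squared distances from [fourier_integral f] to [g] and from [f] to
    [inv_fourier g] bound each other up to a factor 4. So the transform of [f] is [g] exactly when
    [f] is [inv_fourier g], almost everywhere, and this takes the place of an inversion theorem on
    all of L^2. In the bound [2 * h], the factor [h] is the length of the period in Parseval's
    identity and 2 comes from the parallelogram law. The factor [w / h] of the sampling formula is
    [2 * w], from the kernels, divided by [2 * h]. A redundant tight frame offers no orthogonality
    for computing partial sums. An inequality replaces it: a finite combination has squared norm at
    most the frame bound times the sum of the squared coefficients, by a weighted Young inequality
    absorbed through tightness. *)

Section ComplexParts.
Context {R : realType}.
Implicit Types (z u : R[i]) (a : R).

Lemma complexP z u : complex.Re z = complex.Re u -> complex.Im z = complex.Im u -> z = u.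
Proof. by case: z => ? ?; case: u => ? ? /= -> ->. Qed.

Lemma cReD z u : complex.Re (z + u) = complex.Re z + complex.Re u.
Proof. by case: z; case: u. Qed.

Lemma cImD z u : complex.Im (z + u) = complex.Im z + complex.Im u.
Proof. by case: z; case: u. Qed.

Lemma cReN z : complex.Re (- z) = - complex.Re z.
Proof. by case: z. Qed.

Lemma cImN z : complex.Im (- z) = - complex.Im z.
Proof. by case: z. Qed.

Lemma cReM z u : complex.Re (z * u) =
  complex.Re z * complex.Re u - complex.Im z * complex.Im u.
Proof. by case: z; case: u. Qed.

Lemma cImM z u : complex.Im (z * u) =
  complex.Re z * complex.Im u + complex.Im z * complex.Re u.
Proof. by case: z; case: u. Qed.

Lemma cReJ z : complex.Re (z^*)%C = complex.Re z.
Proof. by case: z. Qed.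

Lemma cImJ z : complex.Im (z^*)%C = - complex.Im z.
Proof. by case: z. Qed.

Lemma cReR a : complex.Re a%:C = a. Proof. by []. Qed.
Lemma cImR a : complex.Im a%:C = 0. Proof. by []. Qed.
Lemma Re_expi a : complex.Re (expi a) = cos a. Proof. by []. Qed.
Lemma Im_expi a : complex.Im (expi a) = sin a. Proof. by []. Qed.
Lemma Rei : complex.Re ('i%C : R[i]) = 0. Proof. by []. Qed.
Lemma Imi : complex.Im ('i%C : R[i]) = 1. Proof. by []. Qed.

Definition reimE := (cReD, cImD, cReN, cImN, cReM, cImM, cReJ, cImJ, cReR, cImR,
  Re_expi, Im_expi, Rei, Imi).

Lemma Re_sum (I : Type) (s : seq I) (P : pred I) (F : I -> R[i]) :
  complex.Re (\sum_(i <- s | P i) F i) = \sum_(i <- s | P i) complex.Re (F i).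
Proof. exact: (big_morph (@complex.Re R) cReD (erefl _)). Qed.

(** The squared modulus as a real polynomial in the two parts, so that [ring] and [nra] apply to
    it. *)
Definition sqc z : R := complex.Re z ^+ 2 + complex.Im z ^+ 2.

Lemma sqc_ge0 z : 0 <= sqc z.
Proof. by rewrite addr_ge0 ?sqr_ge0. Qed.

Lemma sqc0 : sqc 0 = 0. Proof. by rewrite /sqc !reimE expr0n addr0. Qed.

Lemma sqc_eq0 z : (sqc z == 0) = (z == 0).
Proof.
apply/idP/eqP => [|->]; last by rewrite sqc0.
rewrite paddr_eq0 ?sqr_ge0// !sqrf_eq0 => /andP[/eqP r /eqP i].
exact: complexP.
Qed.

Lemma sqcM z u : sqc (z * u) = sqc z * sqc u.
Proof. by rewrite /sqc !reimE; ring. Qed.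

Lemma sqcJ z : sqc (z^*)%C = sqc z.
Proof. by rewrite /sqc !reimE sqrrN. Qed.

Lemma sqcN z : sqc (- z) = sqc z.
Proof. by rewrite /sqc !reimE !sqrrN. Qed.

Lemma sqcR a : sqc a%:C = a ^+ 2.
Proof. by rewrite /sqc !reimE expr0n addr0. Qed.

Lemma sqc_expi a : sqc (expi a) = 1.
Proof. by rewrite /sqc !reimE cos2Dsin2. Qed.

Lemma sqc_i : sqc 'i%C = 1.
Proof. by rewrite /sqc !reimE; ring. Qed.

Lemma sqcD z u : sqc (z + u) <= 2 * sqc z + 2 * sqc u.
Proof.
rewrite /sqc !reimE.
have := sqr_ge0 (complex.Re z - complex.Re u).
have := sqr_ge0 (complex.Im z - complex.Im u).
nra.
Qed.

Lemma normc_sq z : Normc.normc z ^+ 2 = sqc z.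
Proof. by case: z => a b; rewrite /= sqr_sqrtr// addr_ge0 ?sqr_ge0. Qed.

Lemma normcE2 z : Normc.normc z = Num.sqrt (sqc z).
Proof. by case: z. Qed.

Lemma normc_ge0 z : 0 <= Normc.normc z.
Proof. by rewrite normcE2 sqrtr_ge0. Qed.

Lemma mulcJ z : z * (z^*)%C = (sqc z)%:C.
Proof. by apply: complexP; rewrite !reimE /sqc; ring. Qed.

Lemma le_Re_normc z : `|complex.Re z| <= Normc.normc z.
Proof. by rewrite normcE2 -sqrtr_sqr ler_sqrt ?lerDl ?sqr_ge0 ?sqc_ge0. Qed.

Lemma le_Im_normc z : `|complex.Im z| <= Normc.normc z.
Proof. by rewrite normcE2 -sqrtr_sqr ler_sqrt ?lerDr ?sqr_ge0 ?sqc_ge0. Qed.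

Lemma normc_le_ReIm z : Normc.normc z <= `|complex.Re z| + `|complex.Im z|.
Proof.
rewrite -(ler_pXn2r (n := 2)) ?nnegrE ?normc_ge0 ?addr_ge0//.
rewrite normc_sq /sqc -(real_normK (num_real (complex.Re z))).
rewrite -(real_normK (num_real (complex.Im z))).
have := normr_ge0 (complex.Re z); have := normr_ge0 (complex.Im z); nra.
Qed.

Lemma expiD a b : expi (a + b) = expi a * expi b.
Proof. by apply: complexP; rewrite !reimE ?cosD ?sinD //; ring. Qed.

Lemma expi0 : expi (0 : R) = 1.
Proof. by apply: complexP; rewrite !reimE ?cos0 ?sin0. Qed.

Lemma expiJ a : ((expi a)^*)%C = expi (- a).
Proof. by apply: complexP; rewrite !reimE ?cosN ?sinN. Qed.

Lemma ReZ a z : complex.Re (a%:C * z) = a * complex.Re z.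
Proof. by rewrite !reimE mul0r subr0. Qed.

Lemma ImZ a z : complex.Im (a%:C * z) = a * complex.Im z.
Proof. by rewrite !reimE mul0r addr0. Qed.

Lemma complex_algE z : z = (complex.Re z)%:C + 'i%C * (complex.Im z)%:C.
Proof. by case: z => a b; apply: complexP; simpc. Qed.

Lemma conjcD z u : ((z + u)^*)%C = (z^*)%C + (u^*)%C.
Proof. exact: rmorphD. Qed.

Lemma conjcB z u : ((z - u)^*)%C = (z^*)%C - (u^*)%C.
Proof. exact: rmorphB. Qed.

Lemma conjcM z u : ((z * u)^*)%C = (z^*)%C * (u^*)%C.
Proof. exact: rmorphM. Qed.

Lemma conjc_sum (I : Type) (s : seq I) (F : I -> R[i]) :
  ((\sum_(i <- s) F i)^*)%C = \sum_(i <- s) ((F i)^*)%C.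
Proof. exact: rmorph_sum. Qed.

Lemma rcD a b : (a + b)%:C = a%:C + b%:C :> R[i]. Proof. exact: rmorphD. Qed.

Lemma rcB a b : (a - b)%:C = a%:C - b%:C :> R[i]. Proof. exact: rmorphB. Qed.

Lemma rcM a b : (a * b)%:C = a%:C * b%:C :> R[i]. Proof. exact: rmorphM. Qed.

End ComplexParts.

Section Measurability.
Context {R : realType}.
Implicit Types (f g : R -> R[i]).

Lemma cmeasD f g : cmeasurable f -> cmeasurable g -> cmeasurable (fun x => f x + g x).
Proof.
move=> [fr fi] [gr gi]; split; under eq_fun do rewrite !reimE; exact: measurable_funD.
Qed.

Lemma cmeasN f : cmeasurable f -> cmeasurable (fun x => - f x).
Proof.
by move=> [fr fi]; split; under eq_fun do rewrite !reimE; exact: measurableT_comp.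
Qed.

Lemma cmeasB f g : cmeasurable f -> cmeasurable g -> cmeasurable (fun x => f x - g x).
Proof. by move=> ? ?; apply: cmeasD => //; exact: cmeasN. Qed.

Lemma cmeasM f g : cmeasurable f -> cmeasurable g -> cmeasurable (fun x => f x * g x).
Proof.
move=> [fr fi] [gr gi]; split; under eq_fun do rewrite !reimE.
  by apply: measurable_funB; exact: measurable_funM.
by apply: measurable_funD; exact: measurable_funM.
Qed.

Lemma cmeasJ f : cmeasurable f -> cmeasurable (fun x => (f x)^*%C).
Proof.
move=> [fr fi]; split; first by under eq_fun do rewrite !reimE.
by under eq_fun do rewrite !reimE; exact: measurableT_comp.
Qed.

Lemma cmeas_cst (z : R[i]) : cmeasurable (fun=> z : R[i]).
Proof. by split; exact: measurable_cst. Qed.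

Lemma cmeasR (r : R -> R) : measurable_fun setT r -> cmeasurable (fun x => (r x)%:C).
Proof. by move=> mr; split => //=; exact: measurable_cst. Qed.

Lemma cmeas_indic (A : set R) : measurable A -> cmeasurable (fun x => (\1_A x : R)%:C).
Proof. by move=> mA; apply: cmeasR; exact: measurable_indic. Qed.

Lemma cmeas_expi (r : R -> R) : measurable_fun setT r -> cmeasurable (fun x => expi (r x)).
Proof.
move=> mr; split => /=.
  by apply: measurableT_comp => //; apply: continuous_measurable_fun; exact: continuous_cos.
by apply: measurableT_comp => //; apply: continuous_measurable_fun; exact: continuous_sin.
Qed.

Lemma cmeas_sqc f : cmeasurable f -> measurable_fun setT (fun x => sqc (f x)).
Proof.
by move=> [fr fi]; apply: measurable_funD; exact: measurable_funX.
Qed.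

Lemma cmeas_normc f : cmeasurable f -> measurable_fun setT (fun x => Normc.normc (f x)).
Proof.
move=> mf; under eq_fun do rewrite normcE2.
have msqrt : measurable_fun setT (@Num.sqrt R : R -> R).
  by apply: continuous_measurable_fun; exact: sqrt_continuous.
exact: (measurableT_comp msqrt (cmeas_sqc mf)).
Qed.

End Measurability.

Section RealIntegral.
Context {d : measure_display} {T : measurableType d} {R : realType}.
Variable mu : {measure set T -> \bar R}.
Implicit Types (f g : T -> R) (a : R).

Definition rint f := mu.-integrable setT (EFin \o f).
Definition rintegral f : R := (\int[mu]_x f x)%R.

Lemma rint_meas f : rint f -> measurable_fun setT f.
Proof. by move=> /integrableP[/measurable_EFinP]. Qed.

Lemma rint0 : rint (fun=> 0).
Proof. exact: integrable0. Qed.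

Lemma rintD f g : rint f -> rint g -> rint (fun x => f x + g x).
Proof. by move=> rf rg; have := integrableD measurableT rf rg. Qed.

Lemma rintN f : rint f -> rint (fun x => - f x).
Proof. by move=> rf; have := integrableN rf. Qed.

Lemma rintB f g : rint f -> rint g -> rint (fun x => f x - g x).
Proof. by move=> rf rg; apply: rintD => //; exact: rintN. Qed.

Lemma rintZ a f : rint f -> rint (fun x => a * f x).
Proof. by move=> rf; have := integrableZl measurableT a rf. Qed.

Lemma rint_le f g : measurable_fun setT f -> (forall x, `|f x| <= g x) ->
  rint g -> rint f.
Proof.
move=> mf fg; apply: le_integrable => //; first exact/measurable_EFinP.
by move=> x _ /=; rewrite lee_fin (le_trans (fg x))// ler_norm.
Qed.

Lemma rint_norm f : rint f -> rint (fun x => `|f x|).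
Proof. exact: integrable_norm. Qed.

Lemma rintegralD f g : rint f -> rint g ->
  rintegral (fun x => f x + g x) = rintegral f + rintegral g.
Proof. exact: RintegralD. Qed.

Lemma rintegralB f g : rint f -> rint g ->
  rintegral (fun x => f x - g x) = rintegral f - rintegral g.
Proof. exact: RintegralB. Qed.

Lemma rintegralZ a f : rint f -> rintegral (fun x => a * f x) = a * rintegral f.
Proof. exact: RintegralZl. Qed.

Lemma rintegral0 : rintegral (fun=> 0) = 0.
Proof. by rewrite /rintegral /Rintegral integral0. Qed.

Lemma rintegralN f : rint f -> rintegral (fun x => - f x) = - rintegral f.
Proof.
move=> rf; under eq_fun do rewrite -mulN1r.
by rewrite rintegralZ// mulN1r.
Qed.

Lemma rintegral_ge0 f : (forall x, 0 <= f x) -> 0 <= rintegral f.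
Proof. by move=> f0; apply: Rintegral_ge0. Qed.

Lemma le_rintegral f g : rint f -> rint g -> (forall x, f x <= g x) ->
  rintegral f <= rintegral g.
Proof. by move=> ? ? ?; exact: le_Rintegral. Qed.

Lemma rintegralE f : rint f -> (\int[mu]_x (f x)%:E)%E = (rintegral f)%:E.
Proof. by move=> rf; rewrite fineK//; exact: integrable_fin_num. Qed.

Lemma rint_ge0P f : measurable_fun setT f -> (forall x, 0 <= f x) ->
  rint f <-> (\int[mu]_x (f x)%:E < +oo)%E.
Proof.
move=> mf f0; split => [/integrableP[_]|fi].
  by under eq_integral do rewrite /= ger0_norm//.
apply/integrableP; split; first exact/measurable_EFinP.
by under eq_integral do rewrite /= ger0_norm//.
Qed.

Lemma rint_indic (A : set T) : measurable A -> (mu A < +oo)%E -> rint (\1_A).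
Proof.
by move=> mA fA; apply/rint_ge0P => //; rewrite integral_indic// setIT.
Qed.

Lemma rintegral_indic (A : set T) : measurable A -> rintegral (\1_A) = fine (mu A).
Proof. by move=> mA; rewrite /rintegral /Rintegral integral_indic// setIT. Qed.

Lemma rintegral_ae f g : measurable_fun setT f -> measurable_fun setT g ->
  {ae mu, forall x, f x = g x} -> rintegral f = rintegral g.
Proof.
move=> mf mg fg; congr fine; apply: ae_eq_integral => //; try exact/measurable_EFinP.
by apply: filterS fg => x /= ->.
Qed.

Lemma rintegral_dct (f_ : nat -> T -> R) f g :
  (forall n, measurable_fun setT (f_ n)) -> measurable_fun setT f ->
  (forall x, f_ ^~ x @ \oo --> f x) ->
  rint g -> (forall n x, `|f_ n x| <= g x) ->
  (fun n => rintegral (f_ n)) @ \oo --> rintegral f.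
Proof.
move=> mf_ mf cf rg fg.
have [] := @dominated_convergence _ _ _ mu setT measurableT
  (fun n x => (f_ n x)%:E) (fun x => (f x)%:E) (fun x => (g x)%:E).
- by move=> n; exact/measurable_EFinP.
- exact/measurable_EFinP.
- by apply: nearW => x _; apply: cvg_EFin; [exact: nearW|exact: cf].
- exact: rg.
- by apply: nearW => x n _; rewrite lee_fin.
move=> rf _; rewrite rintegralE//; move=> /fine_cvgP[_].
exact.
Qed.

Lemma rintegral_eq0 f : rint f -> (forall x, 0 <= f x) -> rintegral f = 0 ->
  {ae mu, forall x, f x = 0}.
Proof.
move=> rf f0 i0.
have mf : measurable_fun setT (fun x => (f x)%:E).
  by apply/measurable_EFinP; exact: rint_meas.
have [+ _] := ae_eq_integral_abs mu measurableT mf.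
under eq_integral do rewrite /= ger0_norm//.
rewrite rintegralE// i0 => /(_ erefl); apply: filterS => x /= /(_ I).
by case.
Qed.

End RealIntegral.

Arguments cintegral : simpl never.
Arguments inner : simpl never.
Arguments expi : simpl never.
Section AlmostEverywhere.
Context {R : realType}.
Notation mu := (@lebesgue_measure R).

Lemma ae_imp (P Q : R -> Prop) : (forall x, P x -> Q x) ->
  {ae mu, forall x, P x} -> {ae mu, forall x, Q x}.
Proof. by move=> PQ; apply: (@filterS _ _ (ae_filter_ringOfSetsType mu)). Qed.

End AlmostEverywhere.

Section ComplexIntegral.
Context {R : realType}.
Notation mu := (@lebesgue_measure R).
Implicit Types (f g u v : R -> R[i]) (z : R[i]) (a b : R).

Record cint f : Prop := Cint {
  cint_Re : rint mu (fun x => complex.Re (f x));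
  cint_Im : rint mu (fun x => complex.Im (f x)) }.

Lemma cint_meas f : cint f -> cmeasurable f.
Proof. by move=> [rf jf]; split; [exact: (rint_meas rf)|exact: (rint_meas jf)]. Qed.

Lemma cintD f g : cint f -> cint g -> cint (fun x => f x + g x).
Proof. by move=> [? ?] [? ?]; split; under eq_fun do rewrite reimE; exact: rintD. Qed.

Lemma cintZ z f : cint f -> cint (fun x => z * f x).
Proof.
move=> [? ?]; split; under eq_fun do rewrite reimE.
  by apply: rintB; exact: rintZ.
by apply: rintD; exact: rintZ.
Qed.

Lemma cintN f : cint f -> cint (fun x => - f x).
Proof. by move=> /(cintZ (-1)); under eq_fun do rewrite mulN1r. Qed.

Lemma cintB f g : cint f -> cint g -> cint (fun x => f x - g x).
Proof. by move=> ? ?; apply: cintD => //; exact: cintN. Qed.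

Lemma cintJ f : cint f -> cint (fun x => (f x)^*%C).
Proof.
move=> [? ?]; split; first by under eq_fun do rewrite reimE.
by under eq_fun do rewrite reimE; exact: rintN.
Qed.

Lemma cint0 : cint (fun=> 0).
Proof. by split; exact: rint0. Qed.

Lemma cint_sum (I : Type) (s : seq I) (F : I -> R -> R[i]) :
  (forall i, cint (F i)) -> cint (fun x => \sum_(i <- s) F i x).
Proof.
move=> iF; elim: s => [|i s IHs].
  by under eq_fun do rewrite big_nil; exact: cint0.
by under eq_fun do rewrite big_cons; exact: cintD.
Qed.

Lemma cint_le f (g : R -> R) : cmeasurable f ->
  (forall x, Normc.normc (f x) <= g x) -> rint mu g -> cint f.
Proof.
move=> [mr mi] fg rg; split; apply: rint_le rg => // x; apply: le_trans (fg x).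
  exact: le_Re_normc.
exact: le_Im_normc.
Qed.

Lemma cint_normc f : cint f -> rint mu (fun x => Normc.normc (f x)).
Proof.
move=> cf; have [rf jf] := cf.
apply: rint_le (rintD (rint_norm rf) (rint_norm jf)).
  by apply: cmeas_normc; exact: cint_meas.
by move=> x; rewrite ger0_norm ?normc_ge0// normc_le_ReIm.
Qed.

Lemma cintegralE f :
  cintegral f = rintegral mu (fun x => complex.Re (f x)) +i*
                rintegral mu (fun x => complex.Im (f x)).
Proof. by []. Qed.

Lemma Re_cintegral f :
  complex.Re (cintegral f) = rintegral mu (fun x => complex.Re (f x)).
Proof. by []. Qed.

Lemma Im_cintegral f :
  complex.Im (cintegral f) = rintegral mu (fun x => complex.Im (f x)).
Proof. by []. Qed.

Lemma cintegralD f g : cint f -> cint g ->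
  cintegral (fun x => f x + g x) = cintegral f + cintegral g.
Proof.
move=> [? ?] [? ?]; apply: complexP; rewrite (cReD, cImD).
  by rewrite !Re_cintegral -rintegralD//; under eq_fun do rewrite reimE.
by rewrite !Im_cintegral -rintegralD//; under eq_fun do rewrite reimE.
Qed.

Lemma cintegralZ z f : cint f ->
  cintegral (fun x => z * f x) = z * cintegral f.
Proof.
move=> [? ?]; apply: complexP; rewrite ?cReM ?cImM !(Re_cintegral, Im_cintegral).
  rewrite -!rintegralZ// -rintegralB; [|exact: rintZ..].
  by under eq_fun do rewrite cReM.
rewrite -!rintegralZ// -rintegralD; [|exact: rintZ..].
by under eq_fun do rewrite cImM.
Qed.

Lemma cintegralJ f : cint f -> cintegral (fun x => (f x)^*%C) = (cintegral f)^*%C.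
Proof.
move=> [? ?]; apply: complexP; rewrite (cReJ, cImJ) !(Re_cintegral, Im_cintegral).
  by under eq_fun do rewrite reimE.
by under eq_fun do rewrite reimE; rewrite rintegralN.
Qed.

Lemma cintegral0 : cintegral (fun=> 0 : R[i]) = 0.
Proof. by apply: complexP; rewrite !(Re_cintegral, Im_cintegral) rintegral0. Qed.

Lemma cintegral_sum (I : Type) (s : seq I) (F : I -> R -> R[i]) :
  (forall i, cint (F i)) ->
  cintegral (fun x => \sum_(i <- s) F i x) = \sum_(i <- s) cintegral (F i).
Proof.
move=> iF; elim: s => [|i s IHs].
  by under eq_fun do rewrite big_nil; rewrite big_nil cintegral0.
under eq_fun do rewrite big_cons.
by rewrite cintegralD ?big_cons ?IHs//; exact: cint_sum.
Qed.

Lemma cintegral_ae f g : cmeasurable f -> cmeasurable g ->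
  {ae mu, forall x, f x = g x} -> cintegral f = cintegral g.
Proof.
move=> [? ?] [? ?] fg; rewrite !cintegralE; congr Complex.
  by apply: rintegral_ae => //; apply: ae_imp fg => x ->.
by apply: rintegral_ae => //; apply: ae_imp fg => x ->.
Qed.

End ComplexIntegral.

(** * Square integrable functions and their inner product *)

Section L2.
Context {R : realType}.
Notation mu := (@lebesgue_measure R).
Implicit Types (f g u v : R -> R[i]) (z : R[i]) (a b : R).

(** Membership in L^2 through a real integral instead of an extended norm; [cLspace2P] identifies it
    with [cLspace 2%:E]. *)
Record sqint f : Prop := Sqint {
  sqint_meas : cmeasurable f;
  sqint_rint : rint mu (fun x => sqc (f x)) }.

(** The squared norm of L^2 as a real number. An infinite integral is sent to 0, hence the [sqint]
    hypotheses of most lemmas about it. *)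
Definition nrm2 f : R := rintegral mu (fun x => sqc (f x)).

Lemma nrm2_indic (A : set R) : measurable A ->
  nrm2 (fun x => (\1_A x)%:C) = fine (mu A).
Proof.
move=> mA; rewrite /nrm2 -(rintegral_indic mu mA); congr rintegral.
apply/funext => x; rewrite sqcR indicE.
by case: (_ \in _); rewrite ?expr1n ?expr0n.
Qed.

Lemma nrm2_ge0 f : 0 <= nrm2 f.
Proof. by apply: rintegral_ge0 => x; exact: sqc_ge0. Qed.

Lemma sqint_le f g a : cmeasurable f -> sqint g ->
  (forall x, sqc (f x) <= a * sqc (g x)) -> sqint f.
Proof.
move=> mf [mg rg] fg; split => //; apply: rint_le (rintZ a rg).
  exact: cmeas_sqc.
by move=> x; rewrite ger0_norm ?sqc_ge0.
Qed.

Lemma sqintD f g : sqint f -> sqint g -> sqint (fun x => f x + g x).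
Proof.
move=> [mf rf] [mg rg]; split; first exact: cmeasD.
apply: rint_le (rintD (rintZ 2 rf) (rintZ 2 rg)).
  by apply: cmeas_sqc; exact: cmeasD.
by move=> x; rewrite ger0_norm ?sqc_ge0 ?sqcD.
Qed.

Lemma sqintZ z f : sqint f -> sqint (fun x => z * f x).
Proof.
move=> lf; apply: (sqint_le (a := sqc z) _ lf).
  by apply: cmeasM; [exact: cmeas_cst|case: lf].
by move=> x; rewrite sqcM.
Qed.

Lemma sqintN f : sqint f -> sqint (fun x => - f x).
Proof. by move=> /(sqintZ (-1)); under eq_fun do rewrite mulN1r. Qed.

Lemma sqintB f g : sqint f -> sqint g -> sqint (fun x => f x - g x).
Proof. by move=> ? ?; apply: sqintD => //; exact: sqintN. Qed.

Lemma sqintJ f : sqint f -> sqint (fun x => (f x)^*%C).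
Proof.
move=> [mf rf]; split; first exact: cmeasJ.
by under eq_fun do rewrite sqcJ.
Qed.

Lemma sqint0 : sqint (fun=> 0).
Proof.
by split; [exact: cmeas_cst|under eq_fun do rewrite sqc0; exact: rint0].
Qed.

Lemma sqint_sum (I : Type) (s : seq I) (F : I -> R -> R[i]) :
  (forall i, sqint (F i)) -> sqint (fun x => \sum_(i <- s) F i x).
Proof.
move=> iF; elim: s => [|i s IHs].
  by under eq_fun do rewrite big_nil; exact: sqint0.
by under eq_fun do rewrite big_cons; exact: sqintD.
Qed.

Lemma sqintMl u f a : cmeasurable u -> (forall x, sqc (u x) <= a) -> sqint f ->
  sqint (fun x => u x * f x).
Proof.
move=> mu_ ua lf; apply: (sqint_le (a := a) _ lf).
  by apply: cmeasM => //; case: lf.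
by move=> x; rewrite sqcM ler_wpM2r ?sqc_ge0.
Qed.

Lemma sqint_indic f (A : set R) : measurable A -> sqint f ->
  sqint (fun x => (\1_A x)%:C * f x).
Proof.
move=> mA; apply: (@sqintMl _ _ 1); first exact: cmeas_indic.
by move=> x; rewrite sqcR indicE; case: (_ \in _); rewrite /= ?expr1n ?expr0n.
Qed.

Lemma sqint_expi f b : sqint f -> sqint (fun x => expi (b * x) * f x).
Proof.
apply: (@sqintMl _ _ 1) => [|x]; last by rewrite sqc_expi.
by apply: cmeas_expi; exact: measurable_funM.
Qed.

Lemma cint_mul f g : sqint f -> sqint g -> cint (fun x => f x * g x).
Proof.
move=> [mf rf] [mg rg]; apply: (cint_le _ _ (rintD rf rg)).
  exact: cmeasM.
move=> x; rewrite normcE2 sqcM.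
have h : 0 <= sqc (f x) + sqc (g x) by rewrite addr_ge0 ?sqc_ge0.
rewrite -[leRHS]ger0_norm// -sqrtr_sqr ler_sqrt ?sqr_ge0//.
have := sqc_ge0 (f x); have := sqc_ge0 (g x); nra.
Qed.

Lemma innerE f g : inner f g = cintegral (fun x => f x * (g x)^*%C).
Proof. by []. Qed.

Lemma cint_inner f g : sqint f -> sqint g -> cint (fun x => f x * (g x)^*%C).
Proof. by move=> lf lg; apply: cint_mul => //; exact: sqintJ. Qed.

Lemma innerDl f g u : sqint f -> sqint g -> sqint u ->
  inner (fun x => f x + g x) u = inner f u + inner g u.
Proof.
move=> lf lg lu; rewrite /inner -cintegralD; [|exact: cint_inner..].
by under eq_fun do rewrite mulrDl.
Qed.

Lemma innerZl z f u : sqint f -> sqint u ->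
  inner (fun x => z * f x) u = z * inner f u.
Proof.
move=> lf lu; rewrite /inner -cintegralZ; last exact: cint_inner.
by under eq_fun do rewrite -mulrA.
Qed.

Lemma innerJ f g : sqint f -> sqint g -> inner g f = (inner f g)^*%C.
Proof.
move=> lf lg; rewrite /inner -cintegralJ; last exact: cint_inner.
by under [in RHS]eq_fun do rewrite conjcM conjcK mulrC.
Qed.

Lemma innerNl f u : sqint f -> sqint u ->
  inner (fun x => - f x) u = - inner f u.
Proof.
by move=> ? ?; under eq_fun do rewrite -mulN1r; rewrite innerZl// mulN1r.
Qed.

Lemma innerBl f g u : sqint f -> sqint g -> sqint u ->
  inner (fun x => f x - g x) u = inner f u - inner g u.
Proof. by move=> ? ? ?; rewrite innerDl ?innerNl//; exact: sqintN. Qed.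

Lemma inner_suml (I : Type) (s : seq I) (F : I -> R -> R[i]) u :
  (forall i, sqint (F i)) -> sqint u ->
  inner (fun x => \sum_(i <- s) F i x) u = \sum_(i <- s) inner (F i) u.
Proof.
move=> iF lu; rewrite /inner -cintegral_sum; last by move=> i; exact: cint_inner.
by under eq_fun do rewrite mulr_suml.
Qed.

Lemma innerDr f g u : sqint f -> sqint g -> sqint u ->
  inner u (fun x => f x + g x) = inner u f + inner u g.
Proof.
move=> lf lg lu; rewrite [LHS]innerJ//; last exact: sqintD.
by rewrite innerDl// conjcD -(innerJ lf lu) -(innerJ lg lu).
Qed.

Lemma innerBr f g u : sqint f -> sqint g -> sqint u ->
  inner u (fun x => f x - g x) = inner u f - inner u g.
Proof.
move=> lf lg lu; rewrite [LHS]innerJ//; last exact: sqintB.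
by rewrite innerBl// conjcB -(innerJ lf lu) -(innerJ lg lu).
Qed.

Lemma innerZr z f u : sqint f -> sqint u ->
  inner u (fun x => z * f x) = (z^*)%C * inner u f.
Proof.
move=> lf lu; rewrite [LHS]innerJ//; last exact: sqintZ.
by rewrite innerZl// conjcM -(innerJ lf lu).
Qed.

Lemma inner_sumr (I : Type) (s : seq I) (F : I -> R -> R[i]) u :
  (forall i, sqint (F i)) -> sqint u ->
  inner u (fun x => \sum_(i <- s) F i x) = \sum_(i <- s) inner u (F i).
Proof.
move=> iF lu; rewrite [LHS]innerJ//; last exact: sqint_sum.
by rewrite inner_suml// conjc_sum; apply: eq_bigr => i _; rewrite -(innerJ (iF i) lu).
Qed.

Lemma inner_nrm2 f : inner f f = (nrm2 f)%:C.
Proof.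
apply: complexP.
  by rewrite Re_cintegral; under eq_fun do rewrite mulcJ cReR.
by rewrite Im_cintegral; under eq_fun do rewrite mulcJ cImR; rewrite rintegral0.
Qed.

Lemma nrm2J f : nrm2 (fun x => (f x)^*%C) = nrm2 f.
Proof. by rewrite /nrm2; under eq_fun do rewrite sqcJ. Qed.

Lemma nrm2Z z f : sqint f -> nrm2 (fun x => z * f x) = sqc z * nrm2 f.
Proof.
by move=> [_ rf]; rewrite /nrm2; under eq_fun do rewrite sqcM; rewrite rintegralZ.
Qed.

Lemma nrm2N f : nrm2 (fun x => - f x) = nrm2 f.
Proof. by rewrite /nrm2; under eq_fun do rewrite sqcN. Qed.

Lemma nrm2_0 : nrm2 (fun=> 0) = 0.
Proof. by rewrite /nrm2; under eq_fun do rewrite sqc0; rewrite rintegral0. Qed.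

Lemma nrm2_expi f b : nrm2 (fun x => expi (b * x) * f x) = nrm2 f.
Proof. by rewrite /nrm2; under eq_fun do rewrite sqcM sqc_expi mul1r. Qed.

Lemma nrm2DE f g : sqint f -> sqint g ->
  nrm2 (fun x => f x + g x) = nrm2 f + nrm2 g + 2 * complex.Re (inner f g).
Proof.
move=> lf lg; apply: complexI; rewrite -inner_nrm2 innerDl ?innerDr//; [|exact: sqintD].
rewrite (innerJ lf lg) !inner_nrm2; apply: complexP; rewrite !reimE; ring.
Qed.

Lemma nrm2BE f g : sqint f -> sqint g ->
  nrm2 (fun x => f x - g x) = nrm2 f + nrm2 g - 2 * complex.Re (inner f g).
Proof.
move=> lf lg; apply: complexI; rewrite -inner_nrm2 innerBl ?innerBr//; [|exact: sqintB].
rewrite (innerJ lf lg) !inner_nrm2; apply: complexP; rewrite !reimE; ring.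
Qed.

Lemma nrm2D_le f g : sqint f -> sqint g ->
  nrm2 (fun x => f x + g x) <= 2 * nrm2 f + 2 * nrm2 g.
Proof.
move=> lf lg; have := nrm2_ge0 (fun x => f x - g x).
by rewrite nrm2BE// nrm2DE//; lra.
Qed.

Lemma nrm2B_le f g : sqint f -> sqint g ->
  nrm2 (fun x => f x - g x) <= 2 * nrm2 f + 2 * nrm2 g.
Proof.
move=> lf lg; have := nrm2_ge0 (fun x => f x + g x).
by rewrite nrm2BE// nrm2DE//; lra.
Qed.

Lemma nrm2BC f g : nrm2 (fun x => f x - g x) = nrm2 (fun x => g x - f x).
Proof. by rewrite -nrm2N; under eq_fun do rewrite opprB. Qed.

Lemma Re_inner_le f g : sqint f -> sqint g ->
  2 * complex.Re (inner f g) <= nrm2 f + nrm2 g.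
Proof.
by move=> lf lg; have := nrm2_ge0 (fun x => f x - g x); rewrite nrm2BE//; lra.
Qed.

Lemma nrm2_le f g : sqint f -> sqint g -> (forall x, sqc (f x) <= sqc (g x)) ->
  nrm2 f <= nrm2 g.
Proof. by move=> [_ ?] [_ ?] ?; exact: le_rintegral. Qed.

Lemma nrm2_ae f g : cmeasurable f -> cmeasurable g ->
  {ae mu, forall x, f x = g x} -> nrm2 f = nrm2 g.
Proof.
move=> mf mg fg; apply: rintegral_ae; [exact: cmeas_sqc..|].
by apply: ae_imp fg => x ->.
Qed.

Lemma nrm2_eq0 f : sqint f -> nrm2 f = 0 -> {ae mu, forall x, f x = 0}.
Proof.
move=> [mf rf] /(rintegral_eq0 rf) => /(_ (fun x => sqc_ge0 (f x))).
by apply: ae_imp => x /eqP; rewrite sqc_eq0 => /eqP.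
Qed.

Lemma nrm2_dct (f_ : nat -> R -> R[i]) f g :
  (forall n, sqint (f_ n)) -> cmeasurable f -> sqint g ->
  (forall x, (fun n => sqc (f_ n x - f x)) @ \oo --> 0) ->
  (forall n x, sqc (f_ n x - f x) <= sqc (g x)) ->
  (fun n => nrm2 (fun x => f_ n x - f x)) @ \oo --> 0.
Proof.
move=> lf_ mf [_ rg] cf fg; rewrite /nrm2 -(@rintegral0 _ _ _ mu).
apply: (@rintegral_dct _ _ _ mu _ _ _ _ _ _ rg) => //.
- by move=> n; apply: cmeas_sqc; apply: cmeasB => //; case: (lf_ n).
- by move=> n x; rewrite ger0_norm ?sqc_ge0.
Qed.

Lemma cLnorm_sqr f : (cLnorm 2%:E f ^+ 2 = \int[mu]_x (sqc (f x))%:E)%E.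
Proof.
have expe_sqr (x : \bar R) : (0 <= x -> x ^+ 2 = x `^ 2)%E.
  case: x => [r| |]//.
    by rewrite lee_fin => r0; rewrite poweR_EFin powR_mulrn// -EFin_expe.
  by rewrite poweRyr// expe2 mulyy.
rewrite /cLnorm expe_sqr ?Lnorm_ge0// poweR_Lnorm//.
apply: eq_integral => x _ /=.
by rewrite ger0_norm ?normc_ge0// powR_mulrn ?normc_ge0// normc_sq.
Qed.

Lemma cLspace2P f : cLspace 2%:E f <-> sqint f.
Proof.
rewrite /cLspace; split=> -[mf lf]; split => //.
  apply/rint_ge0P; [exact: cmeas_sqc|by move=> x; exact: sqc_ge0|].
  by rewrite -cLnorm_sqr expe2 lte_mul_pinfty// ?Lnorm_ge0// ge0_fin_numE// Lnorm_ge0.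
move/rint_ge0P : lf => /(_ (cmeas_sqc mf) (fun x => sqc_ge0 _)).
rewrite -cLnorm_sqr => h; rewrite ltNge leye_eq; apply/eqP => e.
by move: h; rewrite e expe2 mulyy.
Qed.

Lemma cLnorm_nrm2 f : sqint f -> cLnorm 2%:E f = (Num.sqrt (nrm2 f))%:E.
Proof.
move=> lf; have /cLspace2P[_ ff] := lf.
have Fn : cLnorm 2%:E f \is a fin_num by rewrite ge0_fin_numE// Lnorm_ge0.
rewrite -(fineK Fn); congr EFin.
have := cLnorm_sqr f; rewrite rintegralE; last by case: lf.
rewrite -(fineK Fn) -EFin_expe => -[] E.
by rewrite /nrm2 -E sqrtr_sqr ger0_norm// fine_ge0// Lnorm_ge0.
Qed.

Lemma cLspace1P f : cLspace 1 f <-> cint f.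
Proof.
rewrite /cLspace /cLnorm Lnorm1; split=> [[mf lf]|cf].
  apply: (cint_le mf (fun x => lexx _)).
  apply/rint_ge0P; [exact: cmeas_normc|by move=> x; exact: normc_ge0|].
  by under eq_integral do rewrite -[(_)%:E]gee0_abs ?lee_fin ?normc_ge0//.
split; first exact: cint_meas.
have /rint_ge0P := cint_normc cf.
move=> /(_ (cmeas_normc (cint_meas cf)) (fun x => normc_ge0 _)).
by under eq_integral do rewrite -[(_)%:E]gee0_abs ?lee_fin ?normc_ge0//.
Qed.

Lemma cvg_cLnorm (T : Type) (F : set_system T) (FF : Filter F) (u : T -> R -> R[i]) :
  (forall t, sqint (u t)) ->
  ((fun t => cLnorm 2%:E (u t)) @ F --> 0%E) <-> ((fun t => nrm2 (u t)) @ F --> 0).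
Proof.
move=> lu; under eq_fun do rewrite cLnorm_nrm2//.
split=> [/fine_cvgP[_]|] h; last first.
  apply: cvg_EFin; first exact: nearW.
  have := continuous_cvg _ (@sqrt_continuous R 0) h.
  by rewrite sqrtr0; apply.
have -> : (fun t => nrm2 (u t)) = (fun t => Num.sqrt (nrm2 (u t)) * Num.sqrt (nrm2 (u t))).
  by apply/funext => t /=; rewrite -[RHS]expr2 sqr_sqrtr// nrm2_ge0.
by rewrite -[0](mulr0 0); exact: (cvgM h h).
Qed.

(** The function equals its product with the indicator of [A], which is square integrable, and a
    product of two square integrable functions is integrable. *)
Lemma cint_sqint_supp f (A : set R) : measurable A -> (mu A < +oo)%E ->
  (forall x, ~ A x -> f x = 0) -> sqint f -> cint f.
Proof.
move=> mA fA f0 lf.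
have l1 : sqint (fun x => (\1_A x)%:C).
  split; first exact: cmeas_indic.
  under eq_fun do rewrite sqcR.
  have := @rint_indic _ _ _ mu _ mA fA.
  apply: eq_integrable => // x _ /=.
  by rewrite indicE; case: (_ \in _); rewrite /= ?expr1n ?expr0n.
have := cint_mul lf l1; congr cint; apply/funext => x.
rewrite indicE; have [xA|xA] := boolP (x \in A); first by rewrite mulr1.
by rewrite f0 ?mul0r//; move=> /mem_set; apply/negP.
Qed.

End L2.

(** * Fourier series *)

Section RealEsum.
Context {R : realType} {I : choiceType}.
Implicit Types (a : I -> R) (S c : R).

Lemma ler_sum_uniq a (J K : seq I) : (forall i, 0 <= a i) -> uniq J -> uniq K ->
  {subset J <= K} -> \sum_(i <- J) a i <= \sum_(i <- K) a i.
Proof.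
move=> a0 uJ uK JK; rewrite [leRHS](bigID [in J])/= -[X in X + _]big_filter.
have pJ : perm_eq [seq i <- K | i \in J] J.
  apply: uniq_perm => //; first exact: filter_uniq.
  by move=> i; rewrite mem_filter; apply/andb_idr => /JK.
by rewrite (perm_big _ pJ)/= lerDl sumr_ge0.
Qed.

(** Splits the value of a nonnegative sum into the two halves used below: an upper bound for all
    finite sums, in the manner of Bessel, and a finite set that comes within [e] of the total. *)
Lemma esum_realP a S : (forall i, 0 <= a i) ->
  (\esum_(i in [set: I]) (a i)%:E = S%:E)%E <->
  (forall J : seq I, uniq J -> \sum_(i <- J) a i <= S) /\
  (forall e, 0 < e -> exists2 J : seq I, uniq J & S - e < \sum_(i <- J) a i).
Proof.
move=> a0; split=> [aS|[ub ap]].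
  split=> [J uJ|e e0].
    rewrite -lee_fin -aS; apply: esum_ge.
    exists [set` J]; first by split => //; exact: finite_seq.
    by rewrite -fsbig_seq// sumEFin.
  have : ((S - e)%:E < \esum_(i in [set: I]) (a i)%:E)%E.
    by rewrite aS lte_fin gtrBl.
  rewrite /esum => /ereal_sup_gt[_ [X [fX _] <-]].
  rewrite fsbig_finite// sumEFin lte_fin => h.
  by exists (fset_set X) => //; exact: fset_uniq.
apply/eqP; rewrite eq_le; apply/andP; split.
  apply: ge_ereal_sup => _ [X [fX _] <-].
  by rewrite fsbig_finite// sumEFin lee_fin ub// fset_uniq.
apply/lee_addgt0Pr => e e0; have [J uJ /ltW SJ] := ap _ e0.
rewrite -leeBlDr//; apply: esum_ge.
exists [set` J]; first by split => //; exact: finite_seq.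
by rewrite -fsbig_seq// sumEFin lee_fin.
Qed.

Lemma esum_realZ a S c : 0 < c -> (forall i, 0 <= a i) ->
  (\esum_(i in [set: I]) (a i)%:E = S%:E)%E ->
  (\esum_(i in [set: I]) (c * a i)%:E = (c * S)%:E)%E.
Proof.
move=> c0 a0 /(esum_realP _ a0)[ub ap]; apply/esum_realP.
  by move=> i; rewrite mulr_ge0 ?(ltW c0).
split=> [J uJ|e e0]; first by rewrite -mulr_sumr ler_pM2l// ub.
have [J uJ h] := ap _ (divr_gt0 e0 c0); exists J => //.
by rewrite -mulr_sumr -ltr_pdivrMl// mulrBr mulKf ?gt_eqF// mulrC.
Qed.

End RealEsum.

Section TrigIntegrals.
Context {R : realType}.
Notation mu := (@lebesgue_measure R).

Lemma rint_itv (f : R -> R) (a b : R) : continuous f ->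
  rint mu (fun x => \1_(`]a, b]) x * f x).
Proof.
move=> cf; have iab : mu.-integrable `[a, b] (EFin \o f).
  apply: continuous_compact_integrable; first exact: segment_compact.
  exact: continuous_subspaceT.
have iab' : mu.-integrable `]a, b] (EFin \o f).
  by apply: integrableS iab => //; exact: subset_itv_oc_cc.
have mI : measurable (`]a, b]%classic : set R) by [].
have [+ _] := @integrable_mkcond _ _ _ mu _ (EFin \o f) mI; move=> /(_ iab').
apply: eq_integrable => // x _ /=; rewrite patchE indicE.
by case: ifP => _; rewrite /= ?mul1r ?mul0r.
Qed.

Lemma rintegral_FTC (f F : R -> R) (a b : R) : a <= b -> continuous f ->
  (forall x : R, is_derive x 1 F (f x)) ->
  rintegral mu (fun x => \1_(`]a, b]) x * f x) = F b - F a.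
Proof.
move=> ab cf dF.
have -> : rintegral mu (fun x => \1_(`]a, b]) x * f x) = \int[mu]_(x in `[a, b]) f x.
  rewrite -Rintegral_itv_obnd_cbnd; last first.
    have mI : measurable (`]a, b]%classic : set R) by [].
    have [_ ] := @integrable_mkcond _ _ _ mu _ (EFin \o f) mI; apply.
    apply: eq_integrable (rint_itv a b cf) => // x _ /=; rewrite patchE indicE.
    by case: ifP => _; rewrite /= ?mul1r ?mul0r.
  rewrite Rintegral_mkcond; congr Rintegral; apply/funext => x.
  by rewrite patchE indicE; case: ifP => _; rewrite /= ?mul1r ?mul0r.
have [->|nab] := eqVneq a b; first by rewrite set_itv1 Rintegral_set1 subrr.
have {nab}ab' : a < b by rewrite lt_neqAle nab.
have cF : continuous F.
  by move=> x; apply: differentiable_continuous; apply/derivable1_diffP; case: (dF x).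
rewrite /Rintegral (@continuous_FTC2 _ f F)//.
- exact: continuous_subspaceT.
- split; first by move=> x _; case: (dF x).
  + by apply: cvg_at_right_filter; exact: cF.
  + by apply: cvg_at_left_filter; exact: cF.
- by move=> x _; rewrite derive1E; apply: derive_val.
Qed.

Lemma continuous_cosM (k : R) : continuous (fun x : R => cos (k * x)).
Proof. by move=> x; apply: continuous_comp; [exact: mulrl_continuous|exact: continuous_cos]. Qed.

Lemma continuous_sinM (k : R) : continuous (fun x : R => sin (k * x)).
Proof. by move=> x; apply: continuous_comp; [exact: mulrl_continuous|exact: continuous_sin]. Qed.

Lemma rintegral_cos (k a b : R) : k != 0 -> a <= b ->
  rintegral mu (fun x => \1_(`]a, b]) x * cos (k * x)) = (sin (k * b) - sin (k * a)) / k.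
Proof.
move=> k0 ab.
have dF (x : R) : is_derive x 1 (fun x => k^-1 * sin (k * x)) (cos (k * x)).
  apply: is_derive_eq.
  by rewrite /GRing.scale/=; field.
rewrite (rintegral_FTC ab (@continuous_cosM k) dF).
by field.
Qed.

Lemma rintegral_sin (k a b : R) : k != 0 -> a <= b ->
  rintegral mu (fun x => \1_(`]a, b]) x * sin (k * x)) = (cos (k * a) - cos (k * b)) / k.
Proof.
move=> k0 ab.
have dF (x : R) : is_derive x 1 (fun x => - k^-1 * cos (k * x)) (sin (k * x)).
  apply: is_derive_eq.
  by rewrite /GRing.scale/=; field.
rewrite (rintegral_FTC ab (@continuous_sinM k) dF).
by field.
Qed.

Lemma rintegral_itv1 (a b : R) : a <= b -> rintegral mu (\1_(`]a, b])) = b - a.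
Proof.
move=> ab; rewrite rintegral_indic//= lebesgue_measure_itv/= lte_fin.
case: ltP => //= ba; have -> : a = b by apply/eqP; rewrite eq_le ab.
by rewrite subrr.
Qed.

End TrigIntegrals.

Opaque nrm2 inner cintegral rintegral rint.

(** The triangle inequality for squared norms costs a factor 2 on each term, so each error must be
    kept below a quarter of the target. *)
Lemma lt_quarter (R : realFieldType) (x y d : R) :
  x < d / 4 -> y < d / 4 -> 2 * x + 2 * y < d.
Proof. lra. Qed.

(** * Bessel's inequality and the closed span of an orthogonal system *)

Section OrthogonalSystem.
Context {R : realType} {I : choiceType}.
Variables (e : I -> R -> R[i]) (T : R).
Hypothesis T0 : 0 < T.
Hypothesis le : forall i, sqint (e i).
Hypothesis oe : forall i j, inner (e i) (e j) = if i == j then T%:C else 0.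
Implicit Types (f : R -> R[i]) (J : seq I) (c : I -> R[i]).

Lemma inner_ortho_sum J c j : uniq J -> j \in J ->
  inner (fun x => \sum_(i <- J) c i * e i x) (e j) = T%:C * c j.
Proof.
move=> uJ jJ; rewrite inner_suml//; last by move=> i; exact: sqintZ.
under eq_bigr do rewrite innerZl// oe.
rewrite (bigD1_seq j)//= eqxx big1 ?addr0 1?mulrC// => i /negbTE ->.
by rewrite mulr0.
Qed.

Lemma nrm2_ortho_sum J c : uniq J ->
  nrm2 (fun x => \sum_(i <- J) c i * e i x) = T * \sum_(i <- J) sqc (c i).
Proof.
move=> uJ; apply: complexI; rewrite -inner_nrm2 inner_sumr; last 2 first.
- by move=> i; exact: sqintZ.
- by apply: sqint_sum => i; exact: sqintZ.
rewrite big_seq (eq_bigr (fun i => (T * sqc (c i))%:C)) => [|i iJ]; last first.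
  rewrite innerZr//; last by apply: sqint_sum => k; exact: sqintZ.
  rewrite inner_ortho_sum// mulrCA [X in _ * X]mulrC mulcJ.
  by apply: complexP; rewrite !reimE; ring.
by rewrite -big_seq mulr_sumr [in RHS]rmorph_sum.
Qed.

(** For a duplicate-free [J], the orthogonal projection onto the span of the [e i] with [i] in [J];
    the factor [T^-1] compensates for the squared norm [T] of each [e i]. *)
Definition fourier_sum J f : R -> R[i] :=
  fun x => \sum_(i <- J) ((T^-1)%:C * inner f (e i)) * e i x.

Lemma sqint_fourier_sum J f : sqint (fourier_sum J f).
Proof. by apply: sqint_sum => i; exact: sqintZ. Qed.

Lemma nrm2_resid J f : uniq J -> sqint f ->
  nrm2 (fun x => f x - fourier_sum J f x) =
  nrm2 f - T^-1 * \sum_(i <- J) sqc (inner f (e i)).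
Proof.
move=> uJ lf; rewrite nrm2BE//; last exact: sqint_fourier_sum.
have -> : inner f (fourier_sum J f) = (T^-1 * \sum_(i <- J) sqc (inner f (e i)))%:C.
  rewrite inner_sumr//; last by move=> i; exact: sqintZ.
  rewrite mulr_sumr rmorph_sum/=; apply: eq_bigr => i _.
  rewrite innerZr// conjcM -mulrA [X in _ * X]mulrC mulcJ.
  by apply: complexP; rewrite !reimE; ring.
rewrite nrm2_ortho_sum//.
under eq_bigr do rewrite sqcM sqcR.
rewrite -mulr_sumr cReR; field.
by rewrite gt_eqF.
Qed.

Lemma bessel J f : uniq J -> sqint f ->
  \sum_(i <- J) sqc (inner f (e i)) <= T * nrm2 f.
Proof.
move=> uJ lf; have := nrm2_ge0 (fun x => f x - fourier_sum J f x).
by rewrite nrm2_resid// subr_ge0 ler_pdivrMl// mulrC.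
Qed.

Lemma fourier_sumD J f g x : sqint f -> sqint g ->
  fourier_sum J (fun x => f x + g x) x = fourier_sum J f x + fourier_sum J g x.
Proof.
move=> lf lg; rewrite /fourier_sum -big_split/=; apply: eq_bigr => i _.
by rewrite innerDl// mulrDr mulrDl.
Qed.

(* The closed linear span of the system, described by the vanishing of the
   distance to the finite partial sums. *)
Record in_span f : Prop := InSpan {
  in_span_sqint : sqint f;
  in_span_approx : forall d, 0 < d ->
    exists2 J : seq I, uniq J & nrm2 (fun x => f x - fourier_sum J f x) < d }.

Lemma resid_le J K f : uniq J -> uniq K -> {subset J <= K} -> sqint f ->
  nrm2 (fun x => f x - fourier_sum K f x) <= nrm2 (fun x => f x - fourier_sum J f x).
Proof.
move=> uJ uK JK lf; rewrite !nrm2_resid// lerD2l lerN2 ler_pM2l ?invr_gt0//.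
by apply: ler_sum_uniq => // i; exact: sqc_ge0.
Qed.

Lemma resid_le_nrm2 J f : uniq J -> sqint f ->
  nrm2 (fun x => f x - fourier_sum J f x) <= nrm2 f.
Proof.
move=> uJ lf; rewrite nrm2_resid// lerBlDr lerDl pmulr_rge0 ?invr_gt0//.
by apply: sumr_ge0 => i _; exact: sqc_ge0.
Qed.

Lemma in_spanD f g : in_span f -> in_span g -> in_span (fun x => f x + g x).
Proof.
move=> [lf sf] [lg sg]; split; first exact: sqintD.
move=> d d0; have d4 : 0 < d / 4 by rewrite divr_gt0.
have [J uJ fJ] := sf _ d4; have [K uK gK] := sg _ d4.
(* Residuals decrease when the index set grows, so the union serves both functions. *)
exists (undup (J ++ K)); first exact: undup_uniq.
set U := undup _; have uU : uniq U by exact: undup_uniq.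
have JU : {subset J <= U} by move=> i iJ; rewrite mem_undup mem_cat iJ.
have KU : {subset K <= U} by move=> i iK; rewrite mem_undup mem_cat iK orbT.
have -> : (fun x => f x + g x - fourier_sum U (fun x => f x + g x) x) =
  (fun x => (f x - fourier_sum U f x) + (g x - fourier_sum U g x)).
  by apply/funext => x; rewrite fourier_sumD//; ring.
apply: le_lt_trans (nrm2D_le _ _) _.
- by apply: sqintB => //; exact: sqint_fourier_sum.
- by apply: sqintB => //; exact: sqint_fourier_sum.
exact: (lt_quarter (le_lt_trans (resid_le uJ uU JU lf) fJ)
  (le_lt_trans (resid_le uK uU KU lg) gK)).
Qed.

Lemma in_spanZ z f : in_span f -> in_span (fun x => z * f x).
Proof.
move=> [lf sf]; split; first exact: sqintZ.
move=> d d0.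
have d1 : 0 < d / (sqc z + 1) by rewrite divr_gt0// ltr_wpDl// sqc_ge0.
have [J uJ fJ] := sf _ d1; exists J => //.
have -> : (fun x => z * f x - fourier_sum J (fun x => z * f x) x) =
          (fun x => z * (f x - fourier_sum J f x)).
  apply/funext => x; rewrite mulrBr; congr (_ - _).
  rewrite /fourier_sum mulr_sumr; apply: eq_bigr => i _.
  by rewrite innerZl//; ring.
rewrite nrm2Z; last by apply: sqintB => //; exact: sqint_fourier_sum.
move: fJ; rewrite ltr_pdivlMr; last by rewrite ltr_wpDl// sqc_ge0.
apply: le_lt_trans; rewrite mulrC ler_wpM2l ?nrm2_ge0//.
by rewrite lerDl.
Qed.

Lemma in_spanB f g : in_span f -> in_span g -> in_span (fun x => f x - g x).
Proof.
move=> sf sg; under eq_fun do rewrite -mulN1r.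
exact: in_spanD sf (in_spanZ (-1) sg).
Qed.

Lemma in_span0 : in_span (fun=> 0).
Proof.
split; first exact: sqint0.
move=> d d0; exists [::] => //; rewrite /fourier_sum.
under eq_fun do rewrite big_nil subr0.
by rewrite nrm2_0.
Qed.

Lemma in_span_sum (K : Type) (s : seq K) (F : K -> R -> R[i]) :
  (forall i, in_span (F i)) -> in_span (fun x => \sum_(i <- s) F i x).
Proof.
move=> iF; elim: s => [|i s IHs].
  by under eq_fun do rewrite big_nil; exact: in_span0.
under eq_fun do rewrite big_cons; exact: (in_spanD (iF i) IHs).
Qed.

Lemma in_span_gen i : in_span (e i).
Proof.
split => // d d0; exists [:: i] => //.
rewrite nrm2_resid// big_seq1.
have E : nrm2 (e i) = T by apply: complexI; rewrite -inner_nrm2 oe eqxx.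
rewrite oe eqxx sqcR E expr2 mulKf ?gt_eqF// subrr.
exact: d0.
Qed.

Lemma in_span_lim f : sqint f ->
  (forall d, 0 < d -> exists2 g, in_span g & nrm2 (fun x => f x - g x) < d) ->
  in_span f.
Proof.
move=> lf lim; split => // d d0; have d4 : 0 < d / 4 by rewrite divr_gt0.
have [g [lg sg] fg] := lim _ d4; have [J uJ gJ] := sg _ d4.
exists J => //.
(* The residual of [f] is that of [f - g] plus that of [g], and the former is at most [f - g] in
   norm. *)
have -> : (fun x => f x - fourier_sum J f x) =
   (fun x => ((f x - g x) - fourier_sum J (fun x => f x - g x) x) +
             (g x - fourier_sum J g x)).
  apply/funext => x.
  have -> : fourier_sum J f x =
      fourier_sum J (fun x => (f x - g x) + g x) x.
    by congr (fourier_sum _ _ _); apply/funext => y; rewrite subrK.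
  by rewrite fourier_sumD//; [ring|exact: sqintB].
have lfg := sqintB lf lg.
apply: le_lt_trans (nrm2D_le _ _) _.
- by apply: sqintB => //; exact: sqint_fourier_sum.
- by apply: sqintB => //; exact: sqint_fourier_sum.
exact: (lt_quarter (le_lt_trans (resid_le_nrm2 uJ lfg) fg) gJ).
Qed.

Lemma in_span_cvg (f_ : nat -> R -> R[i]) f : sqint f -> (forall n, in_span (f_ n)) ->
  (fun n => nrm2 (fun x => f_ n x - f x)) @ \oo --> 0 -> in_span f.
Proof.
move=> lf sf_ cf; apply: in_span_lim => // d d0.
have /cvgrPdist_lt /(_ _ d0)[n _ /(_ n (leqnn n))] := cf.
rewrite sub0r normrN ger0_norm ?nrm2_ge0// nrm2BC => h.
by exists (f_ n).
Qed.

Lemma in_span_parseval f : in_span f ->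
  (\esum_(i in [set: I]) (sqc (inner f (e i)))%:E = (T * nrm2 f)%:E)%E.
Proof.
move=> [lf sf]; apply/esum_realP; first by move=> i; exact: sqc_ge0.
split=> [J uJ|d d0]; first exact: bessel.
have d1 : 0 < d / T by rewrite divr_gt0.
have [J uJ fJ] := sf _ d1; exists J => //.
have -> : T * nrm2 f - d = T * (nrm2 f - d / T) by field; rewrite gt_eqF.
by rewrite -ltr_pdivlMl// ltrBlDr -ltrBlDl -nrm2_resid.
Qed.

End OrthogonalSystem.

(** * Polynomials converging to a threshold function *)

Section Threshold.
Context {R : realType}.
Implicit Types (x y z : R) (n : nat).

Lemma bernoulli_ineq x n : -1 <= x -> 1 + n%:R * x <= (1 + x) ^+ n.
Proof.
move=> x1; elim: n => [|n IHn]; first by rewrite mul0r addr0 expr0.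
rewrite exprS; apply: le_trans (ler_wpM2l _ IHn); last by lra.
rewrite -natr1; have : 0 <= n%:R * x ^+ 2 :> R by rewrite mulr_ge0// sqr_ge0.
nra.
Qed.

Lemma cvg_nat_expr z : 0 <= z < 1 -> (fun n => n%:R * z ^+ n) @ \oo --> 0.
Proof.
move=> /andP[z0 z1].
have [->|nz] := eqVneq z 0.
  apply: cvg_near_cst; near=> n.
  by rewrite expr0n gtn_eqF ?mulr0//; near: n; exists 1%N.
(* Write [z ^+ n] as [s ^+ n * s ^+ n]: by Bernoulli's inequality [n * s ^+ n] is at most [d^-1],
   and the other factor tends to 0. *)
pose s := Num.sqrt z.
have s0 : 0 < s by rewrite sqrtr_gt0 lt_neqAle eq_sym nz.
have s1 : s < 1 by rewrite -sqrtr1 ltr_sqrt.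
pose d := s^-1 - 1.
have d0 : 0 < d by rewrite subr_gt0 invf_gt1.
have cs : (fun n => d^-1 * s ^+ n) @ \oo --> 0.
  rewrite -[0](mulr0 d^-1); apply: cvgMl_tmp; apply: cvg_expr.
  by rewrite ger0_norm ?ltW.
apply: (squeeze_cvgr _ (cvg_cst 0) cs); near=> n.
rewrite mulr_ge0 ?exprn_ge0//=.
have -> : z = s * s by rewrite -expr2 sqr_sqrtr.
rewrite exprMn mulrA ler_wpM2r ?exprn_ge0 ?(ltW s0)//.
rewrite -ler_pdivlMr ?exprn_gt0// ler_pdivlMl// mulrC -exprVn.
have -> : s^-1 = 1 + d by rewrite /d addrC subrK.
apply: le_trans (bernoulli_ineq _ _); first by rewrite lerDr.
by rewrite (le_trans _ (ltW d0)).
Unshelve. all: end_near. Qed.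

(* The exponent [n * 2 ^ n] is the least one for which the sequence also
   vanishes in the limit at the threshold [y = 1 / 2] itself. *)
Lemma cvg_threshold y : 0 <= y <= 1 ->
  (fun n => (1 - y ^+ n) ^+ (n * 2 ^ n)) @ \oo --> ((if y < 2^-1 then 1 else 0) : R).
Proof.
move=> /andP[y0 y1].
have yn n : 0 <= y ^+ n <= 1 by rewrite exprn_ge0// exprn_ile1.
have [yh|yh] := ltP y 2^-1.
  (* Bernoulli's inequality gives this lower bound, because the exponent times [y ^+ n] is
     [n * (2 * y) ^+ n], and here [2 * y < 1]. *)
  have c1 : (fun n => 1 - n%:R * (2 * y) ^+ n) @ \oo --> (1 : R).
    rewrite -[X in _ --> X]subr0; apply: cvgB; first exact: cvg_cst.
    by apply: cvg_nat_expr; lra.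
  have c2 : (fun=> 1 : R) @ \oo --> (1 : R) by exact: cvg_cst.
  apply: (squeeze_cvgr _ c1 c2); near=> n.
  have /andP[a b] := yn n; apply/andP; split; last by rewrite exprn_ile1; lra.
  have := @bernoulli_ineq (- y ^+ n) (n * 2 ^ n); rewrite lerN2 => /(_ b).
  apply: le_trans; rewrite lerD2l mulrN lerN2 exprMn mulrA natrM natrX.
  by [].
have c0 : (fun n => n.+1%:R^-1 : R) @ \oo --> 0 by exact: cvg_harmonic.
apply: (squeeze_cvgr _ (cvg_cst 0) c0); near=> n.
have /andP[a b] := yn n; rewrite exprn_ge0 ?subr_ge0//=.
set m := (n * 2 ^ n)%N; set x := y ^+ n.
(* As [(1 - x) * (1 + x) <= 1], a lower bound for [(1 + x) ^+ m] is an upper bound for the sequence.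
   Bernoulli's inequality provides [n.+1], since [m * x = n * (2 * y) ^+ n] with [2 * y >= 1]. *)
have h1 : (1 - x) ^+ m * (1 + x) ^+ m <= 1.
  by rewrite -exprMn exprn_ile1//; rewrite /x; nra.
have h2 : n.+1%:R <= (1 + x) ^+ m.
  apply: le_trans (bernoulli_ineq _ _); last by rewrite /x; lra.
  rewrite -nat1r lerD2l /m natrM natrX -mulrA ler_peMr// /x -exprMn.
  by rewrite exprn_ege1//; lra.
rewrite -[leRHS]mul1r ler_pdivlMr//; apply: le_trans h1.
by rewrite ler_wpM2l// exprn_ge0// subr_ge0.
Unshelve. all: end_near. Qed.

End Threshold.

Section ExpiPeriod.
Context {R : realType}.

Lemma expi_2pi (n : int) : expi (n%:~R * (2 * pi)) = 1 :> R[i].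
Proof.
have h1 : expi (2 * pi) = 1 :> R[i].
  by rewrite mulr_natl; apply: complexP; rewrite ?Re_expi ?Im_expi ?cos2pi ?sin2pi.
have hn (k : nat) : expi (k%:R * (2 * pi)) = 1 :> R[i].
  elim: k => [|k IHk]; first by rewrite mul0r expi0.
  by rewrite -natr1 mulrDl mul1r expiD IHk h1 mulr1.
case: n => n; first exact: hn.
rewrite NegzE mulrNz mulNr -expiJ hn.
by apply: complexP; rewrite !reimE ?oppr0.
Qed.

End ExpiPeriod.

(** * The exponentials on one period and the algebra in their closed span *)

Section TrigSystem.
Context {R : realType}.
Notation mu := (@lebesgue_measure R).
Variables (a T : R).
Hypothesis T0 : 0 < T.
Implicit Types (f : R -> R[i]).

Let t0 : R := 2 * pi / T.
Let D : set R := `]a, (a + T)]%classic.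

Definition cindic (A : set R) (x : R) : R[i] := (\1_A x)%:C.

Lemma cindicM (A B : set R) x : cindic A x * cindic B x = cindic (A `&` B) x.
Proof. by rewrite /cindic -rcM indicI. Qed.

Lemma cindic_sq (A : set R) x : cindic A x * cindic A x = cindic A x.
Proof. by rewrite cindicM setIid. Qed.

Lemma sqc_cindic (A : set R) x : sqc (cindic A x) = \1_A x.
Proof. by rewrite sqcR indicE; case: (_ \in _); rewrite ?expr1n ?expr0n. Qed.

Lemma sqint_cindic (A : set R) : measurable A -> (mu A < +oo)%E -> sqint (cindic A).
Proof.
move=> mA fA; split; first exact: cmeas_indic.
by under eq_fun do rewrite sqc_cindic; exact: rint_indic.
Qed.

Let mD : measurable D. Proof. exact: measurable_itv. Qed.
Let fD : (mu D < +oo)%E.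
Proof. by rewrite lebesgue_measure_itv/=; case: ifP => _; rewrite -?EFinB ltry. Qed.

(** Cutting the exponentials off to one period makes them square integrable on the line, where the
    results on orthogonal systems apply. *)
Definition trig (n : int) (x : R) : R[i] := expi (n%:~R * t0 * x) * cindic D x.

Lemma sqint_trig n : sqint (trig n).
Proof. by apply: sqint_expi; exact: sqint_cindic. Qed.

Lemma trig_mulJ n m x : trig n x * (trig m x)^*%C =
  (\1_D x)%:C * expi ((n - m)%:~R * t0 * x).
Proof.
rewrite /trig conjcM expiJ mulrACA [X in _ * X](_ : _ = (\1_D x)%:C); last first.
  by rewrite /cindic conjc_real -/(cindic D x) cindic_sq.
rewrite -expiD mulrC; congr (_ * expi _).
by rewrite intrB; ring.
Qed.

Lemma inner_trig n m : inner (trig n) (trig m) = if n == m then T%:C else 0.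
Proof.
have aT : a <= a + T by rewrite lerDl ltW.
rewrite innerE; under eq_fun do rewrite trig_mulJ.
case: eqVneq => [->|nm].
  under eq_fun do rewrite subrr !mul0r expi0 mulr1.
  apply: complexP; rewrite ?Re_cintegral ?Im_cintegral.
    by rewrite rintegral_itv1// addrAC subrr add0r.
  by rewrite rintegral0.
set k := (n - m)%:~R * t0.
have k0 : k != 0.
  rewrite !mulf_neq0 ?intr_eq0 ?subr_eq0//.
    by rewrite gt_eqF// pi_gt0.
  by rewrite invr_eq0 gt_eqF.
have per : expi (k * (a + T)) = expi (k * a).
  rewrite mulrDr expiD [X in _ * X](_ : _ = 1) ?mulr1//.
  rewrite -[RHS](expi_2pi (n - m)); congr expi.
  by rewrite /k /t0; field; rewrite gt_eqF.
apply: complexP; rewrite ?Re_cintegral ?Im_cintegral.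
  under eq_fun do rewrite ReZ Re_expi.
  rewrite rintegral_cos// (_ : sin _ = sin (k * a)) ?subrr ?mul0r//.
  by move: per => /(congr1 (@complex.Im R)).
under eq_fun do rewrite ImZ Im_expi.
rewrite rintegral_sin// (_ : cos (k * (a + T)) = cos (k * a)) ?subrr ?mul0r//.
by move: per => /(congr1 (@complex.Re R)).
Qed.

Notation span := (in_span trig T).

(** Modulation moves the coefficient of index [n] to index [n + m], so translating the index set by
    [m] leaves the residual unchanged in norm. *)
Lemma span_expi m f : span f -> span (fun x => expi (m%:~R * t0 * x) * f x).
Proof.
move=> [lf sf]; split; first exact: sqint_expi.
move=> d /sf[J uJ fJ]; exists [seq (n + m)%R | n <- J].
  by rewrite map_inj_uniq//; exact: addIr.
move: fJ; rewrite !(nrm2_resid T0 sqint_trig inner_trig)//; last 2 first.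
- by rewrite map_inj_uniq//; exact: addIr.
- exact: sqint_expi.
rewrite nrm2_expi big_map.
congr (_ - _ * _ < _); apply: eq_bigr => n _; congr sqc.
rewrite !innerE; congr cintegral; apply/funext => x.
rewrite /trig !conjcM !expiJ.
have -> : expi (- (n%:~R * t0 * x)) = expi (m%:~R * t0 * x) * expi (- ((n + m)%:~R * t0 * x)).
  by rewrite -expiD; congr expi; rewrite intrD; ring.
by ring.
Qed.

(* Bounded real functions whose restriction to [D] lies in the closed span of
   the exponentials form an algebra, stable under bounded pointwise limits. *)
Record span_bounded (u : R -> R) : Prop := SpanBounded {
  span_bounded_meas : measurable_fun setT u;
  span_bounded_bound : exists M, forall x, `|u x| <= M;
  span_bounded_span : span (fun x => (u x)%:C * cindic D x) }.

(** Replace [f] by a finite Fourier sum: [u] times each exponential stays in the span by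
    [span_expi], and boundedness of [u] multiplies the squared error by at most [M ^+ 2]. *)
Lemma span_mul (u : R -> R) f : span_bounded u -> span f ->
  span (fun x => (u x)%:C * f x).
Proof.
move=> [mu_ [M uM] su] [lf sf].
have lu g : sqint g -> sqint (fun x => (u x)%:C * g x).
  apply: (@sqintMl _ _ _ (M ^+ 2)); first exact: cmeasR.
  by move=> x; rewrite sqcR -(real_normK (num_real _)) lerXn2r ?nnegrE// (le_trans _ (uM x)).
have M0 : 0 <= M by apply: le_trans (uM 0).
apply: (in_span_lim T0 sqint_trig inner_trig); first exact: lu.
move=> d d0; have d1 : 0 < d / (M ^+ 2 + 1) by rewrite divr_gt0// ltr_wpDl// sqr_ge0.
have [J uJ fJ] := sf _ d1.
exists (fun x => (u x)%:C * fourier_sum trig T J f x).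
  have -> : (fun x => (u x)%:C * fourier_sum trig T J f x) =
    (fun x => \sum_(n <- J) ((T^-1)%:C * inner f (trig n)) *
      (expi (n%:~R * t0 * x) * ((u x)%:C * cindic D x))).
    apply/funext => x; rewrite /fourier_sum mulr_sumr; apply: eq_bigr => n _.
    by rewrite {2}/trig; ring.
  apply: (in_span_sum T0 sqint_trig inner_trig) => n.
  exact: (in_spanZ sqint_trig _ (span_expi _ su)).
have lr : sqint (fun x => f x - fourier_sum trig T J f x).
  exact: (sqintB lf (sqint_fourier_sum _ sqint_trig _ _)).
under eq_fun do rewrite -mulrBr.
apply: (@le_lt_trans _ _ (M ^+ 2 * nrm2 (fun x => f x - fourier_sum trig T J f x))).
  rewrite -[M ^+ 2]sqcR -nrm2Z//.
  apply: nrm2_le; [exact: lu|exact: sqintZ|].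
  move=> x; rewrite !sqcM ler_wpM2r ?sqc_ge0// !sqcR.
  by rewrite -(real_normK (num_real (u x))) lerXn2r ?nnegrE.
move: fJ; rewrite ltr_pdivlMr; last by rewrite ltr_wpDl// sqr_ge0.
apply: le_lt_trans; rewrite mulrC ler_wpM2l ?nrm2_ge0//.
by rewrite lerDl.
Qed.

Lemma span_boundedD u v : span_bounded u -> span_bounded v ->
  span_bounded (fun x => u x + v x).
Proof.
move=> [mu_ [M uM] su] [mv [N vN] sv]; split; first exact: measurable_funD.
  by exists (M + N) => x; apply: le_trans (ler_normD _ _) (lerD (uM x) (vN x)).
under eq_fun do rewrite rcD mulrDl.
exact: (in_spanD T0 sqint_trig inner_trig su sv).
Qed.

Lemma span_boundedZ k u : span_bounded u -> span_bounded (fun x => k * u x).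
Proof.
move=> [mu_ [M uM] su]; split; first exact: measurable_funM.
  by exists (`|k| * M) => x; rewrite normrM ler_wpM2l.
under eq_fun do rewrite rcM -mulrA.
exact: (in_spanZ sqint_trig _ su).
Qed.

Lemma span_boundedM u v : span_bounded u -> span_bounded v ->
  span_bounded (fun x => u x * v x).
Proof.
move=> wu [mv [N vN] sv]; have [mu_ [M uM] su] := wu; split; first exact: measurable_funM.
  by exists (M * N) => x; rewrite normrM ler_pM.
under eq_fun do rewrite rcM -mulrA.
exact: span_mul wu sv.
Qed.

Lemma span_bounded1 : span_bounded (fun=> 1).
Proof.
split; [exact: measurable_cst|by exists 1 => x; rewrite normr1|].
have := in_span_gen T0 sqint_trig inner_trig 0; congr in_span.
by apply/funext => x; rewrite /trig !mul0r expi0.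
Qed.

Lemma span_bounded_cst k : span_bounded (fun=> k).
Proof. by have := span_boundedZ k span_bounded1; under eq_fun do rewrite mulr1. Qed.

Lemma span_boundedB u v : span_bounded u -> span_bounded v ->
  span_bounded (fun x => u x - v x).
Proof.
move=> su sv; under eq_fun do rewrite -mulN1r.
exact: (span_boundedD su (span_boundedZ _ sv)).
Qed.

Lemma span_boundedX u n : span_bounded u -> span_bounded (fun x => u x ^+ n).
Proof.
move=> su; elim: n => [|n IHn].
  by under eq_fun do rewrite expr0; exact: span_bounded1.
by under eq_fun do rewrite exprS; exact: span_boundedM.
Qed.

Lemma span_bounded_sum (K : Type) (s : seq K) (F : K -> R -> R) :
  (forall i, span_bounded (F i)) -> span_bounded (fun x => \sum_(i <- s) F i x).
Proof.
move=> iF; elim: s => [|i s IHs].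
  by under eq_fun do rewrite big_nil; exact: span_bounded_cst.
by under eq_fun do rewrite big_cons; exact: span_boundedD.
Qed.

(** Dominated convergence in L^2: the errors on the bounded interval [D] are dominated by [2 * M]
    times its indicator. *)
Lemma span_bounded_lim (u_ : nat -> R -> R) (u : R -> R) (M : R) :
  (forall n, span_bounded (u_ n)) -> (forall n x, `|u_ n x| <= M) ->
  (forall x, u_ ^~ x @ \oo --> u x) -> span_bounded u.
Proof.
move=> su_ uM cu.
have mu_ : measurable_fun setT u.
  apply: (@measurable_fun_cvg _ _ _ _ u_) => [n|x _]; first by case: (su_ n).
  exact: cu.
have M0 : 0 <= M by apply: le_trans (uM 0 0).
have ub x : `|u x| <= M.
  have cn : (fun n => `|u_ n x|) @ \oo --> `|u x| by apply: cvg_norm; exact: cu.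
  by apply: (cvgr_to_le cn); apply: nearW => n; exact: uM.
split => //; first by exists M.
have lD : sqint (cindic D) by exact: sqint_cindic.
have lv (v : R -> R) : measurable_fun setT v -> (forall x, `|v x| <= M) ->
    sqint (fun x => (v x)%:C * cindic D x).
  move=> mv vM; apply: (@sqintMl _ _ _ (M ^+ 2)); [exact: cmeasR|move=> x|exact: lD].
  by rewrite sqcR -(real_normK (num_real _)) lerXn2r ?nnegrE.
apply: (in_span_cvg T0 sqint_trig inner_trig (f_ := fun n x => (u_ n x)%:C * cindic D x)).
- exact: lv.
- by move=> n; case: (su_ n).
apply: (@nrm2_dct _ _ _ (fun x => (2 * M)%:C * cindic D x)).
- by move=> n; apply: lv; [case: (su_ n)|exact: uM].
- by case: (lv u mu_ ub).
- exact: sqintZ.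
- move=> x; under eq_fun do rewrite -mulrBl -rcB sqcM sqcR.
  rewrite -[0](mul0r (sqc (cindic D x))); apply: cvgMr_tmp.
  have c0 : (fun n => u_ n x - u x) @ \oo --> 0.
    by rewrite -(subrr (u x)); apply: cvgB; [exact: cu|exact: cvg_cst].
  by under eq_fun do rewrite expr2; rewrite -[0](mulr0 0); exact: (cvgM c0 c0).
- move=> n x; rewrite -mulrBl -rcB !sqcM ler_wpM2r ?sqc_ge0// !sqcR.
  rewrite -(real_normK (num_real (_ - _))) lerXn2r ?nnegrE ?mulr_ge0//.
  apply: le_trans (ler_normB _ _) _; rewrite mulr2n mulrDl mul1r.
  exact: lerD.
Qed.

(** The polynomials in [u] that [cvg_threshold] provides belong to the algebra and take their values
    in [[0, 1]], so their pointwise limit belongs to it too. *)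
Lemma span_bounded_threshold (u : R -> R) : span_bounded u ->
  (forall x, 0 <= u x <= 1) -> span_bounded (\1_[set x | u x < 2^-1]).
Proof.
move=> su u01.
apply: (@span_bounded_lim (fun n x => (1 - u x ^+ n) ^+ (n * 2 ^ n)) _ 1).
- move=> n; apply: span_boundedX; apply: span_boundedB; first exact: span_bounded1.
  exact: span_boundedX.
- move=> n x; have /andP[a0 a1] : 0 <= u x ^+ n <= 1.
    by have /andP[? ?] := u01 x; rewrite exprn_ge0// exprn_ile1.
  by rewrite ger0_norm ?exprn_ge0 ?exprn_ile1 ?subr_ge0// lerBlDr lerDl.
- move=> x; have := cvg_threshold (u01 x); congr (_ --> nbhs (_ : R)).
  by rewrite indicE; case: ifPn => h; [rewrite mem_set|rewrite memNset//; apply/negP].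
Qed.

Lemma span_bounded_cos m : span_bounded (fun x => cos (t0 * x + m)).
Proof.
have b1 x : `|cos x| <= (1 : R) by rewrite ler_norml cos_geN1 cos_le1.
split.
- apply: (measurableT_comp (f := @cos R)).
    by apply: continuous_measurable_fun; exact: continuous_cos.
  by apply: measurable_funD => //; exact: measurable_funM.
- by exists 1 => x; exact: b1.
have s1 := in_spanZ sqint_trig (expi m / 2) (in_span_gen T0 sqint_trig inner_trig 1).
have s2 := in_spanZ sqint_trig (expi (- m) / 2) (in_span_gen T0 sqint_trig inner_trig (-1)).
have := in_spanD T0 sqint_trig inner_trig s1 s2; congr in_span.
apply/funext => x; rewrite /trig.
have -> : 1%:~R * t0 * x = t0 * x by rewrite mulr1z mul1r.
have -> : (-1)%:~R * t0 * x = - (t0 * x) by rewrite mulrN1z mulN1r mulNr.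
have <- : (expi (t0 * x + m) + expi (- (t0 * x + m))) / 2 = (cos (t0 * x + m))%:C.
  apply: (mulIf (x := 2)); first by rewrite pnatr_eq0.
  by rewrite divfK ?pnatr_eq0//; apply: complexP; rewrite !reimE ?cosN ?sinN; ring.
by rewrite opprD !expiD; field.
Qed.

Let spanset (A : set R) := measurable A /\ span_bounded (\1_A).

Lemma span_bounded_eqD (u v : R -> R) : span_bounded u -> measurable_fun setT v ->
  (exists M, forall x, `|v x| <= M) -> (forall x, D x -> u x = v x) -> span_bounded v.
Proof.
move=> [mu_ _ su] mv bv uv; split => //; move: su; congr in_span.
apply/funext => x; rewrite /cindic indicE.
by have [/set_mem/uv ->//|] := boolP (x \in D); rewrite !mulr0.
Qed.

Let indic_meas_bound (A : set R) : measurable A -> 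
  measurable_fun setT (\1_A : R -> R) /\ exists M, forall x, `|\1_A x : R| <= M.
Proof.
move=> mA; split; first exact: measurable_indic.
by exists 1 => x; rewrite indicE; case: (_ \in _); rewrite ?normr1 ?normr0.
Qed.

(* On [D], the inequality [cos (t0 * (x - m)) > cos (t0 * (c - a) / 2)], where
   [m] is the midpoint of [a] and [c], says exactly that [a < x < c]. *)
Lemma spanset_itv c : spanset (`[c, +oo[%classic : set R).
Proof.
split; first exact: measurable_itv.
have mI : measurable (`[c, +oo[%classic : set R) by exact: measurable_itv.
have [mf bf] := indic_meas_bound mI.
have [ca|ac] := leP c a.
  apply: (span_bounded_eqD span_bounded1 mf bf) => x.
  rewrite /D/= in_itv/= => /andP[ax _]; rewrite indicE mem_set//= in_itv/= andbT.
  by rewrite (le_trans ca)// ltW.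
have [aTc|caT] := ltP (a + T) c.
  apply: (span_bounded_eqD (span_bounded_cst 0) mf bf) => x.
  rewrite /D/= in_itv/= => /andP[_ xaT]; rewrite indicE memNset//= in_itv/= andbT.
  by apply/negP; rewrite -ltNge (le_lt_trans xaT).
pose m := (a + c) / 2; pose th := t0 * (c - a) / 2.
(* This rescaling puts the values in [[0, 1]] and places the threshold [2^-1] exactly where the two
   cosines agree. *)
pose u x := 2^-1 + (cos th - cos (t0 * x + - (t0 * m))) / 4.
have su : span_bounded u.
  rewrite /u; apply: span_boundedD; first exact: span_bounded_cst.
  have := span_boundedZ (4^-1) (span_boundedB (span_bounded_cst (cos th)) (span_bounded_cos (- (t0 * m)))).
  by under eq_fun do rewrite mulrC.
have u01 x : 0 <= u x <= 1.
  rewrite /u; have := cos_geN1 th; have := cos_le1 th.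
  have := cos_geN1 (t0 * x - t0 * m); have := cos_le1 (t0 * x - t0 * m); lra.
have sw := span_boundedB span_bounded1 (span_bounded_threshold su u01).
apply: (span_bounded_eqD sw mf bf) => x; rewrite /D/= in_itv/= => /andP[ax xaT].
have pi0 := pi_gt0 R.
have t00 : 0 < t0 by rewrite divr_gt0 ?mulr_gt0.
have tT : t0 * T = 2 * pi by rewrite /t0 divfK// gt_eqF.
have th0 : 0 < th by apply: divr_gt0 => //; apply: mulr_gt0; rewrite ?subr_gt0.
have thpi : th <= pi.
  by rewrite /th ler_pdivrMr// [leRHS]mulrC -tT ler_wpM2l ?(ltW t00)//; lra.
have key : (u x < 2^-1) = (x < c).
  rewrite /u gtrDl pmulr_llt0 ?invr_gt0// subr_lt0 -mulrBr.
  set y := t0 * (x - m).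
  have yE : y + th = t0 * (x - a) by rewrite /y /th /m; field.
  have yE' : y - th = t0 * (x - c) by rewrite /y /th /m; field.
  have yth : - th < y by rewrite -subr_gt0 opprK yE mulr_gt0 ?subr_gt0.
  have yub : y <= 2 * pi - th.
    by rewrite lerBrDr yE -tT ler_wpM2l ?(ltW t00)//; lra.
  have xc : (x < c) = (y < th).
    by rewrite -[RHS]subr_lt0 yE' pmulr_rlt0// subr_lt0.
  rewrite xc; have [ylth|thy] := ltP y th.
    have <- : cos `|y| = cos y by case: (ger0P y) => _; rewrite ?cosN.
    have ya : `|y| < th by rewrite ltr_norml yth.
    apply/esym; rewrite ltr_cos ?in_itv/= ?normr_ge0 ?(ltW th0) ?thpi//.
    by rewrite (le_trans (ltW ya)).
  apply/negbTE; rewrite -leNgt.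
  have [ypi|piy] := leP y pi.
    by rewrite leNgt ltr_cos -?leNgt ?in_itv/= ?(ltW th0) ?thpi ?ypi ?(le_trans (ltW th0)).
  (* Past [pi] the cosine increases again; reflecting [y] to [2 * pi - y] brings it back into
     [[th, pi]], where monotonicity applies. *)
  rewrite -[cos y]cosN -(cosD2pi (- y)) leNgt ltr_cos -?leNgt ?in_itv/=.
  - by rewrite mulr2n; lra.
  - by rewrite mulr2n; lra.
  - by rewrite (ltW th0).
rewrite !indicE; have [xc|cx] := ltP x c.
  rewrite mem_set ?subrr /= ?key// memNset//= in_itv/= andbT.
  by apply/negP; rewrite -ltNge.
rewrite memNset /= ?key ?subr0 ?mem_set//=; first by rewrite in_itv/= cx.
by apply/negP; rewrite -leNgt.
Qed.

End TrigSystem.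

(** * Completeness of the exponentials and Parseval's identity *)

Section Parseval.
Import HBNNSimple.
Context {R : realType}.
Notation mu := (@lebesgue_measure R).
Variables (a T : R).
Hypothesis T0 : 0 < T.
Implicit Types (f : R -> R[i]).

Notation D := (`]a, (a + T)]%classic : set R).
Notation t0 := (2 * pi / T).
Notation trg := (trig a T).

(** The measurable sets whose indicator belongs to the algebra form a sigma-algebra that contains
    the rays [[c, +oo[], which generate the Borel sets. *)
Lemma span_bounded_measurable (A : set R) : measurable A -> span_bounded a T (\1_A).
Proof.
pose G := [set A : set R | measurable A /\ span_bounded a T (\1_A)].
suff GA : measurable `<=` G by move=> /GA[].
rewrite [X in X `<=` _]RGenCInfty.measurableE; apply: smallest_sub; last first.
  by move=> _ [c ->]; exact: spanset_itv.
split.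
- split; first exact: measurable0.
  by rewrite indic0; exact: span_bounded_cst.
- move=> B [mB sB]; rewrite setTD; split; first exact: measurableC.
  have := span_boundedB T0 (span_bounded1 a T0) sB; congr span_bounded.
  apply/funext => x; rewrite !indicE in_setC.
  by case: (x \in B); rewrite /= ?subrr ?subr0.
- move=> F GF; split; first by apply: bigcupT_measurable => i; case: (GF i).
  (* [P n] is the indicator of the complement of the first [n] sets: a finite product in the
     algebra, converging boundedly to the indicator of the complement of the whole union. *)
  pose P n x : R := \prod_(i < n) (1 - \1_(F i) x).
  have sP n : span_bounded a T (P n).
    elim: n => [|n IHn].
      have := span_bounded1 a T0; congr span_bounded.
      by apply/funext => x; rewrite /P big_ord0.
    have -> : P n.+1 = (fun x => P n x * (1 - \1_(F n) x)).
      by apply/funext => x; rewrite /P big_ord_recr.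
    apply: (span_boundedM T0 IHn); apply: (span_boundedB T0 (span_bounded1 a T0)).
    by case: (GF n).
  have P01 n x : 0 <= P n x <= 1.
    elim: n => [|n /andP[P0 P1]]; first by rewrite /P big_ord0 ler01 lexx.
    rewrite /P big_ord_recr/= -/(P n x) indicE.
    by case: (_ \in _); rewrite /= ?subrr ?subr0 ?mulr0 ?mulr1 ?P0 ?lexx ?ler01.
  suff sQ : span_bounded a T (fun x => 1 - \1_(\bigcup_k F k) x).
    have := span_boundedB T0 (span_bounded1 a T0) sQ; congr span_bounded.
    by apply/funext => x; rewrite opprB addrC subrK.
  apply: (@span_bounded_lim _ _ _ T0 P _ 1) => //.
    by move=> n x; have /andP[P0 P1] := P01 n x; rewrite ger0_norm.
  move=> x; have [[k _ xFk]|nx] := pselect ((\bigcup_k F k) x).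
    apply: cvg_near_cst; near=> n.
    rewrite indicE mem_set; last by exists k.
    have kn : (k < n)%N by near: n; exists k.+1.
    by rewrite /P (bigD1 (Ordinal kn))//= indicE mem_set//= subrr mul0r.
  apply: cvg_near_cst; near=> n.
  rewrite indicE memNset// subr0 /P big1// => i _.
  by rewrite indicE memNset ?subr0// => Fi; apply: nx; exists i.
Unshelve. all: end_near. Qed.

Lemma span_bounded_nnsfun (g : {nnsfun R >-> R}) : span_bounded a T g.
Proof.
have -> : (g : R -> R) = fun x => \sum_(y <- fset_set (range g)) y * \1_(g @^-1` [set y]) x.
  by apply/funext => x; rewrite fimfunE fsbig_finite.
apply: (span_bounded_sum T0) => y.
have mg : measurable (g @^-1` [set y]) by [].
exact: (span_boundedZ y (span_bounded_measurable mg)).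
Qed.

Let mD : measurable D. Proof. exact: measurable_itv. Qed.

(** Simple functions increase to [v], and [v] itself dominates the errors. *)
Lemma span_nonneg (v : R -> R) : measurable_fun setT v -> (forall x, 0 <= v x) ->
  sqint (fun x => (v x)%:C) -> in_span trg T (fun x => (v x)%:C * cindic D x).
Proof.
move=> mv v0 lv.
have lvD : sqint (fun x => (v x)%:C * cindic D x).
  by have := sqint_indic mD lv; under eq_fun do rewrite mulrC.
have mv' : measurable_fun setT (EFin \o v) by exact/measurable_EFinP.
pose g := nnsfun_approx measurableT mv'.
have gv x : (fun n => g n x) @ \oo --> v x.
  have := cvg_nnsfun_approx measurableT mv' (fun x _ => v0 x) (x := x) I.
  by move=> /fine_cvgP[_]; exact.
have g_le n x : 0 <= g n x <= v x.
  rewrite fun_ge0/= -lee_fin /g nnsfun_approxE.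
  by apply: (@le_approx _ _ _ setT (EFin \o v) n x) => // y _; rewrite lee_fin.
apply: (in_span_cvg T0 (sqint_trig a T) (inner_trig a T0)
    (f_ := fun n x => (g n x)%:C * cindic D x)) => //.
  by move=> n; case: (span_bounded_nnsfun (g n)).
apply: (@nrm2_dct _ _ _ (fun x => (v x)%:C * cindic D x)) => //.
- by move=> n; case: (span_bounded_nnsfun (g n)) => _ _ [].
- by case: lvD.
- move=> x; under eq_fun do rewrite -mulrBl -rcB sqcM sqcR.
  rewrite -[0](mul0r (sqc (cindic D x))); apply: cvgMr_tmp.
  have c0 : (fun n => g n x - v x) @ \oo --> 0.
    by rewrite -(subrr (v x)); apply: cvgB; [exact: gv|exact: cvg_cst].
  by under eq_fun do rewrite expr2; rewrite -[0](mulr0 0); exact: (cvgM c0 c0).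
- move=> n x; rewrite -mulrBl -rcB !sqcM ler_wpM2r ?sqc_ge0// !sqcR.
  by have /andP[g0 gle] := g_le n x; nra.
Qed.

(** Completeness of the trigonometric system on a period. Taking real and imaginary parts, then
    positive and negative parts, reduces it to nonnegative functions. *)
Lemma span_sqint f : sqint f -> in_span trg T (fun x => f x * cindic D x).
Proof.
move=> [mf lf].
have [mr mi] := mf.
have part (u : R -> R) : measurable_fun setT u -> (forall x, `|u x| ^+ 2 <= sqc (f x)) ->
    in_span trg T (fun x => (u x)%:C * cindic D x).
  move=> mu_ uf.
  have sub (v : R -> R) : measurable_fun setT v -> (forall x, 0 <= v x <= `|u x|) ->
     in_span trg T (fun x => (v x)%:C * cindic D x).
    move=> mv vu; apply: span_nonneg => // [x|]; first by case/andP: (vu x).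
    apply: (@sqint_le _ _ f 1); [exact: cmeasR|by []|] => x.
    rewrite mul1r sqcR (le_trans _ (uf x))// lerXn2r ?nnegrE//.
      by case/andP: (vu x).
    by case/andP: (vu x).
  have -> : (fun x => (u x)%:C * cindic D x) = (fun x => (Num.max (u x) 0)%:C * cindic D x -
      (Num.max (- u x) 0)%:C * cindic D x).
    apply/funext => x; rewrite -mulrBl -rcB; congr (_%:C * _).
    by case: (leP (u x) 0); case: (leP (- u x) 0); lra.
  apply: (in_spanB T0 (sqint_trig a T) (inner_trig a T0)).
    apply: sub; first exact: measurable_maxr.
    by move=> x; case: (leP (u x) 0); rewrite ?lexx ?normr_ge0// => u0; rewrite ltW//= ler_norm.
  apply: sub; first by apply: measurable_maxr => //; exact: measurableT_comp.
  by move=> x; case: (leP (- u x) 0); rewrite ?lexx ?normr_ge0// => u0; rewrite ltW//= -normrN ler_norm.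
have s1 : in_span trg T (fun x => (complex.Re (f x))%:C * cindic D x).
  by apply: part => // x; rewrite real_normK ?num_real// /sqc lerDl sqr_ge0.
have s2 : in_span trg T (fun x => (complex.Im (f x))%:C * cindic D x).
  by apply: part => // x; rewrite real_normK ?num_real// /sqc lerDr sqr_ge0.
have := in_spanD T0 (sqint_trig a T) (inner_trig a T0) s1
  (in_spanZ (sqint_trig a T) 'i%C s2).
congr in_span; apply/funext => x.
by rewrite [f x in RHS]complex_algE mulrDl mulrA.
Qed.

(** Unnormalised and integrated over the whole line. For a function supported in a period of length
    [2 * pi / c] this is the inner product with [trig]. *)
Definition trig_coef (c : R) (n : int) f : R[i] :=
  cintegral (fun x => f x * expi (- (n%:~R * c * x))).

Lemma parseval f : sqint f -> (forall x, ~ `[a, a + T]%classic x -> f x = 0) ->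
  (\esum_(n in [set: int]) (sqc (trig_coef t0 n f))%:E = (T * nrm2 f)%:E)%E.
Proof.
move=> lf f0.
have lfD : sqint (fun x => f x * cindic D x).
  by have := sqint_indic mD lf; under eq_fun do rewrite mulrC.
(* The support may contain the left endpoint [a], which the half-open period [D] omits. *)
have aeE : {ae mu, forall x, f x * cindic D x = f x}.
  exists [set a]; split => //; first exact: lebesgue_measure_set1.
  move=> x /= fx; apply: contrapT => xa; apply: fx.
  rewrite /cindic indicE; have [xD|xD] := boolP (x \in D); first by rewrite mulr1.
  rewrite mulr0 f0// /= in_itv/= => /andP[ax xb].
  move/negP: xD; apply; rewrite inE/= in_itv/= xb andbT.
  by rewrite lt_neqAle ax andbT; apply/eqP => /esym.
rewrite -(nrm2_ae _ _ aeE); [|by case: lfD|by case: lf].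
rewrite -(in_span_parseval T0 (sqint_trig a T) (inner_trig a T0) (span_sqint lf)).
apply: eq_esum => n _; congr (EFin (sqc _)).
rewrite innerE; apply: cintegral_ae.
- apply: cmeasM; first by case: lf.
  by apply: cmeas_expi; apply: measurableT_comp => //; exact: measurable_funM.
- apply: cmeasM; first by case: lfD.
  by apply: cmeasJ; case: (sqint_trig a T n).
- move: aeE; apply: ae_imp => x {1}<-.
  rewrite /trig conjcM expiJ /cindic conjc_real -/(cindic _ x).
  by rewrite -{1}(cindic_sq D x); ring.
Qed.

End Parseval.

(** * The Fourier transform of square integrable functions *)

Section Tiling.
Context {R : realType}.
Notation mu := (@lebesgue_measure R).

(** The two measures agree on half-open intervals, and these determine Lebesgue measure. *)
Lemma lebesgue_measureD (c : R) (A : set R) : measurable A ->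
  pushforward mu (+%R^~ c : _ -> measurableTypeR R) A = mu A.
Proof.
move=> mA; apply/esym.
have mphi : measurable_fun setT (+%R^~ c : _ -> measurableTypeR R).
  by apply: measurable_funD => //; exact: measurable_cst.
apply: (lebesgue_measure_unique
  (mu := pushforward mu (+%R^~ c : _ -> measurableTypeR R))) => //= _ [[a b]] _ <-.
rewrite /pushforward (_ : _ @^-1` _ = `]a - c, b - c]%classic).
  rewrite !lebesgue_measure_itv/= !lte_fin ltrD2r -!EFinB.
  by have -> : b - c - (a - c) = b - a by ring.
by apply/seteqP; split => x /=; rewrite !in_itv/= ltrBlDr lerBrDr.
Qed.

Lemma ge0_integral_shift (u : R -> \bar R) (c L : R) : measurable_fun setT u ->
  (forall x, 0 <= u x)%E ->
  (\int[mu]_(x in `[c, (c + L)%R[) u x = \int[mu]_(x in `[0%R, L[) u (x + c)%R)%E.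
Proof.
move=> mf f0.
rewrite (_ : `[0%R, L[%classic =
  (+%R^~ c : _ -> measurableTypeR R) @^-1` `[c, (c + L)%R[); last first.
  by apply/seteqP; split => x /=; rewrite !in_itv/= lerDr [c + L]addrC ltrD2r.
rewrite -(@ge0_integral_pushforward _ _ (measurableTypeR R) (measurableTypeR R)
  R (+%R^~ c) _ mu _ u)//=; last first.
- exact: measurable_funS mf.
- by apply: measurable_funD => //; exact: measurable_cst.
apply: eq_measure_integral; first by apply: measurable_funD => //; exact: measurable_cst.
by move=> mp A mA _; rewrite /= lebesgue_measureD.
Qed.

(** Countable additivity is stated for sequences, whereas the cells of the lattice are indexed by
    [int]. *)
Definition nat_int (k : nat) : int := if odd k then Negz k./2 else Posz k./2.

Lemma nat_int_bij : set_bij [set: nat] [set: int] nat_int.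
Proof.
split.
- by move=> k _.
- move=> i j _ _; rewrite /nat_int.
  move=> E; rewrite -(odd_double_half i) -(odd_double_half j); move: E.
  by case: (odd i); case: (odd j) => // -[->].
- move=> [n|n] _ /=.
    by exists n.*2 => //; rewrite /nat_int odd_double doubleK.
  by exists n.*2.+1 => //; rewrite /nat_int /= odd_double/= uphalf_double.
Qed.

(** The cells are the translates of [[0, L[] by [- n * L]; the floor of [x / L] tells which one
    contains [x], whence both covering and disjointness. The minus sign agrees with the exponent in
    [trig_coef]. *)
Lemma ge0_integral_tiling (u : R -> \bar R) (L : R) : 0 < L ->
  measurable_fun setT u -> (forall x, 0 <= u x)%E ->
  (\int[mu]_x u x = \int[mu]_(s in `[0%R, L[) \esum_(n in [set: int]) u (s - n%:~R * L)%R)%E.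
Proof.
move=> L0 mf f0.
pose F k : set R := `[- ((nat_int k)%:~R * L), (- ((nat_int k)%:~R * L) + L)[%classic.
have FE k x : F k x -> Num.floor (x / L) = - nat_int k.
  rewrite /F/= in_itv/= => /andP[a b]; apply: floor_def.
  rewrite ler_pdivlMr// ltr_pdivrMr// intrD intrN mulr1z mulNr a.
  by rewrite mulrDl mulNr mul1r b.
have UF : \bigcup_k F k = setT.
  rewrite -subTset => x _.
  have [_ _ /(_ (- Num.floor (x / L)) I)[k _ kE]] := nat_int_bij.
  exists k => //; rewrite /F kE/= in_itv/= intrN mulNr opprK.
  have := floor_itv (x / L); rewrite intrD mulr1z.
  rewrite ler_pdivlMr// ltr_pdivrMr// => /andP[-> h].
  by rewrite -[X in _ + X]mul1r -mulrDl.
have tF : trivIset setT F.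
  apply/trivIsetP => i j _ _ ij; apply/seteqP; split => // x [/FE xi /FE].
  rewrite xi => /oppr_inj eij; have [_ inj _] := nat_int_bij.
  by move/eqP: ij; apply; apply: inj eij; rewrite inE.
rewrite -UF ge0_integral_bigcup//=; last 2 first.
- by move=> k; exact: measurable_itv.
- by rewrite UF.
under eq_eseriesr do rewrite /F ge0_integral_shift//.
rewrite -integral_nneseries//; last first.
- move=> k; apply: measurable_funTS; apply: measurableT_comp => //.
  by apply: measurable_funD => //; exact: measurable_cst.
apply: eq_integral => s _.
by rewrite nneseries_esumT// (reindex_esum setT _ nat_int)//; exact: nat_int_bij.
Qed.

End Tiling.

Section ComplexContinuity.
Context {R : realType}.

Lemma norm_normc (z : R[i]) : `|z| = (Normc.normc z)%:C.
Proof. by rewrite normc_def normcE2. Qed.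

Lemma continuous_complexP (f : R -> R[i]) :
  continuous (f : R -> R[i]^o) <->
  continuous (fun x => complex.Re (f x)) /\ continuous (fun x => complex.Im (f x)).
Proof.
split=> [cf|[cr ci]].
  split=> x; apply/cvgrPdist_lt => e e0.
    have /cvgrPdist_lt/(_ e%:C) := cf x; rewrite ltcR => /(_ e0).
    apply: filterS => t; rewrite norm_normc ltcR; apply: le_lt_trans.
    have -> : complex.Re (f x) - complex.Re (f t) = complex.Re (f x - f t).
      by rewrite !reimE.
    exact: le_Re_normc.
  have /cvgrPdist_lt/(_ e%:C) := cf x; rewrite ltcR => /(_ e0).
  apply: filterS => t; rewrite norm_normc ltcR; apply: le_lt_trans.
  have -> : complex.Im (f x) - complex.Im (f t) = complex.Im (f x - f t).
    by rewrite !reimE.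
  exact: le_Im_normc.
move=> x; apply/cvgrPdist_lt => -[e e'] h.
(* In the order on complex numbers, a positive element is a positive real. *)
have [e0 ie] : 0 < e /\ e' = 0 by move: h; rewrite ltcE/= => /andP[/eqP].
have e2 : 0 < e / 2 by rewrite divr_gt0.
have /cvgrPdist_lt/(_ _ e2) h1 := cr x.
have /cvgrPdist_lt/(_ _ e2) h2 := ci x.
near=> t; rewrite ie norm_normc ltcR.
apply: le_lt_trans (normc_le_ReIm _) _; rewrite !reimE [e]splitr.
by apply: ltrD; near: t.
Unshelve. all: end_near. Qed.

Lemma continuous_cmeas (f : R -> R[i]) : continuous (f : R -> R[i]^o) -> cmeasurable f.
Proof.
by move=> /continuous_complexP[? ?]; split; exact: continuous_measurable_fun.
Qed.

(** The set where the functions differ is open; if nonempty it contains a ball, which has positive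
    measure. *)
Lemma continuous_ae_eqR (f g : R -> R) : continuous f -> continuous g ->
  {ae (@lebesgue_measure R), forall x, f x = g x} -> f = g.
Proof.
move=> cf cg [N [mN N0 fgN]]; apply/funext => x; apply: contrapT => fgx.
have cd : continuous (fun x => f x - g x).
  by move=> y; apply: continuousB; [exact: cf|exact: cg].
have : nbhs x ((fun x => f x - g x) @^-1` [set z | z != 0]).
  apply: cd; apply: open_nbhs_nbhs; split; first exact: open_neq.
  by rewrite /= subr_eq0; apply/eqP.
move=> /nbhs_ballP[e /= e0 be].
have : ((@lebesgue_measure R) (ball x e) <= 0)%E.
  rewrite -N0; apply: le_measure; rewrite ?inE//.
    exact: measurable_ball.
  by move=> y /be/= ne; apply: fgN => /= fgy; move: ne; rewrite fgy subrr eqxx.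
by rewrite lebesgue_measure_ball ?(ltW e0)// lee_fin leNgt mulrn_wgt0.
Qed.

Lemma continuous_ae_eq (f g : R -> R[i]) :
  continuous (f : R -> R[i]^o) -> continuous (g : R -> R[i]^o) ->
  {ae (@lebesgue_measure R), forall x, f x = g x} -> f = g.
Proof.
move=> /continuous_complexP[fr fi] /continuous_complexP[gr gi] fg.
have rE := continuous_ae_eqR fr gr (ae_imp (fun x E => congr1 _ E) fg).
have iE := continuous_ae_eqR fi gi (ae_imp (fun x E => congr1 _ E) fg).
apply/funext => x; apply: complexP.
  by move/(congr1 (@^~ x)) : rE.
by move/(congr1 (@^~ x)) : iE.
Qed.

End ComplexContinuity.

Transparent rint.

(** * The inverse transform of functions with bounded support *)

Section FourierTransform.
Context {R : realType}.
Notation mu := (@lebesgue_measure R).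
Implicit Types (f g : R -> R[i]) (x xi w : R).

Definition sqrt2piV : R := (Num.sqrt (2 * pi))^-1.

Lemma sqrt2piV_sq : sqrt2piV ^+ 2 = (2 * pi)^-1.
Proof. by rewrite exprVn sqr_sqrtr// mulr_ge0 ?pi_ge0. Qed.

(** An absolutely convergent integral for integrable [g], so its values are defined pointwise and
    continuous in [x]: it produces the continuous representatives of band-limited functions. *)
Definition inv_fourier g x : R[i] :=
  sqrt2piV%:C * cintegral (fun xi => g xi * expi (x * xi)).

Lemma cint_expi g x : cint g -> cint (fun xi => g xi * expi (x * xi)).
Proof.
move=> cg; apply: cint_le (cint_normc cg).
  apply: cmeasM; first exact: cint_meas.
  by apply: cmeas_expi; exact: measurable_funM.
by move=> y; rewrite !normcE2 sqcM sqc_expi mulr1.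
Qed.

Lemma inv_fourierD f g x : cint f -> cint g ->
  inv_fourier (fun xi => f xi + g xi) x = inv_fourier f x + inv_fourier g x.
Proof.
move=> cf cg; rewrite /inv_fourier -mulrDr -cintegralD; [|exact: cint_expi..].
by under eq_fun do rewrite mulrDl.
Qed.

Lemma inv_fourierZ z g x : cint g ->
  inv_fourier (fun xi => z * g xi) x = z * inv_fourier g x.
Proof.
move=> cg; rewrite /inv_fourier [RHS]mulrCA -(cintegralZ z (cint_expi x cg)).
by under eq_fun do rewrite -mulrA.
Qed.

(** Carries results on [inv_fourier] over to the direct transform. *)
Lemma fourier_inv_conj f xi : cint f ->
  fourier_integral f xi = ((inv_fourier (fun t => (f t)^*%C) xi)^*)%C.
Proof.
move=> cf; rewrite /fourier_integral /inv_fourier conjcM conjc_real -cintegralJ.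
  congr (_ * cintegral _); apply/funext => t.
  by rewrite conjcM conjcK expiJ mulrC [t * _]mulrC mulrC.
by apply: cint_expi; exact: cintJ.
Qed.

Lemma continuous_trig_integral (p q : R -> R) : rint mu p -> rint mu q ->
  continuous (fun x => rintegral mu (fun xi => p xi * cos (x * xi) + q xi * sin (x * xi))).
Proof.
move=> rp rq x.
have b1 y : `|cos y| <= (1 : R) by rewrite ler_norml cos_geN1 cos_le1.
have b2 y : `|sin y| <= (1 : R) by rewrite ler_norml sin_geN1 sin_le1.
have mc y : measurable_fun setT (fun xi : R => cos (y * xi)).
  by apply: continuous_measurable_fun; exact: continuous_cosM.
have ms y : measurable_fun setT (fun xi : R => sin (y * xi)).
  by apply: continuous_measurable_fun; exact: continuous_sinM.
have rg := rintD (rint_norm rp) (rint_norm rq).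
have ub y t : `|p t * cos (y * t) + q t * sin (y * t)| <= `|p t| + `|q t|.
  apply: le_trans (ler_normD _ _) _; rewrite !normrM.
  by apply: lerD; rewrite -[leRHS]mulr1 ler_wpM2l.
have xI : x \in `](x - 1), (x + 1)[%classic.
  by rewrite inE/= in_itv/= ltrBlDr !ltrDl ltr01.
apply: (@continuity_under_integral _ _ _ mu
   (fun x xi => p xi * cos (x * xi) + q xi * sin (x * xi)) setT measurableT
   (x - 1) (x + 1) _ _ (fun t => `|p t| + `|q t|) rg _ x xI).
- move=> y _.
  have mpq : measurable_fun setT (fun t => p t * cos (y * t) + q t * sin (y * t)).
    apply: measurable_funD; apply: measurable_funM => //.
      exact: rint_meas rp.
    exact: rint_meas rq.
  exact: (@rint_le _ _ _ mu _ _ mpq (ub y) rg).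
- apply: nearW => t _ y _.
  have c1 : continuous (fun x : R => cos (x * t)).
    by under eq_fun do rewrite mulrC; exact: continuous_cosM.
  have c2 : continuous (fun x : R => sin (x * t)).
    by under eq_fun do rewrite mulrC; exact: continuous_sinM.
  by apply: cvgD; apply: cvgMl_tmp; [exact: c1|exact: c2].
- by move=> y _; apply: nearW => t _; exact: ub.
Qed.

Lemma continuous_inv_fourier g : cint g -> continuous (inv_fourier g : R -> R[i]^o).
Proof.
move=> cg; have [rg ig] := cg; apply/continuous_complexP; split.
  have -> : (fun x => complex.Re (inv_fourier g x)) = fun x => sqrt2piV *
      rintegral mu (fun xi => complex.Re (g xi) * cos (x * xi) + - complex.Im (g xi) * sin (x * xi)).
    apply/funext => x; rewrite ReZ Re_cintegral; congr (_ * rintegral _ _).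
    by apply/funext => t; rewrite cReM mulNr.
  by move=> x; apply: cvgMl_tmp; exact: (continuous_trig_integral rg (rintN ig)).
have -> : (fun x => complex.Im (inv_fourier g x)) = fun x => sqrt2piV *
    rintegral mu (fun xi => complex.Im (g xi) * cos (x * xi) + complex.Re (g xi) * sin (x * xi)).
  apply/funext => x; rewrite ImZ Im_cintegral; congr (_ * rintegral _ _).
  by apply/funext => t; rewrite cImM addrC.
by move=> x; apply: cvgMl_tmp; exact: (continuous_trig_integral ig rg).
Qed.

Lemma inv_fourier_ae f g : cint f -> cmeasurable g ->
  {ae mu, forall x, f x = g x} -> inv_fourier f = inv_fourier g.
Proof.
move=> cf mg fg; apply/funext => x; congr (_ * _); apply: cintegral_ae.
- exact: cint_meas (cint_expi x cf).
- by apply: cmeasM => //; apply: cmeas_expi; exact: measurable_funM.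
- by move: fg; apply: ae_imp => t ->.
Qed.

Definition supported w g := forall x, ~ `[- w, w]%classic x -> g x = 0.

Lemma cint_supported w g : supported w g -> sqint g -> cint g.
Proof.
move=> gw lg; apply: (cint_sqint_supp (A := `[- w, w]%classic)) => //.
rewrite lebesgue_measure_itv/=; case: ifP => _; by rewrite -?EFinB ltry.
Qed.

(* Sampling [inv_fourier g] along [s + t0 Z] gives the Fourier coefficients of
   a modulation of [g] on a period, so Parseval's identity, integrated over
   [s] in a cell of the lattice, yields Plancherel's. *)
Lemma plancherel_supported w g : 0 < w -> supported w g -> sqint g ->
  sqint (inv_fourier g) /\ nrm2 (inv_fourier g) = nrm2 g.
Proof.
move=> w0 gw lg; have cg := cint_supported gw lg.
have mG : cmeasurable (inv_fourier g).
  exact/continuous_cmeas/continuous_inv_fourier.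
(* The support fills exactly one period, starting at [- w]. *)
pose T := 2 * w; have T0 : 0 < T by rewrite mulr_gt0.
pose t0 := 2 * pi / T; have t00 : 0 < t0 by rewrite divr_gt0 ?mulr_gt0 ?pi_gt0.
have sample s (n : int) : inv_fourier g (s - n%:~R * t0) =
    sqrt2piV%:C * trig_coef t0 n (fun xi => expi (s * xi) * g xi).
  congr (_ * cintegral _); apply/funext => xi.
  rewrite mulrBl [n%:~R * t0 * xi in LHS]mulrC expiD.
  by rewrite [xi * _]mulrC; ring.
have lgs s : sqint (fun xi => expi (s * xi) * g xi) by exact: sqint_expi.
have E : (\int[mu]_x (sqc (inv_fourier g x))%:E = (nrm2 g)%:E)%E.
  rewrite (ge0_integral_tiling t00 (u := fun x => (sqc (inv_fourier g x))%:E)); last 2 first.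
  - by apply/measurable_EFinP; exact: cmeas_sqc.
  - by move=> x; rewrite lee_fin sqc_ge0.
  have tile s : (\esum_(n in [set: int]) (sqc (inv_fourier g (s - n%:~R * t0)))%:E =
      ((2 * pi)^-1 * (T * nrm2 g))%:E)%E.
    have sup : forall x, ~ `[- w, - w + T]%classic x -> expi (s * x) * g x = 0.
      move=> x xw; rewrite gw ?mulr0//.
      by move: xw; rewrite /T (_ : - w + 2 * w = w)//; ring.
    have := parseval T0 (lgs s) sup; rewrite nrm2_expi => P.
    rewrite -(esum_realZ _ _ P); last 2 first.
    - by rewrite invr_gt0 mulr_gt0// pi_gt0.
    - by move=> n; exact: sqc_ge0.
    by apply: eq_esum => n _; rewrite sample sqcM sqcR sqrt2piV_sq.
  (* The lattice sum is constant in [s]; integrated over a cell of length [t0] it leaves the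
     constant [t0 * (2 * pi)^-1 * T], which is 1. *)
  under eq_integral do rewrite tile.
  rewrite integral_cst//= lebesgue_measure_itv/= lte_fin t00 -EFinD -EFinM oppr0 addr0.
  have pn : pi != 0 :> R by rewrite gt_eqF// pi_gt0.
  have wn : w != 0 by rewrite gt_eqF.
  congr EFin; rewrite /t0 /T; move: pi pn => p pn; field.
  by rewrite pn wn.
have lG : sqint (inv_fourier g).
  split => //; apply/rint_ge0P; [exact: cmeas_sqc|by move=> x; exact: sqc_ge0|].
  by rewrite E ltry.
split => //; apply: EFin_inj; rewrite -E rintegralE//.
by case: lG.
Qed.

End FourierTransform.

Transparent rintegral.

Section RealFubini.
Context {d1 d2 : measure_display} {T1 : measurableType d1} {T2 : measurableType d2}.
Context {R : realType}.
Variables (m1 : {sigma_finite_measure set T1 -> \bar R})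
          (m2 : {sigma_finite_measure set T2 -> \bar R}).

Lemma rintegral_fubini (K : T1 * T2 -> R) (a : T1 -> R) (b : T2 -> R) :
  measurable_fun setT K -> rint m1 a -> rint m2 b ->
  (forall x y, `|K (x, y)| <= a x * b y) ->
  rintegral m1 (fun x => rintegral m2 (fun y => K (x, y))) =
  rintegral m2 (fun y => rintegral m1 (fun x => K (x, y))).
Proof.
move=> mK ra rb Kab.
have mEK : measurable_fun setT (EFin \o K) by exact/measurable_EFinP.
have Kx x : measurable_fun setT (fun y => K (x, y)) by exact: measurableT_comp mK _.
have Ky y : measurable_fun setT (fun x => K (x, y)) by exact: measurableT_comp mK _.
have r1 x : rint m2 (fun y => K (x, y)) by apply: rint_le (rintZ (a x) rb).
have r2 y : rint m1 (fun x => K (x, y)).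
  by apply: rint_le (rintZ (b y) ra) => // x; rewrite mulrC.
have iK : (m1 \x m2)%E.-integrable setT (EFin \o K).
  apply/integrable12ltyP => //.
  apply: (@le_lt_trans _ _ (\int[m1]_x ((rintegral m2 b) * a x)%:E)%E); last first.
    by rewrite (rintegralE (rintZ _ ra)) ltry.
  apply: ge0_le_integral => //.
  - by move=> x _; exact: integral_ge0.
  - have mabs : measurable_fun setT (fun z => `|(EFin \o K) z|)%E.
      exact: measurableT_comp.
    exact: (@measurable_fun_fubini_tonelli_F _ _ _ _ _ m2 _ mabs).
  - by apply/measurable_EFinP; exact: rint_meas (rintZ _ ra).
  - move=> x _ /=.
    rewrite mulrC -rintegralZ// -rintegralE; last exact: rintZ.
    apply: ge0_le_integral => //.
    + by apply/measurable_EFinP; apply: measurableT_comp.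
    + by apply/measurable_EFinP; exact: rint_meas (rintZ _ rb).
    + by move=> y _; rewrite lee_fin.
have := Fubini iK.
under eq_integral do rewrite /= rintegralE//.
under [X in _ = X -> _]eq_integral do rewrite /= rintegralE//.
by move=> E; rewrite /rintegral /Rintegral E.
Qed.

End RealFubini.

Section Duality.
Context {R : realType}.
Notation mu := (@lebesgue_measure R).
Implicit Types (f g : R -> R[i]) (x xi w : R).

Lemma cintegral_fubini (K : R * R -> R[i]) (a b : R -> R) :
  measurable_fun setT (fun p => complex.Re (K p)) ->
  measurable_fun setT (fun p => complex.Im (K p)) ->
  rint mu a -> rint mu b ->
  (forall x y, Normc.normc (K (x, y)) <= a x * b y) ->
  cintegral (fun x => cintegral (fun y => K (x, y))) =
  cintegral (fun y => cintegral (fun x => K (x, y))).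
Proof.
move=> mr mi ra rb Kab; apply: complexP.
  apply: (@rintegral_fubini _ _ _ _ R mu mu (fun p => complex.Re (K p)) a b) => // x y.
  exact: le_trans (le_Re_normc _) (Kab x y).
apply: (@rintegral_fubini _ _ _ _ R mu mu (fun p => complex.Im (K p)) a b) => // x y.
exact: le_trans (le_Im_normc _) (Kab x y).
Qed.

(** Fubini's theorem for the kernel [K], whose modulus is a product of integrable functions of the
    two variables. *)
Lemma fourier_duality f g : cint f -> cint g ->
  inner (fourier_integral f) g = inner f (inv_fourier g).
Proof.
move=> cf cg; rewrite !innerE.
have [mfr mfi] := cint_meas cf; have [mgr mgi] := cint_meas cg.
pose K (p : R * R) : R[i] := sqrt2piV%:C * (f p.1 * (g p.2)^*%C * expi (- (p.1 * p.2))).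
have -> : (fun x => f x * (inv_fourier g x)^*%C) =
    (fun x => cintegral (fun y => K (x, y))).
  apply/funext => x.
  rewrite /inv_fourier conjcM conjc_real -cintegralJ; last exact: cint_expi.
  rewrite mulrCA -cintegralZ; last by apply: cintJ; exact: cint_expi.
  rewrite -cintegralZ; last by apply: cintZ; apply: cintJ; exact: cint_expi.
  congr cintegral; apply/funext => y.
  by rewrite /K/= conjcM expiJ; ring.
have -> : (fun y => fourier_integral f y * (g y)^*%C) =
    (fun y => cintegral (fun x => K (x, y))).
  apply/funext => y; rewrite /fourier_integral.
  have ce : cint (fun t => f t * expi (- (t * y))).
    have := cint_expi (- y) cf; congr cint; apply/funext => t.
    by rewrite mulNr [y * t]mulrC.
  rewrite -mulrA [X in _ * X]mulrC -cintegralZ// -cintegralZ; last exact: cintZ.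
  congr cintegral; apply/funext => x.
  by rewrite /K/=; ring.
apply/esym.
have m1 (u : R -> R) : measurable_fun setT u -> measurable_fun setT (fun p : R * R => u p.1).
  by move=> mu_; exact: measurableT_comp.
have m2 (u : R -> R) : measurable_fun setT u -> measurable_fun setT (fun p : R * R => u p.2).
  by move=> mu_; exact: measurableT_comp.
have mp : measurable_fun setT (fun p : R * R => - (p.1 * p.2)).
  by apply: measurable_funN; apply: measurable_funM; [exact: measurable_fst|exact: measurable_snd].
have mc : measurable_fun setT (fun p : R * R => cos (- (p.1 * p.2))).
  apply: (measurableT_comp (f := @cos R)) => //.
  by apply: continuous_measurable_fun; exact: continuous_cos.
have ms : measurable_fun setT (fun p : R * R => sin (- (p.1 * p.2))).
  apply: (measurableT_comp (f := @sin R)) => //.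
  by apply: continuous_measurable_fun; exact: continuous_sin.
have mfr' := m1 _ mfr; have mfi' := m1 _ mfi.
have mgr' := m2 _ mgr; have mgi' := m2 _ mgi.
apply: (@cintegral_fubini K (fun x => sqrt2piV * Normc.normc (f x)) (fun y => Normc.normc (g y))).
- under eq_fun do rewrite /K ReZ 2!cReM !cImM cReJ cImJ Re_expi Im_expi.
  apply: measurable_funM => //.
  by apply: measurable_funB; apply: measurable_funM => //;
    [apply: measurable_funB|apply: measurable_funD]; apply: measurable_funM => //;
    apply: measurableT_comp.
- under eq_fun do rewrite /K ImZ 2!cImM !cReM cReJ cImJ Re_expi Im_expi.
  apply: measurable_funM => //.
  by apply: measurable_funD; apply: measurable_funM => //;
    [apply: measurable_funB|apply: measurable_funD]; apply: measurable_funM => //;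
    apply: measurableT_comp.
- exact: rintZ (cint_normc cf).
- exact: cint_normc.
- move=> x y; rewrite /K/= !normcE2 !sqcM sqc_expi mulr1 sqcJ sqcR.
  have k0 : 0 <= sqrt2piV :> R by rewrite invr_ge0 sqrtr_ge0.
  rewrite sqrtrM ?sqr_ge0// sqrtr_sqr ger0_norm// -mulrA ler_wpM2l//.
  by rewrite sqrtrM ?sqc_ge0.
Qed.

(** Polarisation of Plancherel's identity: the sum of two functions gives the real part, and
    replacing [g] by ['i%C * g] turns the imaginary part into a real one. *)
Lemma inv_fourier_isometry w f g : 0 < w -> supported w f -> supported w g ->
  sqint f -> sqint g -> inner (inv_fourier f) (inv_fourier g) = inner f g.
Proof.
move=> w0 sf sg lf lg.
have cf := cint_supported sf lf; have cg := cint_supported sg lg.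
have [lF nF] := plancherel_supported w0 sf lf.
have [lG nG] := plancherel_supported w0 sg lg.
have ReE (h : R -> R[i]) : supported w h -> sqint h ->
    complex.Re (inner (inv_fourier f) (inv_fourier h)) = complex.Re (inner f h).
  move=> sh lh; have ch := cint_supported sh lh.
  have [lH nH] := plancherel_supported w0 sh lh.
  have sfh : supported w (fun x => f x + h x) by move=> x xw; rewrite sf// sh// addr0.
  have [_] := plancherel_supported w0 sfh (sqintD lf lh).
  have -> : inv_fourier (fun x => f x + h x) = (fun x => inv_fourier f x + inv_fourier h x).
    by apply/funext => x; exact: inv_fourierD.
  rewrite !nrm2DE// nF nH => /addrI.
  by move/(mulfI _); apply; rewrite pnatr_eq0.
apply: complexP; first exact: ReE.
have sig : supported w (fun x => 'i%C * g x) by move=> x xw; rewrite sg// mulr0.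
have := ReE _ sig (sqintZ _ lg).
have -> : inv_fourier (fun x => 'i%C * g x) = (fun x => 'i%C * inv_fourier g x).
  by apply/funext => x; exact: inv_fourierZ.
rewrite (innerZr _ lG lF) (innerZr _ lg lf) !cReM cReJ cImJ Rei Imi !mul0r !add0r !mulN1r !opprK.
by [].
Qed.

End Duality.

Lemma fourier_integralE (R : realType) (f : R -> R[i]) xi :
  fourier_integral f xi = sqrt2piV%:C * cintegral (fun t => f t * expi (- (t * xi))).
Proof. by []. Qed.

Lemma inv_fourierE (R : realType) (g : R -> R[i]) x :
  inv_fourier g x = sqrt2piV%:C * cintegral (fun xi => g xi * expi (x * xi)).
Proof. by []. Qed.

Opaque inv_fourier fourier_integral.

Section Truncation.
Context {R : realType}.
Notation mu := (@lebesgue_measure R).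
Implicit Types (f g u : R -> R[i]) (w : R).

(** The bound is [n.+1] so that it is positive already at [n = 0], as [plancherel_supported]
    requires. *)
Definition trunc (n : nat) f : R -> R[i] :=
  fun x => cindic (`[- n.+1%:R, n.+1%:R]%classic) x * f x.

Lemma supported_trunc n f : supported n.+1%:R (trunc n f).
Proof. by move=> x xn; rewrite /trunc /cindic indicE memNset// mul0r. Qed.

Lemma sqint_trunc n f : sqint f -> sqint (trunc n f).
Proof. by move=> lf; apply: sqint_indic. Qed.

Lemma trunc_near f x : \forall n \near \oo, trunc n f x = f x.
Proof.
near=> n; rewrite /trunc /cindic indicE mem_set ?mul1r//= in_itv/= -ler_norml.
have : `|x| <= n%:R by near: n; exact: nbhs_infty_ger.
by move=> /le_trans; apply; rewrite ler_nat.
Unshelve. all: end_near. Qed.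

Lemma cvg_trunc f : sqint f ->
  (fun n => nrm2 (fun x => trunc n f x - f x)) @ \oo --> 0.
Proof.
move=> lf; apply: (@nrm2_dct _ _ _ f) => //.
- by move=> n; exact: sqint_trunc.
- by case: lf.
- move=> x; apply: cvg_near_cst; near=> n.
  have -> : trunc n f x = f x by near: n; exact: trunc_near.
  by rewrite subrr sqc0.
- move=> n x; rewrite /trunc /cindic indicE.
  by case: (_ \in _); rewrite ?mul1r ?subrr ?sqc0 ?sqc_ge0// mul0r sub0r sqcN.
Unshelve. all: end_near. Qed.

End Truncation.

(** * Comparing the direct and the inverse transform in squared norm *)

Section FourierL2.
Context {R : realType}.
Notation mu := (@lebesgue_measure R).
Implicit Types (f g u : R -> R[i]) (w : R).

Lemma fourier_integralB f g xi : cint f -> cint g ->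
  fourier_integral (fun x => f x - g x) xi = fourier_integral f xi - fourier_integral g xi.
Proof.
move=> cf cg; rewrite !fourier_inv_conj//; last exact: cintB.
have -> : (fun t => ((f t - g t)^*)%C) = (fun t => ((f t)^*)%C + (-1) * ((g t)^*)%C).
  by apply/funext => t; rewrite conjcB mulN1r.
rewrite inv_fourierD ?inv_fourierZ ?conjcD; [|exact: cintJ|exact: cintJ|apply: cintZ; exact: cintJ].
by rewrite mulN1r -conjcD conjcB.
Qed.

Lemma cmeas_fourier f : cint f -> cmeasurable (fourier_integral f).
Proof.
move=> cf.
have -> : fourier_integral f = fun xi => ((inv_fourier (fun t => (f t)^*%C) xi)^*)%C.
  by apply/funext => xi; exact: fourier_inv_conj.
by apply/cmeasJ/continuous_cmeas/continuous_inv_fourier/cintJ.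
Qed.

Lemma plancherel_fourier w f : 0 < w -> supported w f -> sqint f ->
  sqint (fourier_integral f) /\ nrm2 (fourier_integral f) = nrm2 f.
Proof.
move=> w0 sf lf; have cf := cint_supported sf lf.
have sfJ : supported w (fun x => (f x)^*%C) by move=> x xw; rewrite sf// conjc0.
have [lF nF] := plancherel_supported w0 sfJ (sqintJ lf).
have -> : fourier_integral f = fun xi => ((inv_fourier (fun t => (f t)^*%C) xi)^*)%C.
  by apply/funext => xi; exact: fourier_inv_conj.
by split; [exact: sqintJ|rewrite nrm2J nF nrm2J].
Qed.

(** Both squares expand into the same norms by Plancherel's identity, and into the same cross term
    by duality. *)
Lemma nrm2_fourier_sub w f g : 0 < w -> supported w f -> sqint f ->
  forall v, 0 < v -> supported v g -> sqint g ->
  nrm2 (fun x => fourier_integral f x - g x) = nrm2 (fun x => f x - inv_fourier g x).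
Proof.
move=> w0 sf lf v v0 sg lg.
have [lF nF] := plancherel_fourier w0 sf lf.
have [lG nG] := plancherel_supported v0 sg lg.
rewrite !nrm2BE// nF nG fourier_duality//.
  exact: cint_supported sf lf.
exact: cint_supported sg lg.
Qed.

(** A crude bound that makes truncations of the transform square integrable; the factor 2 comes from
    estimating the real and imaginary parts separately. *)
Lemma fourier_integral_bound f xi : cint f ->
  sqc (fourier_integral f xi) <=
  sqrt2piV ^+ 2 * (2 * rintegral mu (fun x => Normc.normc (f x)) ^+ 2).
Proof.
move=> cf; rewrite fourier_integralE sqcM sqcR ler_wpM2l ?sqr_ge0//.
set e := fun t => f t * expi (- (t * xi)).
have nE t : Normc.normc (e t) = Normc.normc (f t).
  by rewrite !normcE2 sqcM sqc_expi mulr1.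
have ce : cint e.
  have := cint_expi (- xi) cf; congr cint; apply/funext => t.
  by rewrite mulNr [xi * t]mulrC.
have rn := cint_normc cf; have [re ie] := ce.
have part (h : R -> R) : rint mu h -> (forall t, `|h t| <= Normc.normc (e t)) ->
    rintegral mu h ^+ 2 <= rintegral mu (fun x => Normc.normc (f x)) ^+ 2.
  move=> rh hn; have N0 : 0 <= rintegral mu (fun x => Normc.normc (f x)).
    by apply: rintegral_ge0 => t; exact: normc_ge0.
  rewrite -[leLHS](real_normK (num_real _)) lerXn2r ?nnegrE// ler_norml; apply/andP; split.
    rewrite -rintegralN//; apply: le_rintegral => //; first exact: rintN.
    by move=> t; have := hn t; rewrite nE ler_norml => /andP[].
  apply: le_rintegral => //.
  by move=> t; have := hn t; rewrite nE ler_norml => /andP[].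
rewrite /sqc Re_cintegral Im_cintegral mulr2n mulrDl mul1r; apply: lerD.
  by apply: part => // t; exact: le_Re_normc.
by apply: part => // t; exact: le_Im_normc.
Qed.

(* Testing [fourier_integral f] against its own truncations, duality gives
   Bessel's inequality without any approximation of [f]. *)
Lemma fourier_le f : cint f -> sqint f ->
  sqint (fourier_integral f) /\ nrm2 (fourier_integral f) <= nrm2 f.
Proof.
move=> cf lf; set u := fourier_integral f.
have mu_ : cmeasurable u by exact: cmeas_fourier.
have lk n : sqint (trunc n u).
  have := @sqintMl _ u (cindic (`[- n.+1%:R, n.+1%:R]%classic : set R)) _ mu_
    (fun xi => fourier_integral_bound xi cf).
  rewrite /trunc; under [X in _ -> sqint X]eq_fun do rewrite mulrC.
  apply; apply: sqint_cindic => //.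
  by rewrite lebesgue_measure_itv/=; case: ifP => _; rewrite -?EFinB ltry.
have nk n : nrm2 (trunc n u) <= nrm2 f.
  have n0 : 0 < n.+1%:R :> R by [].
  have [lG nG] := plancherel_supported n0 (@supported_trunc _ n u) (lk n).
  have E : inner u (trunc n u) = inner f (inv_fourier (trunc n u)).
    by apply: fourier_duality => //; apply: cint_supported (lk n); exact: supported_trunc.
  have E' : inner u (trunc n u) = (nrm2 (trunc n u))%:C.
    rewrite -inner_nrm2 !innerE; congr cintegral; apply/funext => x.
    by rewrite /trunc conjcM /cindic conjc_real -/(cindic _ x) -[in LHS]cindic_sq; ring.
  (* With [k] the truncated transform, duality makes [2 * nrm2 k] twice the real part of the inner
     product of [f] with [inv_fourier k], hence at most [nrm2 f + nrm2 k]. *)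
  have := Re_inner_le lf lG; rewrite -E E' cReR nG.
  by move: (nrm2 _) (nrm2 _) => p q; lra.
(* Monotone convergence removes the truncation and proves square integrability at the same time. *)
have I : (\int[mu]_x (sqc (u x))%:E <= (nrm2 f)%:E)%E.
  have cM : (fun n => \int[mu]_x (sqc (trunc n u x))%:E)%E @ \oo --> (\int[mu]_x (sqc (u x))%:E)%E.
    rewrite [X in _ --> X](_ : _ = (\int[mu]_x limn (fun n => (sqc (trunc n u x))%:E))%E); last first.
      apply: eq_integral => x _; apply/esym/cvg_lim => //; apply: cvg_near_cst.
      by near=> n; congr (sqc _)%:E; near: n; exact: trunc_near.
    apply: cvg_monotone_convergence => //.
    - by move=> n; apply/measurable_EFinP; apply: cmeas_sqc; case: (lk n).
    - by move=> n x _; rewrite lee_fin sqc_ge0.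
    - move=> x _ m n mn; rewrite lee_fin /trunc ![sqc (cindic _ _ * _)]sqcM !sqc_cindic.
      rewrite ler_wpM2r ?sqc_ge0// !indicE.
      have [xm|//] := boolP (x \in `[- m.+1%:R, m.+1%:R]%classic).
      rewrite mem_set//; move: xm; rewrite inE/= !in_itv/= -!ler_norml => /le_trans; apply.
      by rewrite ler_nat.
  apply: (@cvge_to_le _ _ _ _ _ _ _ cM); apply: nearW => n.
  by rewrite rintegralE ?lee_fin; [exact: nk|case: (lk n)].
have lu : sqint u.
  split => //; apply/rint_ge0P; [exact: cmeas_sqc|by move=> x; exact: sqc_ge0|].
  by apply: le_lt_trans I _; rewrite ltry.
split => //; rewrite -lee_fin; apply: le_trans I.
by rewrite rintegralE//; case: lu.
Unshelve. all: end_near. Qed.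

Lemma trunc_approx f : cint f -> sqint f -> forall d, 0 < d ->
  exists n, nrm2 (fun x => trunc n f x - f x) < d.
Proof.
move=> cf lf d d0.
have /cvgrPdist_lt /(_ _ d0)[n _ /(_ n (leqnn n))] := cvg_trunc lf.
by rewrite sub0r normrN ger0_norm ?nrm2_ge0// => h; exists n.
Qed.

Lemma le_eps_mul (x y c : R) : (forall d, 0 < d -> x <= y + c * d) -> 0 <= c -> x <= y.
Proof.
move=> h c0; apply/ler_addgt0Pr => e e0.
have c1 : 0 < c + 1 by rewrite ltr_wpDl.
have := h (e / (c + 1)) (divr_gt0 e0 c1) => /le_trans; apply.
by rewrite lerD2l mulrCA ler_piMr ?(ltW e0)// ler_pdivrMr// mul1r lerDl.
Qed.

(** For a truncation of [f] the two distances are equal, and truncating costs arbitrarily little on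
    both sides by [fourier_le]. The factor 4 is the price of two triangle inequalities for squared
    norms; it is harmless for limits that vanish. *)
Lemma fourier_sub_equiv v f g : cint f -> sqint f -> 0 < v -> supported v g -> sqint g ->
  nrm2 (fun x => fourier_integral f x - g x) <= 4 * nrm2 (fun x => f x - inv_fourier g x) /\
  nrm2 (fun x => f x - inv_fourier g x) <= 4 * nrm2 (fun x => fourier_integral f x - g x).
Proof.
move=> cf lf v0 sg lg.
have [lG _] := plancherel_supported v0 sg lg.
have [lF _] := fourier_le cf lf.
have both d : 0 < d -> exists h, [/\ cint h, sqint h, sqint (fourier_integral h),
    nrm2 (fun x => fourier_integral h x - g x) = nrm2 (fun x => h x - inv_fourier g x) &
    nrm2 (fun x => h x - f x) <= d /\
    nrm2 (fun x => fourier_integral h x - fourier_integral f x) <= d].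
  move=> d0; have [n nd] := trunc_approx cf lf d0; exists (trunc n f).
  have n0 : 0 < n.+1%:R :> R by [].
  have ln := sqint_trunc n lf.
  have cn := cint_supported (@supported_trunc _ n f) ln.
  have [lFn _] := fourier_le cn ln.
  split => //; first exact: (nrm2_fourier_sub n0 (@supported_trunc _ n f) ln v0 sg lg).
  split; first exact: ltW.
  have [_ h] := fourier_le (cintB cn cf) (sqintB ln lf).
  apply: le_trans (ltW nd); apply: le_trans h.
  rewrite le_eqVlt; apply/orP; left; apply/eqP; congr nrm2; apply/funext => x.
  by rewrite fourier_integralB.
(* Two triangle inequalities give [2 * (2 * p + 2 * d) + 2 * d], where [p] is the distance on the
   right: hence 4 and 6. *)
split; apply: (@le_eps_mul _ _ 6) => // d d0.
  have [h [ch lh lFh E [h1 h2]]] := both d d0.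
  have -> : (fun x => fourier_integral f x - g x) =
    (fun x => (fourier_integral h x - g x) - (fourier_integral h x - fourier_integral f x)).
    by apply/funext => x; ring.
  apply: le_trans (nrm2B_le (sqintB lFh lg) (sqintB lFh lF)) _; rewrite E.
  have -> : (fun x => h x - inv_fourier g x) =
    (fun x => (f x - inv_fourier g x) + (h x - f x)).
    by apply/funext => x; ring.
  have := nrm2D_le (sqintB lf lG) (sqintB lh lf).
  by move: (nrm2 _) (nrm2 _) (nrm2 _) h1 (nrm2 _) h2 => a b c h1 e h2; lra.
have [h [ch lh lFh E [h1 h2]]] := both d d0.
have -> : (fun x => f x - inv_fourier g x) =
  (fun x => (h x - inv_fourier g x) - (h x - f x)).
  by apply/funext => x; ring.
apply: le_trans (nrm2B_le (sqintB lh lG) (sqintB lh lf)) _; rewrite -E.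
have -> : (fun x => fourier_integral h x - g x) =
  (fun x => (fourier_integral f x - g x) + (fourier_integral h x - fourier_integral f x)).
  by apply/funext => x; ring.
have := nrm2D_le (sqintB lF lg) (sqintB lFh lF).
by move: (nrm2 _) (nrm2 _) (nrm2 _) h1 (nrm2 _) h2 => a b c h1 e h2; lra.
Qed.

End FourierL2.

Opaque rint.

(** * Band-limited functions *)

Section L2Limits.
Context {R : realType}.
Notation mu := (@lebesgue_measure R).
Implicit Types (f g : R -> R[i]).

Lemma cvg0_double_sum (T : Type) (F : set_system T) {FF : Filter F} (u v : T -> R) :
  u @ F --> 0 -> v @ F --> 0 -> (fun t => 2 * (u t + v t)) @ F --> 0.
Proof.
move=> u0 v0; rewrite -[0](mulr0 2) -[0 in X in _ --> X](addr0 0).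
exact: cvgM (cvg_cst _) (cvgD u0 v0).
Qed.

Lemma ae_eq_limit (T : Type) (F : set_system T) {FF : ProperFilter F}
    (u : T -> R -> R[i]) f g :
  (forall t, sqint (u t)) -> sqint f -> sqint g ->
  (fun t => nrm2 (fun x => u t x - f x)) @ F --> 0 ->
  (fun t => nrm2 (fun x => u t x - g x)) @ F --> 0 ->
  {ae mu, forall x, f x = g x}.
Proof.
move=> lu lf lg uf ug.
have l0 : nrm2 (fun x => f x - g x) = 0.
  apply: le_anti; rewrite nrm2_ge0 andbT.
  apply: (cvgr_to_ge (cvg0_double_sum uf ug)); apply: nearW => t /=.
  have E : nrm2 (fun x => f x - g x) = nrm2 (fun x => (u t x - g x) - (u t x - f x)).
    by congr nrm2; apply/funext => x; ring.
  rewrite E; apply: le_trans (nrm2B_le (sqintB (lu t) lg) (sqintB (lu t) lf)) _.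
  by rewrite -mulrDr addrC.
by apply: ae_imp (nrm2_eq0 (sqintB lf lg) l0) => x /eqP; rewrite subr_eq0 => /eqP.
Qed.

Lemma squeeze0 (T : Type) (F : set_system T) {FF : Filter F} (u v : T -> R) (c : R) :
  (forall t, 0 <= u t <= c * v t) -> v @ F --> 0 -> u @ F --> 0.
Proof.
move=> uv v0; have lim : (fun t => c * v t) @ F --> 0.
  by rewrite -[0](mulr0 c); apply: cvgM (cvg_cst _) v0.
by apply: (squeeze_cvgr _ (cvg_cst (0 : R)) lim); exact: nearW.
Qed.

(** Along the approximating sequence, [fourier_sub_equiv] makes the transforms converge to [g]
    exactly when the functions converge to [inv_fourier g]; uniqueness of limits in L^2 does the
    rest. *)
Lemma is_fourier_inv v f fh g : 0 < v -> supported v g -> sqint g ->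
  is_fourier f fh ->
  ({ae mu, forall x, fh x = g x} <-> {ae mu, forall x, f x = inv_fourier g x}).
Proof.
move=> v0 sg lg [/cLspace2P lf /cLspace2P lh [f_ [lf_ cf ch]]].
have cint_f n : cint (f_ n) by case: (lf_ n) => /cLspace1P.
have sqint_f n : sqint (f_ n) by case: (lf_ n) => _ /cLspace2P.
have sqint_Ff n : sqint (fourier_integral (f_ n)) := (fourier_le (cint_f n) (sqint_f n)).1.
have [lG _] := plancherel_supported v0 sg lg.
have {}cf := (cvg_cLnorm eventually_filter (fun n => sqintB (sqint_f n) lf)).1 cf.
have {}ch := (cvg_cLnorm eventually_filter (fun n => sqintB (sqint_Ff n) lh)).1 ch.
have eqv n := fourier_sub_equiv (cint_f n) (sqint_f n) v0 sg lg.
split=> E.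
- apply: (ae_eq_limit sqint_f lf lG cf).
  apply: (squeeze0 (c := 4) _ ch) => n; rewrite nrm2_ge0/=.
  apply: le_trans (eqv n).2 _; rewrite (nrm2_ae (g := fun xi => fourier_integral (f_ n) xi - g xi))//.
  + by case: (sqintB (sqint_Ff n) lh).
  + by case: (sqintB (sqint_Ff n) lg).
  + by apply: ae_imp E => x ->.
- apply: (ae_eq_limit sqint_Ff lh lg ch).
  apply: (squeeze0 (c := 4) _ cf) => n; rewrite nrm2_ge0/=.
  apply: le_trans (eqv n).1 _; rewrite (nrm2_ae (g := fun xi => f_ n xi - inv_fourier g xi))//.
  + by case: (sqintB (sqint_f n) lf).
  + by case: (sqintB (sqint_f n) lG).
  + by apply: ae_imp E => x ->.
Qed.

(** Truncations of [inv_fourier g] lie in L^1 and L^2, and by [fourier_sub_equiv] their transforms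
    approach [g]. *)
Lemma fourier_inv_fourier v g : 0 < v -> supported v g -> sqint g ->
  is_fourier (inv_fourier g) g.
Proof.
move=> v0 sg lg; have [lG _] := plancherel_supported v0 sg lg.
split; [exact/cLspace2P..|].
pose f_ n := trunc n (inv_fourier g).
have lf n : sqint (f_ n) := sqint_trunc n lG.
have cf n : cint (f_ n) := cint_supported (@supported_trunc _ n (inv_fourier g)) (lf n).
have lF n := (fourier_le (cf n) (lf n)).1.
exists f_; split.
- by move=> n; split; [exact/cLspace1P|exact/cLspace2P].
- exact/(cvg_cLnorm eventually_filter (fun n => sqintB (lf n) lG))/cvg_trunc.
- apply/(cvg_cLnorm eventually_filter (fun n => sqintB (lF n) lg)).
  apply: (squeeze0 (c := 4) _ (cvg_trunc lG)) => n; rewrite nrm2_ge0/=.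
  exact: (fourier_sub_equiv (cf n) (lf n) v0 sg lg).1.
Qed.

(** Off the essential support each point has a neighbourhood where [f] vanishes almost everywhere.
    Shrinking these to rational intervals leaves countably many null sets. *)
Lemma ess_supp_ae f (K : set R) : ess_supp f `<=` K ->
  {ae mu, forall x, ~ K x -> f x = 0}.
Proof.
move=> fK.
pose good (p : rat * rat) := {ae mu, forall y, `]ratr p.1, ratr p.2[%classic y -> f y = 0}.
(* The exceptional set of the rational interval coded by [k]; it is empty when [k] codes no pair or
   when [f] does not vanish almost everywhere on that interval. *)
pose N (k : nat) : set R := if @choice.unpickle (rat * rat)%type k is Some p then
  [set y | good p /\ ~ (`]ratr p.1, ratr p.2[%classic y -> f y = 0)] else set0.
have negN k : mu.-negligible (N k).
  rewrite /N; case: (choice.unpickle k) => [p|]; last exact: negligible_set0.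
  have [g|ng] := pselect (good p).
    by apply: negligibleS g => y [].
  by apply: (negligibleS _ (negligible_set0 mu)) => y [].
apply: negligibleS (negligible_bigcup negN) => x /= /not_implyP[nK fx0].
have : ~ ess_supp f x by move/fK.
move=> /existsNP[U /not_implyP[/nbhs_ballP[e /= e0 eU] /contrapT fU]].
have [p] := @rat_in_itvoo _ (x - e) x ltac:(by rewrite ltrBlDr ltrDl).
rewrite in_itv/= => /andP[ep px].
have [q] := @rat_in_itvoo _ x (x + e) ltac:(by rewrite ltrDl).
rewrite in_itv/= => /andP[xq qe].
exists (choice.pickle (p, q)); first exact: I.
rewrite /N choice.pickleK; split.
  apply: ae_imp fU => y h /=; rewrite in_itv/= => /andP[py yq]; apply/h/eU.
  by rewrite /ball/= ltr_distlC; apply/andP; split; lra.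
by move=> h; apply/fx0/h; rewrite /= in_itv/= px xq.
Qed.

End L2Limits.

Section Bandlimited.
Context {R : realType}.
Notation mu := (@lebesgue_measure R).
Implicit Types (f g : R -> R[i]) (w : R).

Lemma continuous_supported w g : supported w g -> sqint g ->
  continuous (inv_fourier g : R -> R[i]^o).
Proof. by move=> sg lg; exact/continuous_inv_fourier/(cint_supported sg lg). Qed.

Lemma bandlimited_inv_fourier w g : 0 < w -> supported w g -> sqint g ->
  bandlimited w (inv_fourier g).
Proof.
move=> w0 sg lg; split.
- exact: (continuous_supported sg lg).
- exact/cLspace2P/(plancherel_supported w0 sg lg).1.
- exists g; first exact: (fourier_inv_fourier w0 sg lg).
  move=> x /= xS; apply: contrapT => xw.
  apply: (xS (~` `[- w, w]%classic)); last exact: aeW.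
  apply: open_nbhs_nbhs; split=> //.
  by apply: closed_openC; exact: itv_closed.
Qed.

Lemma fourier_repr w f fh g : 0 < w -> continuous (f : R -> R[i]^o) ->
  is_fourier f fh -> supported w g -> sqint g ->
  {ae mu, forall x, fh x = g x} -> f = inv_fourier g.
Proof.
move=> w0 cf Ff sg lg E; apply: (continuous_ae_eq cf (continuous_supported sg lg)).
exact: (is_fourier_inv w0 sg lg Ff).1 E.
Qed.

(** Cutting the transform off outside the band changes it on a null set only, and continuity of [f]
    turns almost everywhere equality into equality. *)
Lemma bandlimited_repr w f : 0 < w -> bandlimited w f ->
  exists g, [/\ supported w g, sqint g & f = inv_fourier g].
Proof.
move=> w0 [cf lf [fh Ff /ess_supp_ae fw]].
have [_ /cLspace2P lh _] := Ff.
exists (fun x => cindic (`[- w, w]%classic) x * fh x).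
have sg : supported w (fun x => cindic (`[- w, w]%classic) x * fh x).
  by move=> x xn; rewrite /cindic indicE memNset// mul0r.
have lg : sqint (fun x => cindic (`[- w, w]%classic) x * fh x) by exact: sqint_indic.
split=> //; apply: (fourier_repr w0 cf Ff sg lg).
apply: ae_imp fw => x h; rewrite /cindic indicE.
by case: (boolP (_ \in _)) => [_|]; rewrite ?mul1r// notin_setE => /h ->; rewrite mulr0.
Qed.

(** The Fourier multiplier of the Hilbert transform. *)
Definition hsym g : R -> R[i] := fun xi => - 'i%C * ((Num.sg xi)%:C * g xi).

Lemma sqc_sg (x : R) : sqc (Num.sg x)%:C <= 1.
Proof. by rewrite sqcR; case: (sgrP x) => _; rewrite ?expr0n ?expr1n// sqrrN expr1n. Qed.

Lemma measurable_sg : measurable_fun setT (Num.sg : R -> R).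
Proof.
have -> : Num.sg = (fun x : R => \1_(`]0, +oo[%classic) x - \1_(`]-oo, 0[%classic) x) :> (R -> R).
  apply/funext => x; rewrite !indicE !mem_setE !in_itv/= andbT.
  case: (ltgtP x 0) => [x0|x0|->]; rewrite ?subr0 ?sub0r ?sgr0 ?subrr//.
    by rewrite ltr0_sg.
  by rewrite gtr0_sg.
by apply: measurable_funB; exact: measurable_indic.
Qed.

Lemma sqint_sg g : sqint g -> sqint (fun xi => (Num.sg xi)%:C * g xi).
Proof.
move=> lg; apply: (sqintMl (a := 1)) => //; last by move=> x; exact: sqc_sg.
by apply: cmeasR; exact: measurable_sg.
Qed.

Lemma sqint_hsym g : sqint g -> sqint (hsym g).
Proof. by move=> lg; apply: sqintZ; exact: sqint_sg. Qed.

Lemma supported_hsym w g : supported w g -> supported w (hsym g).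
Proof. by move=> sg x /sg; rewrite /hsym => ->; rewrite !mulr0. Qed.

(** The choice in [hilbert] is forced: [is_fourier_inv] determines a candidate almost everywhere,
    and continuity determines it everywhere. *)
Lemma hilbert_inv_fourier w g : 0 < w -> supported w g -> sqint g ->
  hilbert (inv_fourier g) = inv_fourier (hsym g).
Proof.
move=> w0 sg lg.
have ss : supported w (fun xi => (Num.sg xi)%:C * g xi).
  by move=> x /sg ->; rewrite mulr0.
have ls := sqint_sg lg.
have hE x : inv_fourier (hsym g) x = - 'i%C * inv_fourier (fun xi => (Num.sg xi)%:C * g xi) x.
  exact/inv_fourierZ/(cint_supported ss ls).
have ch := continuous_supported (supported_hsym sg) (sqint_hsym lg).
rewrite /hilbert; case: xgetP => [u _ [cu [fh [v [Ff Fv uE]]]]|/(_ (inv_fourier (hsym g)))[]].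
  apply: (continuous_ae_eq cu ch).
  have fg := (is_fourier_inv w0 sg lg Ff).2 (aeW _ (fun=> erefl)).
  have := (is_fourier_inv w0 ss ls Fv).1 (ae_imp (fun x E => congr1 _ E) fg).
  by apply: ae_imp => x vE; rewrite uE hE vE.
split => //; exists g, (inv_fourier (fun xi => (Num.sg xi)%:C * g xi)); split => //.
- exact: (fourier_inv_fourier w0 sg lg).
- exact: (fourier_inv_fourier w0 ss ls).
Qed.

End Bandlimited.

(** * Tight frames *)

Section TightSystem.
Context {R : realType} {I : choiceType}.
Variables (V : set (R -> R[i])) (s : I -> R -> R[i]) (A : R).
Hypothesis A0 : 0 < A.
Hypothesis sqintV : forall f, V f -> sqint f.
Hypothesis sqint_s : forall i, sqint (s i).
Hypothesis span_sub : forall (J : seq I) (c : I -> R[i]),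
  V (fun x => \sum_(i <- J) c i * s i x).
Hypothesis tight : forall f, V f ->
  (\esum_(i in [set: I]) (sqc (inner f (s i)))%:E = (A * nrm2 f)%:E)%E.
Implicit Types (f : R -> R[i]) (c : I -> R[i]) (J : seq I).

Lemma inner_span f J c : sqint f ->
  inner f (fun x => \sum_(i <- J) c i * s i x) =
  \sum_(i <- J) (c i)^*%C * inner f (s i).
Proof.
move=> lf; rewrite inner_sumr//; last by move=> i; exact: sqintZ.
by apply: eq_bigr => i _; rewrite innerZr.
Qed.

(** Young's inequality, from the square of [A * z - u]. The weight is chosen so that the second term
    can be absorbed by a frame bound [A]. *)
Lemma Re_conj_mul_le (z u : R[i]) :
  2 * complex.Re (z^*%C * u) <= A * sqc z + A^-1 * sqc u.
Proof.
rewrite -subr_ge0 (_ : _ - _ = A^-1 * sqc (A%:C * z - u)); last first.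
  by rewrite /sqc !reimE; move: A A0 => a a0; field; rewrite gt_eqF.
by rewrite mulr_ge0 ?sqc_ge0// invr_ge0 (ltW A0).
Qed.

(** With [P] the combination, [nrm2 P] is the real part of the sum of the conjugates of [c i] times
    the coefficients of [P]. The weighted Young inequality bounds its double, and tightness applied
    to [P] absorbs one copy. *)
Lemma synthesis_le J c : uniq J ->
  nrm2 (fun x => \sum_(i <- J) c i * s i x) <= A * \sum_(i <- J) sqc (c i).
Proof.
move=> uJ; set P := fun x => _.
have VP : V P := span_sub J c.
have lP := sqintV VP.
have [ub _] := (esum_realP _ (fun i => sqc_ge0 (inner P (s i)))).1 (tight VP).
have E : nrm2 P = complex.Re (\sum_(i <- J) (c i)^*%C * inner P (s i)).
  by rewrite -inner_span// inner_nrm2.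
have : 2 * nrm2 P <= \sum_(i <- J) (A * sqc (c i) + A^-1 * sqc (inner P (s i))).
  by rewrite E Re_sum mulr_sumr; apply: ler_sum => i _; exact: Re_conj_mul_le.
rewrite big_split/= -!mulr_sumr => h.
have : A^-1 * \sum_(i <- J) sqc (inner P (s i)) <= nrm2 P.
  by rewrite ler_pdivrMl// ub.
move: h; move: (nrm2 P) (\sum_(i <- J) sqc (c i)) (\sum_(i <- J) _) (A^-1) => p q r a; lra.
Qed.

(** With [r] the partial sum of squares, the cross term in the expansion is [- 2 * A * r], and
    [synthesis_le] bounds the last square by [A * r]. *)
Lemma tight_resid_le f J : V f -> uniq J ->
  nrm2 (fun x => A%:C * f x - \sum_(i <- J) inner f (s i) * s i x) <=
  A * (A * nrm2 f - \sum_(i <- J) sqc (inner f (s i))).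
Proof.
move=> Vf uJ; have lf := sqintV Vf.
have lP := sqintV (span_sub J (fun i => inner f (s i))).
rewrite nrm2BE//; last exact: sqintZ.
rewrite innerZl// inner_span// nrm2Z// sqcR ReZ Re_sum.
have -> : \sum_(i <- J) complex.Re ((inner f (s i))^*%C * inner f (s i)) =
    \sum_(i <- J) sqc (inner f (s i)).
  by apply: eq_bigr => i _; rewrite mulrC mulcJ.
have := synthesis_le (fun i => inner f (s i)) uJ.
move: (nrm2 _) (nrm2 _) (\sum_(i <- J) _) => p q r; nra.
Qed.

(** The map [E] lets finite sets of one index type run through finite families of another: the
    identity for the frame operator, the grouping of both channels at a sampling point for the
    sampling formula. *)
Lemma tight_expansion (K : choiceType) (E : {fset K} -> seq I) f : V f ->
  (forall L, uniq (E L)) ->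
  (forall J, exists L0 : {fset K}, forall L, (L0 `<=` L)%fset -> {subset J <= E L}) ->
  (fun L => nrm2 (fun x => A%:C * f x - \sum_(i <- E L) inner f (s i) * s i x))
    @ totally --> 0.
Proof.
move=> Vf uE exE.
have [_ ap] := (esum_realP _ (fun i => sqc_ge0 (inner f (s i)))).1 (tight Vf).
have FF : ProperFilter (@totally K) := totally_filter.
apply/cvgrPdist_lt => e e0.
have [J uJ h] := ap _ (divr_gt0 e0 A0).
have [L0 hL0] := exE J.
exists L0 => // L /= L0L; rewrite sub0r normrN ger0_norm ?nrm2_ge0//.
apply: le_lt_trans (tight_resid_le Vf (uE L)) _.
have JL := ler_sum_uniq (fun i => sqc_ge0 (inner f (s i))) uJ (uE L) (hL0 L L0L).
rewrite -ltr_pdivlMl// [ltRHS]mulrC; apply: le_lt_trans (lerB (lexx _) JL) _.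
by rewrite ltrBlDr -ltrBlDl.
Qed.

(* The term of index [i] already exhausts the sum of [sqc (inner (s i) (s j))]
   over all [j]. *)
Lemma tight_orthogonal : (forall i, nrm2 (s i) = A) ->
  forall i j, inner (s i) (s j) = if i == j then A%:C else 0.
Proof.
move=> nA i j; case: eqVneq => [<-|ij]; first by rewrite inner_nrm2 nA.
have Vi : V (s i).
  have := span_sub [:: i] (fun=> 1).
  by under eq_fun do rewrite big_seq1 mul1r.
have [ub _] := (esum_realP _ (fun k => sqc_ge0 (inner (s i) (s k)))).1 (tight Vi).
have := ub [:: i; j] _; rewrite /= inE ij => /(_ erefl).
rewrite big_cons big_seq1 inner_nrm2 nA sqcR -expr2 -lerBrDl subrr => le0.
by apply/eqP; rewrite -sqc_eq0 eq_le le0 sqc_ge0.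
Qed.

End TightSystem.

Section L2Sum.
Context {R : realType} {K : choiceType}.
Notation mu := (@lebesgue_measure R).
Implicit Types (u : K -> R -> R[i]) (F G : R -> R[i]).

Lemma L2_sumP u F : (forall k, sqint (u k)) ->
  L2_sum u F <->
  sqint F /\ (fun J : {fset K} => nrm2 (fun x => F x - \sum_(i <- J) u i x)) @ totally --> 0.
Proof.
move=> lu; have FF : ProperFilter (@totally K) := totally_filter.
have eqv : sqint F ->
    ((fun J : {fset K} => cLnorm 2%:E (fun x => F x - \sum_(i <- J) u i x)) @ totally --> 0%E)
    <-> ((fun J : {fset K} => nrm2 (fun x => F x - \sum_(i <- J) u i x)) @ totally --> 0).
  by move=> lF; apply: cvg_cLnorm => J; apply: sqintB => //; exact: sqint_sum.
by split=> [[/cLspace2P lF /(eqv lF)]|[lF /(eqv lF)]]; split => //; exact/cLspace2P.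
Qed.

Lemma L2_sum_unique u F G : (forall k, sqint (u k)) ->
  L2_sum u F -> L2_sum u G -> {ae mu, forall x, F x = G x}.
Proof.
move=> lu /(L2_sumP _ lu)[lF cF] /(L2_sumP _ lu)[lG cG].
have FF : ProperFilter (@totally K) := totally_filter.
apply: (@ae_eq_limit _ _ (@totally K) _ (fun J x => \sum_(i <- J) u i x)) => //.
- by move=> J; exact: sqint_sum.
- by under eq_fun do rewrite nrm2BC.
- by under eq_fun do rewrite nrm2BC.
Qed.

(** Once [J] contains [i], the difference of the two partial sums has squared norm at least
    [T * sqc (c i - d i)] by orthogonality, while it is bounded by twice the sum of two residuals
    that tend to 0. *)
Lemma ortho_coef_unique (e : K -> R -> R[i]) (T : R) (c d : K -> R[i]) F : 0 < T ->
  (forall i, sqint (e i)) ->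
  (forall i j, inner (e i) (e j) = if i == j then T%:C else 0) ->
  L2_sum (fun i x => c i * e i x) F -> L2_sum (fun i x => d i * e i x) F ->
  forall i, c i = d i.
Proof.
move=> T0 le oe /L2_sumP[i|lF cF]; first exact: sqintZ.
move=> /L2_sumP[i|_ dF]; first exact: sqintZ.
have FF : ProperFilter (@totally K) := totally_filter.
move=> i; apply/eqP; rewrite -subr_eq0 -sqc_eq0 eq_le sqc_ge0 andbT.
rewrite -(pmulr_rle0 _ T0).
apply: (cvgr_to_ge (cvg0_double_sum dF cF)); exists [fset i]%fset => // J /= iJ.
have {}iJ : i \in J by move/fsubsetP: iJ; apply; rewrite inE.
have ls (a : K -> R[i]) : sqint (fun x => \sum_(i <- J) a i * e i x).
  by apply: sqint_sum => k; exact: sqintZ.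
rewrite [leRHS]mulrDr; apply: le_trans _ (nrm2B_le (sqintB lF (ls d)) (sqintB lF (ls c))).
have -> : (fun x => F x - \sum_(i <- J) d i * e i x - (F x - \sum_(i <- J) c i * e i x)) =
    (fun x => \sum_(i <- J) (c i - d i) * e i x).
  apply/funext => x; under [in RHS]eq_bigr do rewrite mulrBl.
  by rewrite sumrB; ring.
rewrite (nrm2_ortho_sum le oe)// ler_pM2l//.
by rewrite (bigD1_seq i)//= lerDl sumr_ge0// => j _; exact: sqc_ge0.
Qed.

End L2Sum.

(** * The two sampling channels *)

Section EsumPairs.
Context {R : realType} {m : nat}.

Lemma esum_ord_pair (a : 'I_m -> int -> R) : (forall j n, 0 <= a j n) ->
  (\esum_(i in [set: 'I_m * int]) (a i.1 i.2)%:E =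
   \sum_(j < m) \esum_(n in [set: int]) (a j n)%:E)%E.
Proof.
move=> a0.
transitivity (\esum_(j in [set: 'I_m]) \esum_(n in [set: int]) (a j n)%:E)%E.
  rewrite esum_esum; last by move=> j n _ _; rewrite lee_fin.
  by congr (esum _ _); apply/seteqP; split.
rewrite esum_fset; last 2 first.
- exact: finite_finset.
- by move=> j _; apply: esum_ge0 => n _; rewrite lee_fin.
rewrite (fsbigE (index_enum 'I_m)); first by under eq_bigl do rewrite in_setT.
- exact: index_enum_uniq.
- by [].
- by move=> j _; rewrite mem_index_enum.
Qed.

End EsumPairs.

Lemma sume_ord2 (R : realType) (a : 'I_2 -> \bar R) :
  (\sum_(j < 2) a j = a ord0 + a (lift ord0 ord0))%E.
Proof. by rewrite !big_ord_recl big_ord0 adde0. Qed.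

Section Sampling.
Context {R : realType}.
Notation mu := (@lebesgue_measure R).
Implicit Types (f g c : R -> R[i]) (w t a : R).

Lemma translate_inv_fourier a g :
  translate a (inv_fourier g) = inv_fourier (fun xi => expi (a * xi) * g xi).
Proof.
apply/funext => x; rewrite /translate !inv_fourierE; congr (_ * cintegral _).
by apply/funext => xi; rewrite mulrDl expiD; ring.
Qed.

Lemma supported_expi w a g : supported w g -> supported w (fun xi => expi (a * xi) * g xi).
Proof. by move=> sg x /sg ->; rewrite mulr0. Qed.

Lemma inner_translate w a g c : 0 < w -> supported w g -> sqint g ->
    supported w c -> sqint c ->
  inner (inv_fourier g) (translate a (inv_fourier c)) =
  cintegral (fun xi => g xi * (c xi)^*%C * expi (- (a * xi))).
Proof.
move=> w0 sg lg sc lc; rewrite translate_inv_fourier.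
rewrite (inv_fourier_isometry w0 sg (supported_expi a sc) lg (sqint_expi a lc)).
rewrite innerE; congr cintegral; apply/funext => xi.
by rewrite conjcM expiJ; ring.
Qed.

(** As [translate] shifts by [x + a], the frame coefficient of index [n] corresponds to a sample at
    [- n * t]; the sampling formula compensates by the index [- k]. *)
Lemma sample_inv_fourier t g (n : int) :
  inv_fourier g (- (n%:~R * t)) = sqrt2piV%:C * trig_coef t n g.
Proof.
rewrite inv_fourierE; congr (_ * cintegral _); apply/funext => xi.
by rewrite mulNr.
Qed.

Lemma cint_trig t g (n : int) : cint g ->
  cint (fun x => g x * expi (- (n%:~R * t * x))).
Proof. by move=> cg; under eq_fun do rewrite -mulNr; exact: cint_expi. Qed.

Lemma trig_coefD t n f g : cint f -> cint g ->
  trig_coef t n (fun x => f x + g x) = trig_coef t n f + trig_coef t n g.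
Proof.
move=> cf cg; rewrite /trig_coef -cintegralD; [|exact: cint_trig..].
by under eq_fun do rewrite mulrDl.
Qed.

Lemma trig_coefZ t n z g : cint g ->
  trig_coef t n (fun x => z * g x) = z * trig_coef t n g.
Proof.
move=> cg; rewrite /trig_coef -(cintegralZ z (cint_trig t n cg)).
by under eq_fun do rewrite -mulrA.
Qed.

(** The multiplier has modulus 1 except at the single frequency 0. *)
Lemma nrm2_hsym g : sqint g -> nrm2 (hsym g) = nrm2 g.
Proof.
move=> lg; apply: rintegral_ae.
- by apply: cmeas_sqc; case: (sqint_hsym lg).
- by apply: cmeas_sqc; case: lg.
apply: (@negligibleS _ _ _ mu [set 0]); last first.
  by apply/negligibleP; [exact: measurable_set1|exact: (lebesgue_measure_set1 (0 : R))].
move=> x /=; apply: contra_notP => /eqP x0.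
by rewrite /hsym !sqcM sqcN sqc_i sqcR sqr_sg x0 !mul1r.
Qed.

(* Up to the value at 0, [(g + 'i hsym g) / 2] and [(g - 'i hsym g) / 2] are the
   restrictions of [g] to the positive and to the negative frequencies. Since
   [w <= 2 * pi / t], each is supported in a single period of [expi (t * _)]. *)
Lemma two_channel_parseval w t g : 0 < w -> 0 < t -> w <= 2 * pi / t ->
  supported w g -> sqint g ->
  (\esum_(n in [set: int]) (sqc (trig_coef t n g))%:E +
   \esum_(n in [set: int]) (sqc (trig_coef t n (hsym g)))%:E =
   (2 * (2 * pi / t) * nrm2 g)%:E)%E.
Proof.
move=> w0 t_gt0 wh sg lg; set h := 2 * pi / t in wh *.
have h0 : 0 < h by exact: lt_le_trans wh.
have TE : t = 2 * pi / h.
  by rewrite /h; have := pi_gt0 R; move: (@pi R) {wh h0 h} => p p0; field; rewrite !gt_eqF.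
have lh := sqint_hsym lg; have sh := supported_hsym sg.
have cg := cint_supported sg lg; have ch := cint_supported sh lh.
pose P e x := (2^-1)%:C * (g x + e%:C * 'i%C * hsym g x).
have lP e : sqint (P e) by apply/sqintZ/sqintD => //; exact: sqintZ.
have PE n e : trig_coef t n (P e) =
    (2^-1)%:C * (trig_coef t n g + e%:C * 'i%C * trig_coef t n (hsym g)).
  have ci : cint (fun x => e%:C * 'i%C * hsym g x) by exact: cintZ.
  rewrite trig_coefZ; last exact: cintD.
  by rewrite trig_coefD// trig_coefZ.
(* The parallelogram law; the factor 2 on the right is what survives of its own 2 after the two
   halvings, and ends up in the frame bound. *)
have sE n : sqc (trig_coef t n g) + sqc (trig_coef t n (hsym g)) =
    2 * sqc (trig_coef t n (P 1)) + 2 * sqc (trig_coef t n (P (-1))).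
  rewrite !PE; move: (trig_coef _ _ _) (trig_coef _ _ _) => a b.
  by rewrite /sqc !reimE !(mulr0, mulr1, mul0r, mul1r, subr0, sub0r, addr0, add0r); field.
have nE : nrm2 (P 1) + nrm2 (P (-1)) = nrm2 g.
  have E e : nrm2 (P e) = 4^-1 * nrm2 (fun x => g x + e%:C * 'i%C * hsym g x).
    rewrite nrm2Z; last by apply: sqintD => //; exact: sqintZ.
    by rewrite sqcR; congr (_ * _); field.
  have lih : sqint (fun x => 'i%C * hsym g x) by exact: sqintZ.
  have nih : nrm2 (fun x => 'i%C * hsym g x) = nrm2 g.
    by rewrite nrm2Z// sqc_i mul1r nrm2_hsym.
  rewrite !E.
  have -> : (fun x => g x + 1%:C * 'i%C * hsym g x) = (fun x => g x + 'i%C * hsym g x).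
    by apply/funext => x; rewrite mul1r.
  have -> : (fun x => g x + (-1)%:C * 'i%C * hsym g x) = (fun x => g x - 'i%C * hsym g x).
    by apply/funext => x; rewrite rmorphN1 mulN1r mulNr.
  by rewrite nrm2DE// nrm2BE// nih; field.
have vanish (e x : R) : Num.sg x = - e -> e ^+ 2 = 1 -> P e x = 0.
  move=> xe e2; rewrite /P /hsym xe.
  have -> : g x + e%:C * 'i%C * (- 'i%C * ((- e)%:C * g x)) = (1 - e ^+ 2)%:C * g x.
    by apply: complexP; rewrite !reimE !(mulr0, mul0r, mul1r, subr0, sub0r, addr0, add0r, oppr0); ring.
  by rewrite e2 subrr mul0r mulr0.
have supp0 x : ~ `[-w, w]%classic x -> forall e, P e x = 0.
  by move=> xw e; rewrite /P /hsym (sg _ xw) !mulr0 addr0 mulr0.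
have supp1 x : ~ `[0, 0 + h]%classic x -> P 1 x = 0.
  rewrite /= in_itv/= add0r => xh; have [x0|x0] := ltP x 0.
    by apply: vanish; rewrite ?expr1n// ltr0_sg.
  apply: supp0; rewrite /= in_itv/= => /andP[_ xw]; apply: xh.
  by rewrite x0 (le_trans xw wh).
have supp2 x : ~ `[- h, - h + h]%classic x -> P (-1) x = 0.
  rewrite /= in_itv/= addNr => xh; have [x0|x0] := ltP 0 x.
    by apply: vanish; rewrite ?sqrrN ?expr1n// gtr0_sg// opprK.
  apply: supp0; rewrite /= in_itv/= => /andP[xw _]; apply: xh.
  by rewrite x0 andbT (le_trans _ xw)// lerN2.
rewrite -esumD; [|by move=> n _; rewrite lee_fin sqc_ge0..].
under eq_esum do rewrite -EFinD sE EFinD.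
have p e a : (forall x, ~ `[a, a + h]%classic x -> P e x = 0) ->
    (\esum_(n in [set: int]) (2 * sqc (trig_coef t n (P e)))%:E =
     (2 * (h * nrm2 (P e)))%:E)%E.
  move=> sP; apply: esum_realZ => //; first by move=> n; exact: sqc_ge0.
  by rewrite TE; exact: (parseval h0 (lP e) sP).
rewrite esumD; [|by move=> n _; rewrite lee_fin mulr_ge0// sqc_ge0..].
by rewrite (p _ _ supp1) (p _ _ supp2) -EFinD -!mulrDr nE mulrA.
Qed.
End Sampling.

Section BandlimitedSpace.
Context {R : realType}.
Variable w : R.
Hypothesis w0 : 0 < w.
Implicit Types (f g : R -> R[i]).

Lemma bandlimited_sqint f : bandlimited w f -> sqint f.
Proof. by case=> _ /cLspace2P. Qed.

Lemma bandlimitedD f g : bandlimited w f -> bandlimited w g ->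
  bandlimited w (fun x => f x + g x).
Proof.
move=> /(bandlimited_repr w0)[p [sp lp ->]] /(bandlimited_repr w0)[q [sq lq ->]].
have -> : (fun x => inv_fourier p x + inv_fourier q x) = inv_fourier (fun x => p x + q x).
  by apply/funext => x; rewrite inv_fourierD//; exact: (@cint_supported _ w).
apply: (bandlimited_inv_fourier w0); last exact: sqintD.
by move=> x xw; rewrite sp// sq// addr0.
Qed.

Lemma bandlimitedZ z f : bandlimited w f -> bandlimited w (fun x => z * f x).
Proof.
move=> /(bandlimited_repr w0)[p [sp lp ->]].
have -> : (fun x => z * inv_fourier p x) = inv_fourier (fun x => z * p x).
  by apply/funext => x; rewrite inv_fourierZ//; exact: (@cint_supported _ w).
apply: (bandlimited_inv_fourier w0); last exact: sqintZ.
by move=> x xw; rewrite sp// mulr0.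
Qed.

Lemma bandlimited0 : bandlimited w (fun=> 0).
Proof.
have -> : (fun=> 0) = inv_fourier (fun=> 0) :> (R -> R[i]).
  apply/funext => x; rewrite inv_fourierE.
  by under eq_fun do rewrite mul0r; rewrite cintegral0 mulr0.
by apply: (bandlimited_inv_fourier w0) => //; exact: sqint0.
Qed.

Lemma bandlimited_sum (I : Type) (J : seq I) (F : I -> R -> R[i]) :
  (forall i, bandlimited w (F i)) -> bandlimited w (fun x => \sum_(i <- J) F i x).
Proof.
move=> BF; elim: J => [|i J IH].
  by under eq_fun do rewrite big_nil; exact: bandlimited0.
by under eq_fun do rewrite big_cons; exact: bandlimitedD.
Qed.

Lemma bandlimited_translate a f : bandlimited w f -> bandlimited w (translate a f).
Proof.
move=> /(bandlimited_repr w0)[p [sp lp ->]]; rewrite translate_inv_fourier.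
exact: (bandlimited_inv_fourier w0 (supported_expi a sp) (sqint_expi a lp)).
Qed.

End BandlimitedSpace.

Section TwoChannelFrame.
Context {R : realType}.
Variables (w t : R).
Hypotheses (w0 : 0 < w) (t0 : 0 < t) (wh : w <= 2 * pi / t).
Implicit Types (f g : R -> R[i]).
Notation h := (2 * pi / t).

Definition band : R -> R[i] := cindic (`[- w, w]%classic).

Lemma supported_band : supported w band.
Proof. by move=> x xw; rewrite /band /cindic indicE memNset. Qed.

Lemma sqint_band : sqint band.
Proof.
apply: sqint_cindic => //.
by rewrite lebesgue_measure_itv/=; case: ifP => _; rewrite -?EFinB ltry.
Qed.

Lemma conj_band x : ((band x)^*)%C = band x. Proof. exact: conjc_real. Qed.

Lemma mul_band g : supported w g -> forall x, g x * band x = g x.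
Proof.
move=> sg x; rewrite /band /cindic indicE.
by case: (boolP (x \in _)) => [_|]; rewrite ?mulr1// notin_setE => /sg ->; rewrite mul0r.
Qed.

(** Explicit forms of the two generators: the continuous functions [phi1] and [phi2] of the theorem
    are equal to them everywhere. *)
Definition channels := [tuple inv_fourier band; inv_fourier (hsym band)].
Notation s := (Defs.shift t channels).

Lemma bandlimited_channel j : bandlimited w (tnth channels j).
Proof.
have lb := sqint_band; have sb := supported_band.
case: j => -[|[|//]] ij; rewrite (tnth_nth (fun=> 0))/=.
  exact: (bandlimited_inv_fourier w0 sb lb).
exact: (bandlimited_inv_fourier w0 (supported_hsym sb) (sqint_hsym lb)).
Qed.

Lemma bandlimited_shift j n : bandlimited w (s j n).
Proof. exact: (bandlimited_translate w0 _ (bandlimited_channel j)). Qed.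

(** The multiplier of the Hilbert transform is purely imaginary, so moving it to the other side of
    the inner product changes the sign. *)
Lemma inner_shift g j n : supported w g -> sqint g ->
  inner (inv_fourier g) (s j n) =
  if j == 0 then trig_coef t n g else - trig_coef t n (hsym g).
Proof.
move=> sg lg; have lb := sqint_band; have sb := supported_band.
rewrite /Defs.shift; case: j => -[|[|//]] ij; rewrite (tnth_nth (fun=> 0))/=.
  rewrite (inner_translate _ w0 sg lg sb lb); congr cintegral.
  by apply/funext => x; rewrite conj_band mul_band.
rewrite (inner_translate _ w0 sg lg (supported_hsym sb) (sqint_hsym lb)).
rewrite -mulN1r -trig_coefZ; last exact: cint_supported (supported_hsym sg) (sqint_hsym lg).
congr cintegral; apply/funext => x; congr (_ * _).
rewrite /hsym -[in RHS](mul_band sg x) !conjcM conj_band conjc_real.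
have -> : ((- 'i%C)^*)%C = 'i%C :> R[i] by apply: complexP; rewrite !reimE ?oppr0 ?opprK.
by ring.
Qed.

Lemma esum_inner_shift f : bandlimited w f ->
  (\sum_(j < 2) \esum_(n in [set: int]) (sqc (inner f (s j n)))%:E = (2 * h * nrm2 f)%:E)%E.
Proof.
move=> /(bandlimited_repr w0)[g [sg lg ->]].
have [_ ->] := plancherel_supported w0 sg lg.
rewrite -[RHS](two_channel_parseval w0 t0 wh sg lg).
rewrite sume_ord2.
congr (_ + _)%E; apply: eq_esum => n _; rewrite inner_shift//=.
by rewrite sqcN.
Qed.

Lemma tight_shift f : bandlimited w f ->
  (\esum_(i in [set: 'I_2 * int]) (sqc (inner f (s i.1 i.2)))%:E = (2 * h * nrm2 f)%:E)%E.
Proof.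
move=> Bf; rewrite (esum_ord_pair (a := fun j n => sqc (inner f (s j n)))).
  exact: esum_inner_shift.
by move=> j n; exact: sqc_ge0.
Qed.

Lemma frame_bound_gt0 : 0 < 2 * h.
Proof. by rewrite mulr_gt0// (lt_le_trans w0). Qed.

Lemma channels_tight : frame_bounds w t channels (2 * h) (2 * h).
Proof.
move=> f Bf; have lf := bandlimited_sqint Bf.
under eq_bigr => j _ do under eq_esum do rewrite normc_sq.
rewrite esum_inner_shift//.
have -> : (cLnorm 2%:E f ^+ 2)%E = (nrm2 f)%:E.
  by rewrite cLnorm_sqr rintegralE//; case: lf.
by rewrite -EFinM !lexx.
Qed.

Lemma sqint_shift (i : 'I_2 * int) : sqint (s i.1 i.2).
Proof. exact: (bandlimited_sqint (bandlimited_shift i.1 i.2)). Qed.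

Lemma bandlimited_synthesis (J : seq ('I_2 * int)) (c : 'I_2 * int -> R[i]) :
  bandlimited w (fun x => \sum_(i <- J) c i * s i.1 i.2 x).
Proof.
by apply: (bandlimited_sum w0) => i; apply: (bandlimitedZ w0); exact: bandlimited_shift.
Qed.

Lemma frame_expansion (K : choiceType) (E : {fset K} -> seq ('I_2 * int)) f :
  bandlimited w f -> (forall L, uniq (E L)) ->
  (forall J : seq ('I_2 * int), exists L0 : {fset K}, forall L,
    (L0 `<=` L)%fset -> {subset J <= E L}) ->
  (fun L => nrm2 (fun x => (2 * h)%:C * f x -
      \sum_(i <- E L) inner f (s i.1 i.2) * s i.1 i.2 x)) @ totally --> 0.
Proof.
exact: (tight_expansion frame_bound_gt0 (@bandlimited_sqint R w) sqint_shift
  bandlimited_synthesis tight_shift).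
Qed.

Lemma synthesis_frame f : bandlimited w f ->
  is_synthesis t channels (fun j n => inner f (s j n)) (fun x => (2 * h)%:C * f x).
Proof.
move=> Bf; apply/L2_sumP => [i|]; first by apply: sqintZ; exact: sqint_shift.
split; first exact: sqintZ (bandlimited_sqint Bf).
apply: (frame_expansion (E := fun J => J)) => // [J|J]; first exact: fset_uniq.
exists [fset i | i in J]%fset => L /fsubsetP JL i iJ.
by apply: JL; rewrite inE.
Qed.

Lemma frame_operatorE f : bandlimited w f ->
  frame_operator w t channels f = (fun x => (2 * h)%:C * f x).
Proof.
move=> Bf; have Sf := synthesis_frame Bf.
have B2 := bandlimitedZ w0 (2 * h)%:C Bf.
rewrite /frame_operator; case: xgetP => [F _ [BF SF]|/(_ (fun x => (2 * h)%:C * f x))[]//].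
apply: continuous_ae_eq; [by case: BF|by case: B2|].
apply: (L2_sum_unique _ SF Sf) => i; apply: sqintZ; exact: sqint_shift.
Qed.

(** The frame operator is multiplication by the nonzero scalar [2 * h], so the preimage of a
    generator exists and is unique, and the choice in [dual_generator] is forced. *)
Lemma dual_generatorE j :
  dual_generator w t channels j = (fun x => ((2 * h)^-1)%:C * tnth channels j x).
Proof.
have Bj := bandlimited_channel j; have h0 := frame_bound_gt0.
have hK : (2 * h)%:C * ((2 * h)^-1)%:C = 1 :> R[i] by rewrite -rcM divff ?gt_eqF.
rewrite /dual_generator.
case: xgetP => [g _ [Bg Sg]|/(_ (fun x => ((2 * h)^-1)%:C * tnth channels j x))[]].
  by apply/funext => x; rewrite -Sg frame_operatorE// mulrA [X in X * _]mulrC hK mul1r.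
have B2 := bandlimitedZ w0 ((2 * h)^-1)%:C Bj.
split => //; rewrite frame_operatorE//.
by apply/funext => x; rewrite mulrA hK mul1r.
Qed.

Lemma nrm2_shift (i : 'I_2 * int) : nrm2 (s i.1 i.2) = 2 * w.
Proof.
have lb := sqint_band; have sb := supported_band.
have nb : nrm2 band = 2 * w.
  by rewrite nrm2_indic//= lebesgue_measure_itv/= lte_fin gtrN// -EFinB/= opprK mulr2n mulrDl mul1r.
have nt a g : supported w g -> sqint g -> nrm2 (translate a (inv_fourier g)) = nrm2 g.
  move=> sg lg; rewrite translate_inv_fourier.
  have [_ ->] := plancherel_supported w0 (supported_expi a sg) (sqint_expi a lg).
  exact: nrm2_expi.
rewrite /Defs.shift; case: i => -[[|[|//]] ij] n; rewrite (tnth_nth (fun=> 0))/=.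
  by rewrite nt.
by rewrite nt ?nrm2_hsym//; [exact: supported_hsym|exact: sqint_hsym].
Qed.

Lemma channels_riesz : h = w -> riesz_basis w t channels.
Proof.
move=> hw; split.
  by exists (2 * h), (2 * h); split; [exact: frame_bound_gt0|split; [exact: lexx|exact: channels_tight]].
move=> c d _ _ F cF dF; apply/funext => j; apply/funext => n.
have nA i : nrm2 (s i.1 i.2) = 2 * h by rewrite nrm2_shift hw.
have oe := tight_orthogonal bandlimited_synthesis tight_shift nA.
exact: (ortho_coef_unique frame_bound_gt0 sqint_shift oe cF dF (j, n)).
Qed.

End TwoChannelFrame.

(** * The reconstruction kernels *)

Section Kernels.
Context {R : realType}.
Notation mu := (@lebesgue_measure R).
Implicit Types (a b v w : R).

Lemma ae_off2 (P : R -> Prop) a b : (forall x, x != a -> x != b -> P x) ->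
  {ae mu, forall x, P x}.
Proof.
move=> h; apply: (@negligibleS _ _ _ mu ([set a] `|` [set b])); last first.
  by apply: negligibleU; apply/negligibleP;
    solve [exact: measurable_set1|exact: lebesgue_measure_set1].
move=> x /= nP; apply: contrapT => /not_orP[xa xb].
by apply: nP; apply: h; exact/eqP.
Qed.

Lemma cint_itv a b : cint (cindic (`]a, b]%classic)).
Proof.
have fin : (mu `]a, b]%classic < +oo)%E.
  by rewrite lebesgue_measure_itv/=; case: ifP => _; rewrite -?EFinB ltry.
apply: (@cint_sqint_supp _ _ (`]a, b]%classic)) => //; last exact: sqint_cindic.
by move=> x xab; rewrite /cindic indicE memNset.
Qed.

Lemma inv_fourier_itv a b v : a <= b -> v != 0 ->
  inv_fourier (cindic (`]a, b]%classic)) v = sqrt2piV%:C *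
  (((sin (v * b) - sin (v * a)) / v)%:C + 'i%C * ((cos (v * a) - cos (v * b)) / v)%:C).
Proof.
move=> ab v0; rewrite inv_fourierE; congr (_ * _).
rewrite -(rintegral_cos v0 ab) -(rintegral_sin v0 ab) [LHS]complex_algE.
congr (_%:C + _ * _%:C).
  rewrite Re_cintegral; congr rintegral.
  by apply/funext => x; rewrite ReZ Re_expi.
rewrite Im_cintegral; congr rintegral.
by apply/funext => x; rewrite ImZ Im_expi.
Qed.

Lemma inv_fourier_itv0 a b : a <= b ->
  inv_fourier (cindic (`]a, b]%classic)) 0 = sqrt2piV%:C * (b - a)%:C.
Proof.
move=> ab; rewrite inv_fourierE; congr (_ * _); apply: complexP.
  rewrite Re_cintegral cReR -(rintegral_itv1 ab); congr rintegral.
  by apply/funext => x; rewrite mul0r expi0 mulr1.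
rewrite Im_cintegral cImR -[RHS](@rintegral0 _ _ _ mu); congr rintegral.
by apply/funext => x; rewrite mul0r expi0 mulr1.
Qed.

Lemma inv_fourier_bandE w v : 0 < w ->
  inv_fourier (band w) v = inv_fourier (cindic (`]0, w]%classic)) v +
                           inv_fourier (cindic (`](- w), 0]%classic)) v.
Proof.
move=> w0; rewrite -inv_fourierD; [|exact: cint_itv..].
congr (_ v); apply: inv_fourier_ae.
- exact: cint_supported (@supported_band _ w) (@sqint_band _ w).
- by apply: cint_meas; apply: cintD; exact: cint_itv.
(* The half-open intervals miss the endpoint [- w] of the closed band. *)
apply: (@ae_off2 _ 0 (- w)) => x x0 xw.
rewrite /band /cindic -rcD; congr (_ %:C); rewrite !indicE !mem_setE !in_itv/=.
case: (ltgtP x 0) x0 => [x0 _|x0 _|//].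

  by rewrite add0r (ltW (lt_trans x0 w0)) !andbT le_eqVlt eq_sym (negbTE xw).
by rewrite andbF addr0 (le_trans _ (ltW x0))// oppr_le0 ltW.
Qed.

Lemma inv_fourier_hsym_bandE w v : 0 < w ->
  inv_fourier (hsym (band w)) v = - 'i%C * (inv_fourier (cindic (`]0, w]%classic)) v -
                           inv_fourier (cindic (`](- w), 0]%classic)) v).
Proof.
move=> w0; have c1 := @cint_itv 0 w; have c2 := @cint_itv (- w) 0.
have -> : inv_fourier (cindic (`]0, w]%classic)) v - inv_fourier (cindic (`](- w), 0]%classic)) v =
    inv_fourier (fun x => cindic (`]0, w]%classic) x + (-1) * cindic (`](- w), 0]%classic) x) v.
  by rewrite inv_fourierD ?inv_fourierZ ?mulN1r//; exact: cintZ.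
rewrite -inv_fourierZ; last by apply: cintD => //; exact: cintZ.
congr (_ v); apply: inv_fourier_ae.
- exact: cint_supported (supported_hsym (@supported_band _ w)) (sqint_hsym (@sqint_band _ w)).
- by apply: cint_meas; apply: cintZ; apply: cintD => //; exact: cintZ.
(* The two sides also differ at 0, where the sign vanishes but the left half-open interval has its
   endpoint. *)
apply: (@ae_off2 _ 0 (- w)) => x x0 xw.
rewrite /hsym /band /cindic; congr (_ * _); rewrite !indicE !mem_setE !in_itv/= mulN1r.
case: (ltgtP x 0) x0 => [x0 _|x0 _|//].
  by rewrite ltr0_sg// add0r (ltW (lt_trans x0 w0)) !andbT le_eqVlt eq_sym (negbTE xw) rmorphN1 mulN1r.
by rewrite gtr0_sg// mul1r andbF subr0 (le_trans _ (ltW x0))// oppr_le0 ltW.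
Qed.

(* Half of the band contributes [sin (v w) / v] to the real part and
   [+- (1 - cos (v w)) / v] to the imaginary part; with [y = w v / 2] these are
   [w cos y sinc y] and [w sin y sinc y]. *)
Lemma inv_fourier_half_bands w v : 0 < w -> let y := w * v / 2 in
  inv_fourier (cindic (`]0, w]%classic)) v =
    sqrt2piV%:C * ((w * (cos y * sinc y))%:C + 'i%C * (w * (sin y * sinc y))%:C) /\
  inv_fourier (cindic (`](- w), 0]%classic)) v =
    sqrt2piV%:C * ((w * (cos y * sinc y))%:C - 'i%C * (w * (sin y * sinc y))%:C).
Proof.
move=> w0 y; have nw0 : - w <= 0 by rewrite oppr_le0 ltW.
have [v0|v0] := eqVneq v 0.
  rewrite /y v0 mulr0 mul0r /sinc eqxx cos0 sin0 !inv_fourier_itv0 ?(ltW w0)//.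
  by rewrite !mul0r !mulr0 !mulr1 addr0 !subr0 sub0r opprK.
rewrite !inv_fourier_itv ?(ltW w0)//.
have y0 : y != 0 by rewrite /y !mulf_neq0// ?gt_eqF// invr_eq0 pnatr_eq0.
have vw : v * w = y + y by rewrite /y; field.
have vE : v^-1 = w / (2 * y) by rewrite /y; field; rewrite v0 gt_eqF.
rewrite /sinc (negbTE y0) mulr0 sin0 cos0 mulrN sinN cosN vw sinD cosD vE.
(* Eliminating the square of the cosine turns the double-angle expressions into [2 * s * c] and
   [2 * s ^+ 2]. *)
have := cos2Dsin2 y; move: (cos y) (sin y) => c s cs.
have -> : c * c = 1 - s ^+ 2 by rewrite -cs; ring.
split; congr (_ * _).
  by congr (_%:C + _ * _%:C); field.
have rcN (a : R) : - a%:C = (- a)%:C :> R[i] by exact/esym/rmorphN.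
by rewrite -[- ('i%C * _)]mulrN rcN; congr (_%:C + _ * _%:C); field.
Qed.

Lemma inv_fourier_band w v : 0 < w -> let y := w * v / 2 in
  inv_fourier (band w) v = sqrt2piV%:C * (2 * w * (cos y * sinc y))%:C.
Proof.
move=> w0 y; rewrite inv_fourier_bandE//.
have [-> ->] := inv_fourier_half_bands v w0.
by rewrite -/y -mulrDr addrACA subrr addr0 -rcD; congr (_ * _%:C); ring.
Qed.

Lemma inv_fourier_hsym_band w v : 0 < w -> let y := w * v / 2 in
  inv_fourier (hsym (band w)) v = sqrt2piV%:C * (2 * w * (sin y * sinc y))%:C.
Proof.
move=> w0 y; rewrite inv_fourier_hsym_bandE//.
have [-> ->] := inv_fourier_half_bands v w0.
rewrite -/y -mulrBr mulrCA; congr (_ * _).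
rewrite (_ : 2 * w * (sin y * sinc y) = w * (sin y * sinc y) + w * (sin y * sinc y)); last by ring.
rewrite rcD; move: (_%:C) (_%:C) => p q.
have ii : 'i%C * 'i%C = -1 :> R[i] by rewrite -expr2 sqr_i.
by transitivity (- ('i%C * 'i%C) * (p + p)); [ring|rewrite ii opprK mul1r].
Qed.

End Kernels.

(** * From the frame expansion to the Hilbert transform sampling formula *)

Section SamplingFormula.
Context {R : realType}.
Variables (w t : R).
Hypotheses (w0 : 0 < w) (t0 : 0 < t) (wh : w <= 2 * pi / t).
Implicit Types (f g : R -> R[i]).
Notation h := (2 * pi / t).
Notation s := (Defs.shift t (channels w)).
Notation ord1 := (lift ord0 ord0 : 'I_2).

Definition hilbert_sample f (k : int) (x : R) : R[i] :=
  let a : R := k%:~R * t in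
  let y : R := w * (x - a) / 2 in
  (w / h)%:C * (f a * (cos y)%:C * (sinc y)%:C
                - hilbert f a * (sin y)%:C * (sinc y)%:C).

Lemma shift0E n x : s ord0 n x = inv_fourier (band w) (x + n%:~R * t).
Proof. by []. Qed.

Lemma shift1E n x : s ord1 n x = inv_fourier (hsym (band w)) (x + n%:~R * t).
Proof. by []. Qed.

(** The constant [sqrt2piV] belongs to the sample on one side and to the kernel on the other. The
    kernels carry [2 * w], which gives [w / h] after division by [2 * h]. *)
Lemma hilbert_sampleE f k x : bandlimited w f ->
  hilbert_sample f k x = ((2 * h)^-1)%:C *
    (inner f (s ord0 (- k)) * s ord0 (- k) x + inner f (s ord1 (- k)) * s ord1 (- k) x).
Proof.
move=> /(bandlimited_repr w0)[g [sg lg ->]].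
rewrite /hilbert_sample (hilbert_inv_fourier w0 sg lg).
rewrite !(inner_shift t w0 _ _ sg lg) shift0E shift1E /=.
rewrite !inv_fourier_band// !inv_fourier_hsym_band//.
have sample u : inv_fourier u (k%:~R * t) = sqrt2piV%:C * trig_coef t (- k) u.
  by rewrite -sample_inv_fourier rmorphN mulNr opprK.
have -> : x + (- k)%:~R * t = x - k%:~R * t by rewrite rmorphN mulNr.
rewrite !sample; set y := w * (x - _) / 2.
have hE : (w / h)%:C = ((2 * h)^-1)%:C * (2 * w)%:C :> R[i].
  rewrite -rcM; congr (_%:C); have := lt_le_trans w0 wh.
  by move: h => H H0; field; rewrite gt_eqF.
by rewrite hE !(rcM (2 * w)) !(rcM _ (sinc y)); ring.
Qed.

Lemma sampling_formula f : bandlimited w f -> L2_sum (hilbert_sample f) f.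
Proof.
move=> Bf; have lf := bandlimited_sqint Bf.
have h0 := frame_bound_gt0 w0 wh.
have Sx k x : hilbert_sample f k x = ((2 * h)^-1)%:C *
    (inner f (s ord0 (- k)) * s ord0 (- k) x + inner f (s ord1 (- k)) * s ord1 (- k) x).
  exact: hilbert_sampleE.
have ls j n : sqint (s j n) := sqint_shift t w0 (j, n).
have lS k : sqint (hilbert_sample f k).
  rewrite (funext (Sx k)); apply: sqintZ; apply: sqintD; exact: sqintZ.
apply/(L2_sumP _ lS); split=> //.
have FF : ProperFilter (@totally int) := totally_filter.
(* A finite set of sampling points uses both channels at each point, with the opposite index, so
   partial sums of the formula are partial sums of the frame expansion. *)
pose E (L : {fset int}) : seq ('I_2 * int) :=
  [seq (ord0, - k) | k <- L] ++ [seq (ord1, - k) | k <- L].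
have uE L : uniq (E L).
  have inj j : injective (fun k : int => (j, - k) : 'I_2 * int) by move=> a b [/oppr_inj].
  rewrite cat_uniq !(map_inj_uniq (inj _)) fset_uniq/= andbT.
  by apply/hasPn => _ /mapP[k _ ->]; apply/mapP => -[].
have exE (J : seq ('I_2 * int)) : exists L0 : {fset int},
    forall L, (L0 `<=` L)%fset -> {subset J <= E L}.
  (* The sampling points at which some element of [J] occurs. *)
  exists [fset - i.2 | i in J]%fset => L /fsubsetP JL -[j n] jJ.
  have nL : - n \in L by apply: JL; apply/imfsetP; exists (j, n).
  rewrite mem_cat; apply/orP.
  case: j jJ => -[|[|//]] ij jJ; [left|right]; apply/mapP; exists (- n) => //;
    by rewrite opprK; congr (_, _); exact: val_inj.
apply: (squeeze0 (c := sqc ((2 * h)^-1)%:C) _ (frame_expansion w0 t0 wh Bf uE exE)) => L.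
rewrite nrm2_ge0/= -nrm2Z; last first.
  by apply: sqintB; [exact: sqintZ|apply: sqint_sum => i; exact: sqintZ].
rewrite le_eqVlt; apply/orP; left; apply/eqP; congr nrm2; apply/funext => x.
have hK : ((2 * h)^-1)%:C * (2 * h)%:C = 1 :> R[i] by rewrite -rcM mulVf// gt_eqF.
rewrite mulrBr (mulrA _ _ (f x)) hK mul1r; congr (_ - _).
under eq_bigr do rewrite Sx.
by rewrite -mulr_sumr big_split big_cat !big_map.
Qed.

End SamplingFormula.

Theorem corollary5p2 (R : realType) (w t0 : R) (phi1 phi2 : R -> R[i])
    (w_gt0 : 0 < w) (t0_gt0 : 0 < t0)
    (phi1_B : bandlimited w phi1) (phi2_B : bandlimited w phi2)
    (phi1_hat : is_fourier phi1 (fun xi : R => (\1_(`[- w, w]) xi)%:C))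
    (phi2_hat : is_fourier phi2
       (fun xi : R => - 'i%C * (\1_(`[- w, w]) xi)%:C * (Num.sg xi)%:C)) :
  let h : R := 2 * pi / t0 in
  let Phi := [tuple phi1; phi2] in
  [/\ w <= h < 2 * w ->
        tight_frame w t0 Phi /\
        forall i : 'I_2,
          dual_generator w t0 Phi i =
            (fun x => ((2 * h)^-1)%:C * tnth Phi i x),
      h = w -> riesz_basis w t0 Phi &
      w <= h < 2 * w ->
        forall f : R -> R[i], bandlimited w f ->
          L2_sum
            (fun (k : int) (x : R) =>
               let a : R := k%:~R * t0 in
               let y : R := w * (x - a) / 2 in
               (w / h)%:C *
                 (f a * (cos y)%:C * (sinc y)%:C
                  - hilbert f a * (sin y)%:C * (sinc y)%:C))
            f].
Proof.
have c1 : continuous (phi1 : R -> R[i]^o) by case: phi1_B.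
have c2 : continuous (phi2 : R -> R[i]^o) by case: phi2_B.
(* Continuity and the prescribed transform determine each generator everywhere. *)
have phi1E : phi1 = inv_fourier (band w).
  apply: (fourier_repr w_gt0 c1 phi1_hat (@supported_band R w) (@sqint_band R w)).
  exact: aeW.
have phi2E : phi2 = inv_fourier (hsym (band w)).
  apply: (fourier_repr w_gt0 c2 phi2_hat (supported_hsym (@supported_band R w))
    (sqint_hsym (@sqint_band R w))).
  by apply: aeW => x; rewrite /hsym -mulrA [X in _ * X]mulrC.
rewrite phi1E phi2E => h Phi; split.
- move=> /andP[wh _]; split.
    exists (2 * h); split; first exact: (frame_bound_gt0 w_gt0 wh).
    exact: (channels_tight w_gt0 t0_gt0 wh).
  by move=> i; exact: (dual_generatorE w_gt0 t0_gt0 wh).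
- move=> hw; have wh : w <= h by rewrite hw.
  exact: (channels_riesz w_gt0 t0_gt0 wh hw).
- by move=> /andP[wh _] f; exact: (sampling_formula w_gt0 t0_gt0 wh).
Qed.
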